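(* Suppose that the mesh bound $|\mathcal O|\le\frac{m(\Omega)}{\alpha}h^{-\ell}$ holds and that the numerical fluxes are monotone, conservative, regular and consistent, as described in the context. Let $u_{\mathcal O,\delta t}$ be an approximate solution of problem $(P)$ defined by the implicit finite volume scheme described in the context. Let $T>0$ and set $N=\max\{n\in\mathbb N:\ n<T/\delta t\}$. Then there exists $C=C(\|f\|_{L^\infty},u_{\max},T,|\Omega|)\ge0$ such that $$\sum_{n=0}^N\delta t\sum_{K|L}\Big[\max_{u_L^{n+1}\le c\le d\le u_K^{n+1}}\big(F_{K,L}(d,c)-F_{K,L}(d,d)\big)\Big]+\sum_{n=0}^N\delta t\sum_{K|L}\Big[\max_{u_L^{n+1}\le c\le d\le u_K^{n+1}}\big(F_{K,L}(d,c)-F_{K,L}(c,c)\big)\Big]\le\frac{C}{\sqrt h},$$ where $\sum_{K|L}$ runs over the interfaces between neighbouring control volumes $K$ and $L\in\mathcal N(K)$, with the convention $u_K^{n+1}\ge u_L^{n+1}$.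
   Context: Data. Let $\ell\ge1$, $\Omega\subset\mathbb R^\ell$ a bounded open set with Lipschitz boundary, $|\Omega|$ its measure, $\eta$ the outward unit normal to $\partial\Omega$, $Q=(0,T)\times\Omega$, $u_{\max}>0$. The $\mathbb R^\ell$-valued function $f$ is continuous with $f(0)=f(u_{\max})=0$; $\|f\|_{L^\infty}$ is its sup norm on $[0,u_{\max}]$. The function $\phi$ is nondecreasing and Lipschitz continuous in $[0,u_{\max}]$, and for some $u_c\in[0,u_{\max}]$, $\phi\equiv0$ on $[0,u_c]$ and $\phi$ is strictly increasing on $[u_c,u_{\max}]$. The couple $(f,\phi)$ is non-degenerate: for every $\xi\in\mathbb R^\ell\setminus\{0\}$ the function $\lambda\mapsto\sum_i\xi_if_i(\lambda)$ is not affine on the non-degenerate subintervals of $[0,u_c]$. The initial datum $u_0$ takes values in $[0,u_{\max}]$. Problem $(P)$: $u_t+\operatorname{div}f(u)-\Delta\phi(u)=0$ in $Q$, $u(0,\cdot)=u_0$ in $\Omega$, $(f(u)-\nabla\phi(u))\cdot\eta=0$ on $(0,T)\times\partial\Omega$. Mesh. $\mathcal O$ is a family of disjoint connected polygonal control volumes $K\subset\Omega$ whose closures have union $\overline\Omega$, the common interface of two control volumes being included in a hyperplane; $h=\sup_K\operatorname{diam}K$. There is $\alpha>0$ with $\alpha h^\ell\le m(K)$ and $m(\partial K)\le\frac1\alpha h^{\ell-1}$ for all $K$, which gives $|\mathcal O|\le\frac{m(\Omega)}{\alpha}h^{-\ell}$ for the number $|\mathcal O|$ of control volumes; $m$ denotes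 $\ell$- or $(\ell-1)$-dimensional measure. $\mathcal N(K)$ is the set of neighbours of $K$; $K|L$ is the common edge of $K$ and $L\in\mathcal N(K)$; $\bar\varepsilon_K$ is the set of all edges of $K$ (including those on $\partial\Omega$); $n_{K,\sigma}$ is the unit normal to $\sigma$ outward to $K$. The mesh is admissible: there are points $x_K\in K$ such that the line $x_Kx_L$ is orthogonal to $K|L$; $d_{K,L}=|x_K-x_L|$, $\tau_{K|L}=m(K|L)/d_{K,L}$. Numerical fluxes. For $K\in\mathcal O$, $\sigma\in\bar\varepsilon_K$, the flux $F_{K,\sigma}:\mathbb R^2\to\mathbb R$ (written $F_{K,L}$ if $\sigma=K|L$) satisfies, for arguments in $[0,u_{\max}]$: (monotone) $F_{K,\sigma}(a,b)$ is nondecreasing in $a$ and nonincreasing in $b$; (conservative) $F_{K,L}(a,b)=-F_{L,K}(b,a)$; (regular) $F_{K,\sigma}$ is Lipschitz continuous with Lipschitz constant $m(\sigma)M$; (consistent) $F_{K,\sigma}(s,s)=m(\sigma)f(s)\cdot n_{K,\sigma}$. Scheme. With time step $\delta t>0$: $u_K^0=\frac1{m(K)}\int_Ku_0\,dx$, and for all $n\ge0$, $K\in\mathcal O$, $$m(K)\frac{u_K^{n+1}-u_K^n}{\delta t}+\sum_{L\in\mathcal N(K)}F_{K,L}(u_K^{n+1},u_L^{n+1})-\sum_{L\in\mathcal N(K)}\tau_{K|L}\big(\phi(u_L^{n+1})-\phi(u_K^{n+1})\big)=0$$ (fluxes through boundary edges are zero). If the scheme has a solution, the function $u_{\mathcal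 O,\delta t}(t,x)=u_K^{n+1}$ for $x\in K$, $t\in(n\delta t,(n+1)\delta t]$ is called an approximate solution of $(P)$.
   Formalization: C may also depend on Ω itself, ℓ, α and M (with C depending only on the listed data the bound fails); δt ≤ T is assumed (for δt > T the bound fails); approximate solutions are taken with values in [0,u_max], where f, φ and the fluxes are specified. *)

(* Defs.v *)
From HB Require Import structures.
From mathcomp Require Import all_boot all_order all_algebra.
From mathcomp Require Import all_classical all_reals all_analysis.
Set Implicit Arguments.
Unset Strict Implicit.
Unset Printing Implicit Defensive.
Import Order.TTheory GRing.Theory Num.Theory numFieldNormedType.Exports.
Local Open Scope classical_set_scope.
Local Open Scope ring_scope.

(* The product (= Borel) sigma-algebra of R^l, generated by the coordinates. *)
Section measurable_rV.
Context {R : realType} {l : nat}.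

Definition rV_sigma_algebra : set (set 'rV[R]_l) :=
  g_sigma_preimage (fun (i : 'I_l) (x : 'rV[R]_l) => x ord0 i : measurableTypeR R).

Let rV_set0 : rV_sigma_algebra set0. Proof. exact: sigma_algebra0. Qed.
Let rV_setC A : rV_sigma_algebra A -> rV_sigma_algebra (~` A).
Proof. exact: sigma_algebraC. Qed.
Let rV_bigcup (F : (set 'rV[R]_l)^nat) :
  (forall i, rV_sigma_algebra (F i)) -> rV_sigma_algebra (\bigcup_i F i).
Proof. exact: sigma_algebra_bigcup. Qed.

HB.instance Definition _ := @isMeasurable.Build
  (measure_tuple_display default_measure_display)
  'rV[R]_l rV_sigma_algebra rV_set0 rV_setC rV_bigcup.
End measurable_rV.

Section lebesgue_rV.
Local Open Scope ereal_scope.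
Context {R : realType}.

Lemma measurable_coord (l : nat) (i : 'I_l) :
  measurable_fun [set: 'rV[R]_l]
    (fun x : 'rV[R]_l => x ord0 i : measurableTypeR R).
Proof.
move=> _ Y mY; rewrite setTI; apply: sub_sigma_algebra => /=.
rewrite -bigcup_seq/=; exists i => /=; first by rewrite mem_index_enum.
by exists Y => //; rewrite setTI.
Qed.

Lemma measurable_rVP (l : nat) d (T : measurableType d) (f : T -> 'rV[R]_l) :
  (forall i, measurable_fun [set: T] (fun x => f x ord0 i : measurableTypeR R)) ->
  measurable_fun [set: T] f.
Proof.
move=> mf _ A mA; rewrite setTI.
suff : preimage_set_system setT f measurable `<=` measurable.
  by apply; exists A => //; rewrite setTI.
rewrite -[X in preimage_set_system _ _ X]/(rV_sigma_algebra).
rewrite -g_sigma_preimage_comp.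
apply: smallest_sub; first exact: sigma_algebra_measurable.
move=> B; rewrite -bigcup_seq => -[i _ [C mC <-]].
exact: mf.
Qed.

Section step.
Variables (l : nat) (mu : {sigma_finite_measure set 'rV[R]_l -> \bar R}).

Definition cons_rV (p : measurableTypeR R * 'rV[R]_l) : 'rV[R]_l.+1 :=
  row_mx (p.1%:M : 'rV[R]_1) p.2.

Lemma measurable_cons_rV : measurable_fun setT cons_rV.
Proof.
apply: measurable_rVP => i.
case: (split_ordP (i : 'I_(1 + l))) => j ->.
  rewrite (_ : (fun _ => _) = fst) //; apply/funext => p.
  have -> : cons_rV p ord0 (lshift l j) = (p.1%:M : (matrix (measurableTypeR R) 1 1)) ord0 j by exact: (@row_mxEl _ 1 1 l (p.1%:M : matrix (measurableTypeR R) 1 1)).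
  by rewrite mxE (ord1 j) eqxx.
rewrite (_ : (fun _ => _) = (fun x : 'rV_l => x ord0 j : measurableTypeR R) \o snd); last first.
  by apply/funext => p; exact: (@row_mxEr _ 1 1 l (p.1%:M : matrix R 1 1) p.2).
by apply: measurableT_comp => //; exact: measurable_coord.
Qed.

Definition lebesgue_cons : set 'rV[R]_l.+1 -> \bar R :=
  pushforward (@lebesgue_measure R \x mu) cons_rV.

Let pm : {measure set _ -> \bar R} :=
  @measure_function_pushforward__canonical__measure_function_Measure
   _ _ _ _ _ (@lebesgue_measure R \x mu) _ measurable_cons_rV.

HB.instance Definition _ := Measure.copy lebesgue_cons pm.

Definition uncons_rV (x : 'rV[R]_l.+1) : measurableTypeR R * 'rV[R]_l :=
  (x ord0 ord0, \row_j x ord0 (lift ord0 j)).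

Lemma cons_rVK : cancel cons_rV uncons_rV.
Proof.
move=> [a x]; rewrite /uncons_rV; congr pair.
  have -> : ord0 = lshift l ord0 :> 'I_(1 + l) by exact/val_inj.
  by rewrite (@row_mxEl _ 1 1 l (a%:M : matrix R 1 1)) mxE.
apply/rowP => j; rewrite mxE.
have -> : lift ord0 j = rshift 1 j :> 'I_(1 + l) by exact/val_inj.
exact: (@row_mxEr _ 1 1 l (a%:M : matrix R 1 1) x).
Qed.

Lemma measurable_uncons_rV : measurable_fun setT uncons_rV.
Proof.
apply/measurable_fun_pairP; split; first exact: measurable_coord.
apply: measurable_rVP => i /=.
rewrite (_ : (fun _ => _) =
  (fun x : 'rV[R]_l.+1 => x ord0 (lift ord0 i) : measurableTypeR R)).
  exact: measurable_coord.
by apply/funext => x /=; rewrite mxE.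
Qed.

Let sigma_finite_lebesgue_cons : sigma_finite setT lebesgue_cons.
Proof.
have /sigma_finiteP[F [TF ndF Foo]] := sigma_finiteT (@lebesgue_measure R).
have /sigma_finiteP[G [TG ndG Goo]] := sigma_finiteT mu.
exists (fun n => uncons_rV @^-1` (F n `*` G n)).
  rewrite -preimage_bigcup; apply/esym/seteqP; split => // x _ /=.
  have : setT (uncons_rV x).1 by [].
  have : setT (uncons_rV x).2 by [].
  rewrite [in X in X -> _]TG [in X in _ -> X -> _]TF => -[k _ Gk] [n _ Fn].
  exists (maxn n k) => //; split.
    by move: Fn; exact/subsetPset/ndF/leq_maxl.
  by move: Gk; exact/subsetPset/ndG/leq_maxr.
move=> n; have [mF Fn] := Foo n; have [mG Gn] := Goo n; split.
  rewrite -[X in measurable X]setTI; apply: measurable_uncons_rV => //.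
  exact: measurableX.
rewrite /lebesgue_cons /pushforward -comp_preimage.
rewrite (_ : uncons_rV \o cons_rV = id); last first.
  by apply/funext => p; exact: cons_rVK.
by rewrite preimage_id product_measure1E// lte_mul_pinfty// ge0_fin_numE.
Qed.

HB.instance Definition _ := Measure_isSigmaFinite.Build _ _ _ lebesgue_cons
  sigma_finite_lebesgue_cons.
End step.

(* l-dimensional Lebesgue measure, the iterated product of the measure on R;
   its values on boxes are computed in [lebesgue_rV_box]. *)
Fixpoint lebesgue_rV (l : nat) : {sigma_finite_measure set 'rV[R]_l -> \bar R} :=
  if l is l'.+1 then lebesgue_cons (lebesgue_rV l') else \d_(0%R : 'rV[R]_0).
End lebesgue_rV.
Lemma lebesgue_rV_box (R : realType) (l : nat) (a b : 'rV[R]_l) :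
  (forall i, a ord0 i <= b ord0 i) ->
  lebesgue_rV l [set x : 'rV[R]_l | forall i, x ord0 i \in `[a ord0 i, b ord0 i]] =
  (\prod_(i < l) (b ord0 i - a ord0 i))%:E.
Proof.
elim: l a b => [|l IH] a b ab.
  by rewrite big_ord0 /= diracE mem_set //= => -[].
rewrite big_ord_recl EFinM /=.
pose a' := \row_j a ord0 (lift ord0 j); pose b' := \row_j b ord0 (lift ord0 j).
rewrite /lebesgue_cons /pushforward.
rewrite (_ : _ @^-1` _ = `[a ord0 ord0, b ord0 ord0] `*`
   [set x : 'rV[R]_l | forall i, x ord0 i \in `[a' ord0 i, b' ord0 i]]).
  rewrite product_measure1E //; last first.
    rewrite (_ : [set x | _] = \bigcap_i ((fun x : 'rV[R]_l => x ord0 i : measurableTypeR R) @^-1` `[a' ord0 i, b' ord0 i])).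
      apply: fin_bigcap_measurable => // i _.
      by rewrite -[X in measurable X]setTI; apply: measurable_coord.
    by apply/seteqP; split => x /= h i; [move=> _; exact: h | exact: (h i Logic.I)].
  rewrite IH; last by move=> i; rewrite !mxE.
  rewrite [X in (X * _)%E](_ : _ = lebesgue_measure ([set` `[a ord0 ord0, b ord0 ord0]] : set R)) //.
  rewrite lebesgue_measure_itv /= lte_fin.
  have -> : (if a ord0 ord0 < b ord0 ord0 then ((b ord0 ord0)%:E - (a ord0 ord0)%:E)%E else 0%E) = (b ord0 ord0 - a ord0 ord0)%:E.
    by case: ltgtP (ab ord0) => // -> _; rewrite subrr.
  by congr ((_ * _%:E)%E); apply: eq_bigr => i _; rewrite !mxE.
have E0 (p : measurableTypeR R * 'rV[R]_l) : cons_rV p ord0 ord0 = p.1.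
  exact: (congr1 fst (cons_rVK p)).
have ES (p : measurableTypeR R * 'rV[R]_l) j :
    cons_rV p ord0 (lift ord0 j) = p.2 ord0 j.
  by have /rowP/(_ j) := congr1 snd (cons_rVK p); rewrite /= mxE.
apply/seteqP; split => p /=.
  move=> h; split; first by have := h ord0; rewrite /= E0.
  by move=> i; have := h (lift ord0 i); rewrite /= ES !mxE.
move=> [h1 h2] i; case: (unliftP ord0 i) => [j|] ->; rewrite ?E0 ?ES //.
by have := h2 j; rewrite !mxE.
Qed.

Section euclidean.
Context {R : realType} {l : nat}.
Implicit Types (A : set 'rV[R]_l) (x y n : 'rV[R]_l).

Definition dotv x y : R := \sum_(i < l) x ord0 i * y ord0 i.

(* The library norm on 'rV is the sup norm. *)
Definition enorm x : R := Num.sqrt (dotv x x).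

Definition diam A : R := sup [set enorm (p.1 - p.2) | p in A `*` A].

Definition boundary A : set 'rV[R]_l := closure A `\` A°.

Definition hyperplane n (c : R) : set 'rV[R]_l := [set x | dotv n x = c].

Definition volume A : R := fine (lebesgue_rV l A).

(* (l-1)-dimensional measure of a subset A of a hyperplane with unit normal n:
   by Fubini it is the l-dimensional volume of the right prism of base A and
   height 1. *)
Definition hvolume n A : R :=
  volume [set x + t *: n | x in A & t in `[- 2^-1, 2^-1]].

(* A is a (relatively open) polytope of the hyperplane with normal n through
   its points: its relative boundary lies in finitely many hyperplanes
   transversal to that one. *)
Definition flat_polytope n A : Prop :=
  [/\ A !=set0,
      exists c, exists2 U, open U & A = U `&` hyperplane n c &
      exists2 H : seq ('rV[R]_l * R),
        (forall p, p \in H -> forall a, p.1 <> a *: n) &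
        forall x, (closure A `\` A) x -> exists2 p, p \in H & dotv p.1 x = p.2].

(* Near each boundary point, Omega is the part lying below the graph of a
   Lipschitz function in some orthonormal frame with vertical direction e. *)
Definition lipschitz_boundary (Omega : set 'rV[R]_l) : Prop :=
  forall x, boundary Omega x ->
  exists (r k : R) (e : 'rV[R]_l) (g : 'rV[R]_l -> R),
    [/\ 0 < r, enorm e = 1,
        (forall y z, `|g y - g z| <= k * enorm (y - z)) &
        forall y, enorm (y - x) < r ->
          (Omega y <-> dotv y e < g (y - dotv y e *: e))].

Definition sup_norm (umax : R) (f : R -> 'rV[R]_l) : R :=
  sup [set enorm (f s) | s in `[0, umax]].

Definition nondegenerate (uc : R) (f : R -> 'rV[R]_l) : Prop :=
  forall xi, xi != 0 -> forall a b, 0 <= a -> a < b -> b <= uc ->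
  ~ exists p q : R, forall s, s \in `[a, b] -> dotv xi (f s) = p * s + q.

Record problem_data (umax uc : R) (f : R -> 'rV[R]_l) (phi : R -> R)
    (Omega : set 'rV[R]_l) (u0 : 'rV[R]_l -> R) : Prop := ProblemData {
  f_continuous : {within `[0, umax], continuous f};
  f_0 : f 0 = 0;
  f_umax : f umax = 0;
  phi_nondecreasing : {in `[0, umax] &, {homo phi : s t / s <= t}};
  phi_lipschitz : exists k : R, {in `[0, umax] &, forall s t,
    `|phi s - phi t| <= k * `|s - t|};
  uc_itv : uc \in `[0, umax];
  phi_degenerate : {in `[0, uc], forall s, phi s = 0};
  phi_increasing : {in `[uc, umax] &, {homo phi : s t / s < t}};
  f_phi_nondegenerate : nondegenerate uc f;
  u0_measurable : measurable_fun Omega u0;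
  u0_itv : forall x, Omega x -> u0 x \in `[0, umax] }.

End euclidean.

(* [cv] indexes the control volumes and [edge] the edges; [edges K] is the set
   of all edges of K, [normal K s] the unit normal to s outward to K, and
   [centre K] the point x_K. *)
Record mesh (R : realType) (l : nat) := Mesh {
  cv : finType;
  edge : finType;
  cvset : cv -> set 'rV[R]_l;
  edgeset : edge -> set 'rV[R]_l;
  edges : cv -> {set edge};
  normal : cv -> edge -> 'rV[R]_l;
  centre : cv -> 'rV[R]_l }.

Section scheme.
Context {R : realType} {l : nat}.
Variables (Omega : set 'rV[R]_l) (m : mesh R l).
Implicit Types (K L : cv m) (s : edge m).

(* The edges common to two control volumes: by [interface_unique] below this is
   [set K|L] if L is a neighbour of K, and it is empty otherwise. Hence a sum
   over L \in N(K) of terms attached to K|L is a double sum over L and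
   s \in interface K L. *)
Definition interface K L : {set edge m} :=
  if K == L then finset.set0 else edges K :&: edges L.

(* Edges are relatively open and pairwise disjoint. *)
Record admissible_mesh : Prop := AdmissibleMesh {
  cv_open : forall K, open (cvset K);
  cv_nonempty : forall K, cvset K !=set0;
  cv_connected : forall K, connected (cvset K);
  cv_sub : forall K, cvset K `<=` Omega;
  cv_disjoint : forall K L, K != L -> cvset K `&` cvset L = set0;
  cv_cover : \bigcup_(K in [set: cv m]) closure (cvset K) = closure Omega;
  cv_polygonal : forall K,
    boundary (cvset K) = \bigcup_(s in [set` edges K]) closure (edgeset s);
  edge_polytope : forall K s, s \in edges K ->
    flat_polytope (normal K s) (edgeset s);
  edge_disjoint : forall s t, s != t -> edgeset s `&` edgeset t = set0;
  normal_unit : forall K s, s \in edges K -> enorm (normal K s) = 1;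
  normal_outward : forall K s, s \in edges K -> forall x, edgeset s x ->
    \forall t \near 0^'+, cvset K (x - t *: normal K s) /\
                          ~ cvset K (x + t *: normal K s);
  edge_dichotomy : forall K s, s \in edges K ->
    edgeset s `<=` boundary Omega \/ exists L, s \in interface K L;
  interface_unique : forall K L s t,
    s \in interface K L -> t \in interface K L -> s = t;
  centre_in : forall K, cvset K (centre K);
  centre_orthogonal : forall K L s, s \in interface K L ->
    exists a, centre L - centre K = a *: normal K s }.

Definition mesh_size : R := \big[Num.max/0]_(K : cv m) diam (cvset K).

Definition edge_measure K s : R := hvolume (normal K s) (edgeset s).

Definition transmissibility K L s : R :=
  edge_measure K s / enorm (centre K - centre L).

Definition regular_mesh (alpha : R) : Prop :=
  [/\ (forall K, alpha * mesh_size ^+ l <= volume (cvset K)),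
      (forall K, \sum_(s in edges K) edge_measure K s
                   <= alpha^-1 * mesh_size ^+ l.-1) &
      #|cv m|%:R <= volume Omega / alpha * mesh_size ^- l].

Record numerical_flux (umax M : R) (f : R -> 'rV[R]_l)
    (F : cv m -> edge m -> R -> R -> R) : Prop := NumericalFlux {
  flux_nondecreasing : forall K s, s \in edges K ->
    {in `[0, umax] & &, forall a a' b, a <= a' -> F K s a b <= F K s a' b};
  flux_nonincreasing : forall K s, s \in edges K ->
    {in `[0, umax] & &, forall a b b', b <= b' -> F K s a b' <= F K s a b};
  flux_conservative : forall K L s, s \in interface K L ->
    {in `[0, umax] &, forall a b, F K s a b = - F L s b a};
  flux_lipschitz : forall K s, s \in edges K ->
    forall a b a' b', a \in `[0, umax] -> b \in `[0, umax] ->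
      a' \in `[0, umax] -> b' \in `[0, umax] ->
      `|F K s a b - F K s a' b'|
        <= edge_measure K s * M * (`|a - a'| + `|b - b'|);
  flux_consistent : forall K s, s \in edges K ->
    {in `[0, umax], forall a,
      F K s a a = edge_measure K s * dotv (f a) (normal K s)} }.

(* [u n K] is u_K^n: the approximate solution is the function equal to u n.+1 K
   on (n dt, (n+1) dt] x K. As f, phi and the fluxes are only specified on [0, umax],
   so are the values of a solution. *)
Record approximate_solution (umax dt : R) (phi : R -> R)
    (F : cv m -> edge m -> R -> R -> R) (u0 : 'rV[R]_l -> R)
    (u : nat -> cv m -> R) : Prop := ApproximateSolution {
  solution_itv : forall n K, u n K \in `[0, umax];
  solution_init : forall K,
    u 0%N K = (volume (cvset K))^-1
              * fine (\int[lebesgue_rV l]_(x in cvset K) (u0 x)%:E);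
  solution_scheme : forall n K,
    volume (cvset K) * ((u n.+1 K - u n K) / dt)
    + \sum_(L : cv m) \sum_(s in interface K L) F K s (u n.+1 K) (u n.+1 L)
    - \sum_(L : cv m) \sum_(s in interface K L)
        transmissibility K L s * (phi (u n.+1 L) - phi (u n.+1 K)) = 0 }.

(* Sum over the interfaces K|L, oriented so that v K >= v L. Interfaces with
   v K = v L are left out; in the sums below their contribution is zero. *)
Definition interface_sum (v : cv m -> R) (G : cv m -> cv m -> edge m -> R) : R :=
  \sum_(K : cv m) \sum_(L : cv m | v L < v K) \sum_(s in interface K L) G K L s.

(* The maximum of G c d over a <= c <= d <= b (attained for continuous G). *)
Definition max_between (a b : R) (G : R -> R -> R) : R :=
  sup [set y | exists c d, [/\ a <= c, c <= d, d <= b & y = G c d]].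

End scheme.

(* Main.v *)
From HB Require Import structures.
Require Import Defs.
From mathcomp Require Import all_boot all_order all_algebra.
From mathcomp Require Import all_classical all_reals all_analysis.
From mathcomp Require Import measurable_realfun ring lra.
Import Order.TTheory GRing.Theory Num.Theory numFieldNormedType.Exports.
Set Implicit Arguments.
Unset Strict Implicit.
Unset Printing Implicit Defensive.
Local Open Scope classical_set_scope.
Local Open Scope ring_scope.

(** The scheme is multiplied by [dt * u n.+1 K] and summed. The diffusive terms
    have a sign because [phi] is nondecreasing, the time differences telescope up
    to a sign, and conservativity turns the fluxes into a sum over interfaces of
    [F b a * (b - a)], where [a <= b] are the two values ([sum_energy]). If [G] is
    a primitive of the consistent flux [g s = F s s], then
    [F b a * (b - a) - (G b - G a)] is the integral of [F b a - g s >= 0] over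
    [a, b]. It controls the squares of the flux gaps: a gap [X] inside [a, b]
    decreases at most at the Lipschitz rate [Lam] of the flux, so that it persists
    on a length of order [X / Lam], and [X ^+ 2 <= 4 * Lam * dissipation a b]
    ([dissipation_sqr_le]). Since [Lam] is proportional to the measure of the
    interface and these measures add up to at most a multiple of [1 / h], the
    inequality between means with weight [sqrt h] gives the bound [C / sqrt h],
    provided that the total dissipation is bounded independently of the mesh.

    For this the sum of the terms [G b - G a] has to be bounded. It has the form
    of the sum over all cells and interior edges of [w K] times the measure of the
    edge times a component of its normal. By the divergence theorem in each cell
    only the edges on the boundary of the domain would remain, and their total
    measure is at most the perimeter. Both facts are obtained at once, without
    any surface measure, by translating the mesh by [t *: e] and letting [t] tend
    to [0]. The volume that passes from [K] to a cell [L] is [t] times the measure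
    of their interface times the positive part of the component of the normal
    along [e], up to [o(t)] ([volume_transfer]). Summation by parts of these
    volumes leaves only what leaves the domain, which is [O(t)] for a Lipschitz
    domain ([transfer_sum_le], [lipschitz_translation_loss]).

    The first-order expansion rests on two facts. The oblique prism swept by an
    edge has the volume of a right prism, because an oblique reflection exchanges
    the two and affine involutions preserve the Lebesgue measure
    ([affine_involution_measure], [volume_sweep]). And the points whose segment in
    direction [t *: e] touches the rim of an edge, is parallel to an edge that it
    meets, or meets two edges, have volume [o(t)] ([transverse_off_small]). *)

(** * Borel sets and translations of row vectors *)

Section borel_rV.
Context {R : realType} {l : nat}.
Implicit Types (U : set 'rV[R]_l).

Lemma measurable_ball_rV (x : 'rV[R]_l) (r : R) : measurable (ball x r).
Proof.
have [r0|r0] := leP r 0.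
  rewrite (_ : ball x r = set0) //.
  by apply/seteqP; split => // y [/lt_le_trans/(_ r0)]; rewrite ltxx.
rewrite (_ : ball x r = \bigcap_i
  ((fun y : 'rV[R]_l => y ord0 i : measurableTypeR R) @^-1` ball (x ord0 i) r)).
  apply: fin_bigcap_measurable => // i _.
  rewrite -[X in measurable X]setTI; apply: measurable_coord => //.
  by apply: open_measurable; exact: ball_open.
apply/seteqP; split => y /=; first by move=> [_ h] i _; exact: h.
by move=> h; split => // i j; rewrite ord1; exact: h.
Qed.

(** The cubes with rational centres form a countable basis of the topology. *)
Lemma open_measurable_rV U : open U -> measurable U.
Proof.
move=> oU.
pose F (p : 'rV[rat]_l * nat) : set 'rV[R]_l :=
  let B := ball (map_mx ratr p.1 : 'rV[R]_l) (p.2.+1%:R^-1) in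
  if `[< B `<=` U >] then B else set0.
rewrite (_ : U = \bigcup_p F p); last first.
  apply/seteqP; split => [x Ux|x [p _]]; last first.
    by rewrite /F; case: asboolP => // BU; exact: BU.
  have [e /= e0 eU] := (nbhs_ballP _ _).1 (oU _ Ux).
  have [k kP] : exists k : nat, k.+1%:R^-1 < e / 2.
    by have [k _ kP] := near_infty_natSinv_lt (PosNum (divr_gt0 e0 (ltr0Sn _ 1)));
       exists k; apply: kP => /=.
  have /(_ _)/cid hq (i : 'I_l) : exists q : rat,
      ratr q \in `](x ord0 i), (x ord0 i + k.+1%:R^-1)[.
    by apply: rat_in_itvoo; rewrite ltrDl invr_gt0.
  pose q : 'rV[rat]_l := \row_i projT1 (hq i).
  have qx i : `|ratr (q ord0 i) - x ord0 i| < k.+1%:R^-1.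
    rewrite mxE; case: (hq i) => /= a; rewrite in_itv/= => /andP[a1 a2].
    by rewrite ger0_norm ?subr_ge0 1?ltW// ltrBlDl.
  exists (q, k) => //; rewrite /F; case: asboolP => [_|[]] /=.
    by split => // i j; rewrite (ord1 i) mxE; exact: qx.
  move=> y [_ yq]; apply: eU; split => // i j; rewrite (ord1 i) /ball/=.
  have := yq ord0 j; rewrite /ball/= mxE => h.
  have h' := qx j; have e2 : e = e / 2 + e / 2 by rewrite -splitr.
  rewrite (_ : x ord0 j - y ord0 j =
    - (ratr (q ord0 j) - x ord0 j) + (ratr (q ord0 j) - y ord0 j)); last by ring.
  rewrite (le_lt_trans (ler_normD _ _))// e2 normrN ltrD// (lt_trans _ kP)//.
apply: countable_bigcupT_measurable; first exact: countableP.
by move=> p; rewrite /F; case: asboolP => _ //; exact: measurable_ball_rV.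
Qed.

Lemma closed_measurable_rV U : closed U -> measurable U.
Proof.
move=> cU; have oU : open (~` U) by apply: closed_openC.
by rewrite -(setCK U); apply: measurableC; exact: open_measurable_rV oU.
Qed.

Lemma measurable_dotv (n : 'rV[R]_l) :
  measurable_fun setT (fun x : 'rV[R]_l => dotv n x : measurableTypeR R).
Proof.
rewrite /dotv; apply: measurable_sum => i.
by apply: measurable_funM => //; exact: measurable_coord.
Qed.

End borel_rV.

Section product_sections.
Context d1 d2 (T1 : measurableType d1) (T2 : measurableType d2) (R : realType).
Variables (m1 : {sigma_finite_measure set T1 -> \bar R})
  (m2 : {sigma_finite_measure set T2 -> \bar R}).
Local Open Scope ereal_scope.

Lemma eq_product_xsection (A B : set (T1 * T2)) :
  (forall x, m2 (xsection A x) = m2 (xsection B x)) ->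
  (m1 \x m2) A = (m1 \x m2) B.
Proof. by move=> h; apply: eq_integral => x _ /=; exact: h. Qed.

(** Two sets with sections of equal measure have equal product measure. Together
    with the version for the other variable, it lets each coordinate be moved
    separately. *)
Lemma eq_product_ysection (A B : set (T1 * T2)) :
  measurable A -> measurable B ->
  (forall y, m1 (ysection A y) = m1 (ysection B y)) ->
  (m1 \x m2) A = (m1 \x m2) B.
Proof.
move=> mA mB h.
have e X : measurable X -> (m1 \x m2) X = (m1 \x^ m2) X.
  by apply: product_measure_unique => * /=; rewrite product_measure2E.
by rewrite !e//; apply: eq_integral => y _ /=; exact: h.
Qed.
End product_sections.

Section translation.
Context {R : realType}.
Local Open Scope ereal_scope.

Lemma lebesgue_measure_shift (v : R) (A : set (measurableTypeR R)) : measurable A ->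
  lebesgue_measure ((fun x : R => x + v)%R @^-1` A) = lebesgue_measure A.
Proof.
move=> mA; apply/esym.
have ms : measurable_fun setT ((fun x : R => x + v)%R : measurableTypeR R -> measurableTypeR R).
  by apply: measurable_funD.
pose pm : {measure set (measurableTypeR R) -> \bar R} :=
  @measure_function_pushforward__canonical__measure_function_Measure
   _ _ _ _ _ (@lebesgue_measure R) _ ms.
rewrite (@lebesgue_measure_unique R pm)//= => _ [[a b]] _ <- /=.
rewrite /pushforward.
rewrite (_ : _ @^-1` _ = `](a - v)%R, (b - v)%R]%classic); last first.
  by apply/seteqP; split => x /=; rewrite !in_itv/= ltrBlDr lerBrDr.
rewrite (_ : [set` _] = `]a, b]%classic) //.
rewrite !lebesgue_measure_itv/= !lte_fin ltrD2r.
by case: ifP => // _; rewrite -!EFinD; congr (_%:E); ring.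
Qed.

(** The first coordinate and the remaining ones are translated one after the other,
    each on the sections of the product that defines the measure. *)
Lemma lebesgue_rV_shift (l : nat) (v : 'rV[R]_l) (A : set 'rV[R]_l) : measurable A ->
  lebesgue_rV l ((fun x => x + v)%R @^-1` A) = lebesgue_rV l A.
Proof.
elim: l v A => [|l IH] v A mA.
  by congr (lebesgue_rV 0 _); apply/seteqP; split => x /=;
    rewrite (_ : (x + v)%R = x)//; apply/rowP => -[].
have mv : measurable_fun setT (fun x : 'rV[R]_l.+1 => x + v)%R.
  apply: measurable_rVP => i.
  rewrite (_ : (fun x => _) = fun x : 'rV[R]_l.+1 =>
     (x ord0 i + v ord0 i)%R : measurableTypeR R); last first.
    by apply/funext => x; rewrite mxE.
  by apply: measurable_funD => //; exact: measurable_coord.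
rewrite /= /lebesgue_cons /pushforward.
set v' : 'rV[R]_l := (\row_j v ord0 (lift ord0 j))%R.
set a : R := v ord0 ord0.
have consD p : (cons_rV p + v)%R = cons_rV (p.1 + a, p.2 + v')%R.
  have e0 (q : measurableTypeR R * 'rV[R]_l) : cons_rV q ord0 ord0 = q.1.
    exact: (congr1 fst (cons_rVK q)).
  have eS (q : measurableTypeR R * 'rV[R]_l) j :
      cons_rV q ord0 (lift ord0 j) = q.2 ord0 j.
    by have /rowP/(_ j) := congr1 snd (cons_rVK q); rewrite /= mxE.
  apply/rowP => i; rewrite mxE.
  by case: (unliftP ord0 i) => [j|] ->; rewrite ?eS ?e0 //= !mxE.
have mc := @measurable_cons_rV R l.
have preim X : measurable X -> measurable (@cons_rV R l @^-1` X).
  by move=> mX; rewrite -[X in measurable X]setTI; apply: mc.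
have mA1 : measurable ((fun x => x + v)%R @^-1` A).
  by rewrite -[X in measurable X]setTI; apply: mv.
have mA2 : measurable ((fun p : measurableTypeR R * 'rV[R]_l => (p.1 + a, p.2)%R) @^-1` (@cons_rV R l @^-1` A)).
  rewrite -[X in measurable X]setTI.
  have : measurable_fun setT (fun p : measurableTypeR R * 'rV[R]_l => ((p.1 + a)%R : measurableTypeR R, p.2)).
    apply/measurable_fun_pairP; split; last exact: measurable_snd.
    apply: (@measurableT_comp _ _ _ _ _ _ (fun x : R => (x + a)%R : measurableTypeR R)).
      by apply: measurable_funD.
    exact: measurable_fst.
  by apply => //; exact: preim.
transitivity (((@lebesgue_measure R) \x (lebesgue_rV l))
  ((fun p : measurableTypeR R * 'rV[R]_l => (p.1 + a, p.2)%R) @^-1` (@cons_rV R l @^-1` A))).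
  apply: eq_product_xsection => x.
  rewrite -[RHS](IH v'); last exact: measurable_xsection.
  congr (lebesgue_rV l _); apply/seteqP; split => y /xsectionP /=.
    by rewrite consD /= => h; apply/xsectionP.
  by move=> h; apply/xsectionP; rewrite /= consD.
apply: eq_product_ysection => //; first exact: preim.
move=> y; rewrite -[RHS](lebesgue_measure_shift a); last by apply: measurable_ysection; exact: preim.
congr (lebesgue_measure _); apply/seteqP; split => x /ysectionP /= h; exact/ysectionP.
Qed.
End translation.

(** * Volumes of bounded sets *)

Section volume_basics.
Context {R : realType} {l : nat}.
Implicit Types (A B : set 'rV[R]_l) (v x n : 'rV[R]_l).

Lemma rV_norm_le x (r : R) : 0 <= r ->
  (forall i, `|x ord0 i| <= r) <-> `|x| <= r.
Proof.
move=> r0; rewrite [`|x|]/Num.norm /= mx_normrE; split.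
  by move=> h; apply/bigmax_leP; split => // -[i j] _ /=; rewrite (ord1 i).
by move=> /bigmax_leP[_ h] i; exact: (h (ord0, i)).
Qed.

Lemma bounded_setP A : bounded_set A <-> exists r, forall x, A x -> `|x| <= r.
Proof.
split=> [[M [_ h]]|[r h]].
  by exists (M + 1) => x Ax; apply: (h (M + 1)) => //; rewrite ltrDl.
exists r; split; first exact: num_real.
by move=> M rM x /h xr; rewrite /= (le_trans xr)// ltW.
Qed.

Lemma bounded_subset A B : A `<=` B -> bounded_set B -> bounded_set A.
Proof.
move=> AB /bounded_setP[r h]; apply/bounded_setP; exists r => x /AB; exact: h.
Qed.

Lemma bounded_finite_measure A : measurable A -> bounded_set A ->
  (lebesgue_rV l A < +oo)%E.
Proof.
move=> mA /bounded_setP[r h].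
pose a : 'rV[R]_l := const_mx (- `|r|); pose b : 'rV[R]_l := const_mx `|r|.
have ab i : a ord0 i <= b ord0 i by rewrite !mxE ge0_cp.
pose Q := [set x : 'rV[R]_l | forall i, x ord0 i \in `[a ord0 i, b ord0 i]].
have mQ : measurable Q.
  rewrite (_ : Q = \bigcap_i ((fun x : 'rV[R]_l => x ord0 i : measurableTypeR R) @^-1` `[a ord0 i, b ord0 i])).
    apply: fin_bigcap_measurable => // i _.
    by rewrite -[X in measurable X]setTI; apply: measurable_coord.
  by apply/seteqP; split => x /= h' i; [move=> _; exact: h' | exact: (h' i Logic.I)].
have AQ : A `<=` Q.
  move=> x /h xr i; rewrite in_itv /= !mxE -ler_norml.
  by move: i; apply/rV_norm_le => //; rewrite (le_trans xr)// ler_norm.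
apply: (@le_lt_trans _ _ (lebesgue_rV l Q)); first by apply: le_measure => //; rewrite inE.
by rewrite lebesgue_rV_box// ltry.
Qed.

Lemma volumeE A : measurable A -> bounded_set A ->
  lebesgue_rV l A = (volume A)%:E.
Proof.
move=> mA bA; rewrite /volume fineK// ge0_fin_numE//.
exact: bounded_finite_measure.
Qed.

Lemma volume_ge0 A : 0 <= volume A.
Proof. by rewrite /volume fine_ge0. Qed.

Lemma volume0 : volume (set0 : set 'rV[R]_l) = 0.
Proof. by rewrite /volume measure0. Qed.

Lemma le_volume A B : measurable A -> measurable B -> bounded_set B ->
  A `<=` B -> volume A <= volume B.
Proof.
move=> mA mB bB AB; rewrite -lee_fin -!volumeE//; last exact: bounded_subset bB.
by apply: le_measure => //; rewrite inE.
Qed.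

Lemma volumeID A B : measurable A -> measurable B -> bounded_set A ->
  volume A = volume (A `&` B) + volume (A `\` B).
Proof.
move=> mA mB bA; apply: EFin_inj; rewrite EFinD -!volumeE//.
- by rewrite addeC [LHS](measureDI _ mA mB).
- exact: measurableD.
- by apply: bounded_subset bA => x [].
- exact: measurableI.
- by apply: bounded_subset bA => x [].
Qed.

Lemma volume_le_sum (I : finType) (P : pred I) A (B : I -> set 'rV[R]_l) :
  measurable A -> bounded_set A -> (forall i, P i -> measurable (B i)) ->
  (forall i, P i -> bounded_set (B i)) ->
  (forall x, A x -> exists2 i, P i & B i x) ->
  volume A <= \sum_(i | P i) volume (B i).
Proof.
move=> mA bA mB bB.
have : forall x, (exists2 i, P i & B i x) <-> exists2 i, (i \in index_enum I) && P i & B i x.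
  move=> x; split => -[i]; first by move=> Pi Bi; exists i => //; rewrite mem_index_enum.
  by move=> /andP[_ Pi] Bi; exists i.
move=> e cov; have {e cov} : forall x, A x -> exists2 i, (i \in index_enum I) && P i & B i x.
  by move=> x /cov /e.
elim: (index_enum I) A mA bA => [|i s IH] A mA bA cov.
  rewrite big_nil (_ : A = set0) ?volume0//.
  by apply/seteqP; split => // x /cov[].
rewrite big_cons; case: ifPn => Pi; last first.
  apply: IH => // x /cov[j]; rewrite in_cons => /andP[/orP[/eqP ->|js] Pj] Bj.
    by rewrite Pj in Pi.
  by exists j => //; rewrite js.
rewrite (volumeID mA (mB _ Pi) bA) lerD//.
  by apply: le_volume => //; [apply: measurableI; [|exact: mB] | exact: mB | exact: bB].
apply: IH.
- by apply: measurableD => //; exact: mB.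
- by apply: bounded_subset bA => x [].
- move=> x [/cov[j]]; rewrite in_cons => /andP[/orP[/eqP ->|js] Pj] Bj nB //.
  by exists j => //; rewrite js.
Qed.

Lemma sum_volume_le (I : finType) (P : pred I) A (B : I -> set 'rV[R]_l) :
  measurable A -> bounded_set A -> (forall i, P i -> measurable (B i)) ->
  (forall i, P i -> B i `<=` A) ->
  (forall i j, P i -> P j -> i != j -> B i `&` B j = set0) ->
  \sum_(i | P i) volume (B i) <= volume A.
Proof.
move=> mA bA mB BA tB.
have {BA} : forall i, i \in index_enum I -> P i -> B i `<=` A by move=> i _; exact: BA.
have := index_enum_uniq I.
elim: (index_enum I) A mA bA => [|i s IH] A mA bA us BA; first by rewrite big_nil volume_ge0.
move: us => /= /andP[ns us].
rewrite big_cons; case: ifPn => Pi; last first.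
  by apply: IH => // j js; apply: BA; rewrite in_cons js orbT.
rewrite (volumeID mA (mB _ Pi) bA) lerD//.
  rewrite (_ : A `&` B i = B i)//; apply/setIidPr/BA => //; exact: mem_head.
apply: IH => //.
- by apply: measurableD => //; exact: mB.
- by apply: bounded_subset bA => x [].
- move=> j js Pj x Bj; split; first by apply: (BA j) => //; rewrite in_cons js orbT.
  move=> Bi; have := tB i j Pi Pj _; rewrite -subset0; apply.
    by apply: contraNneq ns => ->.
  by split; [exact: Bi|exact: Bj].
Qed.

Lemma measurable_rV_shift v : measurable_fun setT (fun x : 'rV[R]_l => x + v).
Proof.
apply: measurable_rVP => i.
rewrite (_ : (fun x => _) = fun x : 'rV[R]_l =>
   (x ord0 i + v ord0 i)%R : measurableTypeR R); last first.
  by apply/funext => x; rewrite mxE.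
by apply: measurable_funD => //; exact: measurable_coord.
Qed.

Lemma measurable_preimage_rV (f : 'rV[R]_l -> 'rV[R]_l) A :
  measurable_fun setT f -> measurable A -> measurable (f @^-1` A).
Proof. by move=> mf mA; rewrite -[X in measurable X]setTI; apply: mf. Qed.

Lemma measurable_shift A v : measurable A -> measurable ((fun x => x + v) @^-1` A).
Proof. by apply: measurable_preimage_rV; exact: measurable_rV_shift. Qed.

Lemma volume_shift A v : measurable A -> volume ((fun x => x + v) @^-1` A) = volume A.
Proof. by move=> mA; rewrite /volume lebesgue_rV_shift. Qed.

Lemma bounded_shift A v : bounded_set A -> bounded_set ((fun x => x + v) @^-1` A).
Proof.
move=> /bounded_setP[r h]; apply/bounded_setP; exists (r + `|v|) => x /h.
rewrite -lerBlDr; apply: le_trans; rewrite -[X in `|X| - _](addrK v).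
by rewrite lerBlDr ler_normB.
Qed.

(** Disjoint translates have the same volume and share that of [B]. Hyperplanes and
    strips below graphs are measured by this lemma, without computing integrals. *)
Lemma volume_packing A B v (k : nat) :
  measurable A -> measurable B -> bounded_set B ->
  (forall i j x, (i < k)%N -> (j < k)%N -> A (x + i%:R *: v) -> A (x + j%:R *: v) ->
    i = j) ->
  (forall i x, (i < k)%N -> A (x + i%:R *: v) -> B x) ->
  k%:R * volume A <= volume B.
Proof.
move=> mA mB bB dA AB.
rewrite mulr_natl -[X in _ *+ X](card_ord k) -sumr_const.
rewrite (eq_bigr (fun i : 'I_k => volume ((fun x => x + i%:R *: v) @^-1` A))).
  apply: sum_volume_le => // [i _|i _ x Ax|i j _ _ ij].
  - exact: measurable_shift.
  - exact: (AB i x (ltn_ord i) Ax).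
  - rewrite -subset0 => x [/= Ai Aj]; move/eqP: ij; apply.
    by apply/val_inj/(dA _ _ x) => //; exact: ltn_ord.
by move=> i _; rewrite volume_shift.
Qed.
End volume_basics.

(** * Scalar products and affine involutions *)

Section archimedean.
Context {R : realType}.

(** The archimedean principle, in the form used with packings. *)
Lemma natmul_bounded_le0 (a b : R) : (forall k : nat, k%:R * a <= b) -> a <= 0.
Proof.
move=> h; rewrite leNgt; apply/negP => a0.
have := h (Num.trunc (`|b| / a)).+1; apply/negP; rewrite -ltNge.
apply: (le_lt_trans (ler_norm b)); rewrite -ltr_pdivrMr//.
by apply: truncnS_gt; rewrite divr_ge0// ltW.
Qed.

(** Cauchy's functional equation on the half-line: an additive function is linear on
    rational multiples, and monotonicity fills the gaps. *)
Lemma additive_monotone_linear (g : R -> R) :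
  (forall x y, 0 <= x -> 0 <= y -> g (x + y) = g x + g y) ->
  (forall x y, 0 <= x -> x <= y -> g x <= g y) ->
  forall x, 0 <= x -> g x = x * g 1.
Proof.
move=> gD gM x x0.
have gn y (k : nat) : 0 <= y -> g (k%:R * y) = k%:R * g y.
  move=> y0; elim: k => [|k IH].
    by rewrite !mul0r; have := gD 0 0 (lexx _) (lexx _); rewrite addr0; lra.
  by rewrite -natr1 mulrDl mul1r gD ?mulr_ge0// IH; ring.
have b (q : nat) : `|q%:R * g x - q%:R * x * g 1| <= g 1.
  have qx0 : 0 <= q%:R * x by rewrite mulr_ge0.
  have := truncn_itv qx0; set k := Num.trunc _ => /andP[h1 h2].
  have := gM _ _ (ler0n _ k) h1; have := gM _ _ qx0 (ltW h2).
  rewrite gn// -[k%:R]mulr1 gn// -[k.+1%:R]mulr1 gn// -natr1 => u1 u2.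
  have g1 : 0 <= g 1.
    by have := gD 0 0 (lexx _) (lexx _); rewrite addr0 => e;
      have := gM 0 1 (lexx _) ler01; lra.
  have v1 : k%:R * g 1 <= q%:R * x * g 1 by rewrite ler_wpM2r.
  have v2 : q%:R * x * g 1 <= (k%:R + 1) * g 1 by rewrite ler_wpM2r// natr1 ltW.
  by rewrite ler_norml; apply/andP; split; lra.
apply/eqP; rewrite -subr_eq0 -normr_le0; apply: (@natmul_bounded_le0 _ (g 1)) => k.
by rewrite -[k%:R]ger0_norm// -normrM mulrBr mulrA.
Qed.
End archimedean.

Section dotv.
Context {R : realType} {l : nat}.
Implicit Types (x y z n v : 'rV[R]_l).

Lemma dotvC x y : dotv x y = dotv y x.
Proof. by apply: eq_bigr => i _; rewrite mulrC. Qed.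

Lemma dotvDr x y z : dotv x (y + z) = dotv x y + dotv x z.
Proof. by rewrite -big_split; apply: eq_bigr => i _; rewrite mxE mulrDr. Qed.

Lemma dotvZr (a : R) x y : dotv x (a *: y) = a * dotv x y.
Proof. by rewrite mulr_sumr; apply: eq_bigr => i _; rewrite mxE mulrCA. Qed.

Lemma dotvNr x y : dotv x (- y) = - dotv x y.
Proof. by rewrite -scaleN1r dotvZr mulN1r. Qed.

Lemma dotvBr x y z : dotv x (y - z) = dotv x y - dotv x z.
Proof. by rewrite dotvDr dotvNr. Qed.

Lemma dotvDl x y z : dotv (x + y) z = dotv x z + dotv y z.
Proof. by rewrite dotvC dotvDr !(dotvC z). Qed.

Lemma dotvZl (a : R) x y : dotv (a *: x) y = a * dotv x y.
Proof. by rewrite dotvC dotvZr dotvC. Qed.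

Lemma dotvNl x y : dotv (- x) y = - dotv x y.
Proof. by rewrite dotvC dotvNr dotvC. Qed.

Lemma dotvBl x y z : dotv (x - y) z = dotv x z - dotv y z.
Proof. by rewrite dotvDl dotvNl. Qed.

Lemma dotv_ge0 x : 0 <= dotv x x.
Proof. by apply: sumr_ge0 => i _; rewrite -expr2 sqr_ge0. Qed.

Lemma dotv_eq0 x : (dotv x x == 0) = (x == 0).
Proof.
apply/eqP/eqP => [|->]; last by rewrite /dotv big1// => i _; rewrite mxE mul0r.
move=> /psumr_eq0P h; apply/rowP => i; rewrite mxE.
by apply/eqP; rewrite -(orbb (_ == 0)) -mulf_eq0; apply/eqP/h => // j _; rewrite -expr2 sqr_ge0.
Qed.

Lemma dotv_gt0 x : x != 0 -> 0 < dotv x x.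
Proof. by move=> x0; rewrite lt_neqAle dotv_ge0 eq_sym dotv_eq0 x0. Qed.

Lemma enorm1_dotv x : enorm x = 1 -> dotv x x = 1.
Proof. by move=> h; rewrite -[LHS]sqr_sqrtr ?dotv_ge0// -/(enorm x) h expr1n. Qed.

Lemma dotv_continuous n : continuous (dotv n : 'rV[R]_l -> R).
Proof.
rewrite (_ : dotv n = fun x => \sum_(i < l) n ord0 i * x ord0 i)//.
apply: continuous_big => [|i _ x]; first by move=> z; apply: (@cvgD _ R^o _ _ _ fst snd); [exact: cvg_fst | exact: cvg_snd].
exact: (@cvgM R _ (nbhs x) _ (fun=> n ord0 i) (fun x : 'rV[R]_l => x ord0 i) _ _ (cvg_cst _) (@coord_continuous R 1 l ord0 i x)).
Qed.

(** If [dotv n v = - 2] this is the reflection through the hyperplane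
    [dotv n x = c] along the oblique direction [v]. *)
Definition drift n (c : R) v x : 'rV[R]_l := x + (dotv n x - c) *: v.

Lemma measurable_drift n c v : measurable_fun setT (drift n c v).
Proof.
apply: measurable_rVP => i.
rewrite (_ : (fun x => _) = fun x : 'rV[R]_l =>
   (x ord0 i + (dotv n x - c) * v ord0 i)%R : measurableTypeR R); last first.
  by apply/funext => x; rewrite !mxE.
apply: measurable_funD => //; first exact: measurable_coord.
apply: measurable_funM => //; apply: measurable_funB => //.
exact: measurable_dotv.
Qed.

End dotv.

Lemma xsectionE (T1 T2 : Type) (A : set (T1 * T2)) x :
  xsection A x = [set y | A (x, y)].
Proof. by apply/seteqP; split => y; [move/xsectionP | move=> ?; apply/xsectionP]. Qed.

Section involution.
Context {R : realType} {l : nat}.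
Variables (T L : 'rV[R]_l -> 'rV[R]_l).
Hypotheses (mT : measurable_fun setT T) (TL : forall x v, T (x + v) = T x + L v)
  (TK : forall x, T (T x) = x).
Local Open Scope ereal_scope.

(** No determinant is needed: by Tonelli and translation invariance any affine
    bijection multiplies volumes by a constant, and for an involution the square of
    this constant is [1]. Here [L] is the linear part of [T]. *)
Lemma affine_involution_measure (A : set 'rV[R]_l) : measurable A ->
  lebesgue_rV l (T @^-1` A) = lebesgue_rV l A.
Proof.
have LK v : L (L v) = v.
  have := TK (0 + v)%R; rewrite TL TL TK => h; exact: addrI h.
have LN v : L (- v) = (- L v)%R.
  apply: (addrI (T 0 + L v)%R); transitivity (T 0%R); last by rewrite addrK.
  by rewrite -2!TL add0r subrr.
(* any bounded measurable set of positive measure with B = - B would do *)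
pose B : set 'rV[R]_l := [set x | forall i, x ord0 i \in `[(const_mx (-1)%R : 'rV[R]_l) ord0 i, (const_mx 1%R : 'rV[R]_l) ord0 i]].
have muB : lebesgue_rV l B = (2 ^+ l)%:E.
  rewrite /B lebesgue_rV_box; last by move=> i; rewrite !mxE; lra.
  congr (_%:E); rewrite -[in RHS](card_ord l) -prodr_const.
  by apply: eq_bigr => i _; rewrite !mxE; ring.
have mB : measurable B.
  rewrite (_ : B = \bigcap_i ((fun x : 'rV[R]_l => x ord0 i : measurableTypeR R) @^-1` `[(-1)%R, 1%R])).
    apply: fin_bigcap_measurable => // i _.
    by rewrite -[X in measurable X]setTI; apply: measurable_coord.
  apply/seteqP; split => x /= h i; first by move=> _; have := h i; rewrite !mxE.
  by rewrite !mxE; exact: (h i Logic.I).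
have BN x : B x -> B (- x)%R.
  by move=> h i; have := h i; rewrite !mxE !in_itv/=; lra.
have key X : measurable X -> lebesgue_rV l X * lebesgue_rV l (T @^-1` B) =
    lebesgue_rV l B * lebesgue_rV l (T @^-1` X).
  move=> mX.
  have mTB := measurable_preimage_rV mT mB.
  have mTX := measurable_preimage_rV mT mX.
  rewrite -!product_measure1E//.
  (* From X * T^-1 B to B * T^-1 X through E2 and E3, moving one variable at a
     time: x by T y, then y by L x, then x by - T y. *)
  pose E2 : set ('rV[R]_l * 'rV[R]_l) := [set p | X (p.1 + T p.2)%R /\ B (T p.2)].
  pose E3 : set ('rV[R]_l * 'rV[R]_l) := [set p | B (p.1 - T p.2)%R /\ X (T p.2)].
  have mT2 : measurable_fun setT (T \o snd : 'rV[R]_l * 'rV[R]_l -> 'rV[R]_l).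
    by apply: measurableT_comp => //; exact: measurable_snd.
  have mc (s : R) : measurable_fun setT
      (fun p : 'rV[R]_l * 'rV[R]_l => p.1 + s *: T p.2)%R.
    apply: measurable_rVP => i.
    rewrite (_ : (fun x => _) = fun p : 'rV[R]_l * 'rV[R]_l =>
       (p.1 ord0 i + s * T p.2 ord0 i)%R : measurableTypeR R); last first.
      by apply/funext => x; rewrite !mxE.
    apply: measurable_funD.
      by apply: (measurableT_comp (measurable_coord i)); exact: measurable_fst.
    apply: measurable_funM => //.
    exact: (measurableT_comp (measurable_coord i)).
  have mE Y Z (s : R) : measurable Y -> measurable Z ->
      measurable [set p : 'rV[R]_l * 'rV[R]_l | Y (p.1 + s *: T p.2)%R /\ Z (T p.2)].
    move=> mY mZ; apply: measurableI.
      by rewrite -[X in measurable X]setTI; exact: mc.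
    by rewrite -[X in measurable X]setTI; exact: mT2.
  have mE2 : measurable E2.
    have := mE _ _ 1%R mX mB; rewrite (_ : [set _ | _] = E2)//.
    by apply/seteqP; split => -[x y] /=; rewrite scale1r.
  have mE3 : measurable E3.
    have := mE _ _ (-1)%R mB mX; rewrite (_ : [set _ | _] = E3)//.
    by apply/seteqP; split => -[x y] /=; rewrite scaleN1r.
  transitivity ((lebesgue_rV l \x lebesgue_rV l) E2).
    have mE1 := measurableX mX mTB.
    apply: eq_product_ysection => //.
    move=> y; rewrite -[LHS](lebesgue_rV_shift (T y) (measurable_ysection y mE1)).
    by congr (lebesgue_rV l _).
  transitivity ((lebesgue_rV l \x lebesgue_rV l) E3).
    apply: eq_product_xsection => x.
    rewrite -[LHS](lebesgue_rV_shift (- L x)%R); last exact: measurable_xsection.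
    have TLx y : T (y - L x)%R = (T y - x)%R by rewrite TL LN LK.
    congr (lebesgue_rV l _); apply/seteqP; split => y /=.
      rewrite !xsectionE /E2 /E3 /= TLx (addrC x (T y - x)%R) subrK => -[h1 /BN].
      by rewrite opprB.
    rewrite !xsectionE /E2 /E3 /= TLx (addrC x (T y - x)%R) subrK => -[/BN].
    by rewrite opprB.
  have mE4 := measurableX mB mTX.
  apply: eq_product_ysection => // y.
  rewrite -[RHS](lebesgue_rV_shift (- T y)%R (measurable_ysection y mE4)).
  by congr (lebesgue_rV l _).
move=> mA.
have mTB := measurable_preimage_rV mT mB.
have TT X : T @^-1` (T @^-1` X) = X.
  by apply/seteqP; split => x /=; rewrite TK.
have := key _ mTB; rewrite TT muB.
have := key _ mA; rewrite muB.
have : 0 <= lebesgue_rV l (T @^-1` B) by exact: measure_ge0.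
have p0 : (0 < 2 ^+ l :> R)%R by rewrite exprn_gt0.
case: (lebesgue_rV l (T @^-1` B)) => [b| |]; [|by move=> _ _; rewrite -EFinM mulyy|by []].
rewrite lee_fin => b0; rewrite -!EFinM => h1 [] /eqP.
rewrite -!expr2 eqrXn2 ?(ltW p0)// => /eqP h2.
move: h1; rewrite h2 muleC => h1.
by have := congr1 (fun z => (2 ^+ l)^-1%:E * z) h1; rewrite !muleA -EFinM mulVf ?gt_eqF// !mul1e.
Qed.
End involution.

(** * Hyperplanes and prisms *)

Section hyperplanes.
Context {R : realType} {l : nat}.
Implicit Types (A U : set 'rV[R]_l) (n x e v : 'rV[R]_l) (c t : R).

(** Arbitrarily many short translates along the normal fit in a bounded set. *)
Lemma volume_sub_hyperplane n c A : n != 0 -> measurable A -> bounded_set A ->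
  A `<=` hyperplane n c -> volume A = 0.
Proof.
move=> n0 mA bA An; apply/eqP; rewrite eq_le volume_ge0 andbT.
have /bounded_setP[r Ar] := bA.
apply: (@natmul_bounded_le0 _ _ (volume (ball (0 : 'rV[R]_l) (r + `|n| + 1)))) => k.
apply: (@volume_packing _ _ _ _ (k%:R^-1 *: n)) => //.
- exact: measurable_ball_rV.
- apply/bounded_setP; exists (r + `|n| + 1) => x.
  by rewrite -ball_normE /= sub0r normrN => /ltW.
- move=> i j x ik jk /An; rewrite /hyperplane /= => h1 /An; rewrite /hyperplane /= -h1.
  rewrite !dotvDr !dotvZr !mulrA => /addrI /mulIf; rewrite gt_eqF ?dotv_gt0// => /(_ isT).
  have k0 : (k%:R : R)^-1 != 0 by rewrite invr_eq0 pnatr_eq0; case: (k) ik.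
  by move/(mulIf k0)/eqP; rewrite eqr_nat => /eqP.
- move=> i x ik /Ar h; rewrite -ball_normE /= sub0r normrN.
  rewrite -[x](addrK (i%:R *: (k%:R^-1 *: n))).
  apply: (le_lt_trans (ler_normB _ _)); rewrite -addrA ler_ltD// scalerA normrZ.
  apply: (@le_lt_trans _ _ (`|n|)); last by rewrite ltrDl.
  rewrite ler_piMl// ger0_norm ?mulr_ge0 ?invr_ge0//.
  by rewrite ler_pdivrMr ?ltr0n ?(leq_ltn_trans _ ik)// mul1r ler_nat ltnW.
Qed.

Lemma hyperplane_opp n c : hyperplane (- n) (- c) = hyperplane n c.
Proof.
apply/funext => x; apply/propext; rewrite /hyperplane /= dotvNl.
by split=> [/oppr_inj|->].
Qed.

Lemma hvolume_opp n A : hvolume (- n) A = hvolume n A.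
Proof.
congr volume; apply/seteqP; split => y [x Ax [t]]; rewrite /= in_itv /= => /andP[t1 t2] <-.
  by exists x => //; exists (- t); rewrite ?scaleNr ?scalerN// in_itv/= lerNl opprK t2 lerNl.
by exists x => //; exists (- t); rewrite ?scaleNr ?scalerN ?opprK// in_itv/= lerNl opprK t2 lerNl.
Qed.

(** The right prism over the part of [U] in the hyperplane, at heights in [J]. *)
Definition slab n c U (J : set R) : set 'rV[R]_l :=
  [set x | J (dotv n x - c) /\ U (x - (dotv n x - c) *: n)].

(** The oblique prism traced by [A] when it moves backwards along [e] for a time [t]. *)
Definition sweep A e t : set 'rV[R]_l :=
  [set x | exists2 s, s \in `]0, t[ & A (x + s *: e)].

Lemma bounded_sweep A e t : bounded_set A -> bounded_set (sweep A e t).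
Proof.
move=> /bounded_setP[r Ar]; apply/bounded_setP; exists (r + t * `|e|) => x.
move=> [s]; rewrite in_itv /= => /andP[s0 st] /Ar h.
rewrite -[x](addrK (s *: e)) (le_trans (ler_normB _ _))// lerD//.
by rewrite normrZ ler_wpM2r// ger0_norm ltW.
Qed.

Section unit_normal.
Variables (n : 'rV[R]_l) (c : R) (U : set 'rV[R]_l).
Hypotheses (nn : dotv n n = 1) (mU : measurable U).
Hypothesis bU : bounded_set (U `&` hyperplane n c).

Lemma measurable_slab (J : set R) : measurable (J : set (measurableTypeR R)) ->
  measurable (slab n c U J).
Proof.
move=> mJ; apply: measurableI.
  rewrite -[X in measurable X]setTI.
  have : measurable_fun setT (fun x : 'rV[R]_l => dotv n x - c : measurableTypeR R).
    by apply: measurable_funB => //; exact: measurable_dotv.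
  exact.
rewrite (_ : (fun x => _) = (drift n c (- n)) @^-1` U).
  by apply: measurable_preimage_rV => //; exact: measurable_drift.
by apply/funext => x; rewrite /= /drift scalerN.
Qed.

Lemma bounded_slab (J : set R) r : (forall s, J s -> `|s| <= r) -> bounded_set (slab n c U J).
Proof.
move=> Jr; have /bounded_setP[M h] := bU; apply/bounded_setP.
exists (M + r * `|n|) => x [Jx Ux].
rewrite -[x](subrK ((dotv n x - c) *: n)) (le_trans (ler_normD _ _))// lerD//.
  by apply: h; split => //; rewrite /hyperplane /= dotvBr dotvZr nn; ring.
by rewrite normrZ ler_wpM2r// Jr.
Qed.

Lemma volume_slab_shift (J : set R) s : measurable (J : set (measurableTypeR R)) ->
  volume (slab n c U [set t | J (t + s)]) = volume (slab n c U J).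
Proof.
move=> mJ; rewrite -[RHS](volume_shift (s *: n)); last exact: measurable_slab.
congr volume; apply/funext => x; rewrite /slab /= dotvDr dotvZr nn mulr1.
rewrite (_ : dotv n x + s - c = dotv n x - c + s); last by ring.
rewrite (_ : x + s *: n - _ = x - (dotv n x - c) *: n)//.
by rewrite scalerDl opprD addrA (addrAC x) addrK.
Qed.

(** One more height adds only a piece of a hyperplane, so that open, half-open and
    closed slabs have the same volume. *)
Lemma volume_slab_point (J : set R) a r : measurable (J : set (measurableTypeR R)) ->
  (forall s, J s -> `|s| <= r) ->
  volume (slab n c U (J `|` [set a])) = volume (slab n c U J).
Proof.
move=> mJ Jr.
have mJa : measurable (J `|` [set a] : set (measurableTypeR R)).
  by apply: measurableU => //; exact: measurable_set1.
have bJa : bounded_set (slab n c U (J `|` [set a])).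
  apply: (@bounded_slab _ (Num.max r `|a|)) => s [/Jr sr|->].
    by rewrite le_max sr.
  by rewrite le_max lexx orbT.
rewrite (volumeID (measurable_slab mJa) (measurable_slab mJ) bJa).
rewrite [X in _ + X](_ : _ = 0) ?addr0.
  by congr volume; apply/seteqP; split => x; [case | move=> [Jx Ux]; do 2 split; auto; left].
apply: (@volume_sub_hyperplane n (c + a)).
- by rewrite -dotv_eq0 nn oner_eq0.
- by apply: measurableD; exact: measurable_slab.
- by apply: bounded_subset bJa => x [].
- move=> x [[[Jx|/= <-] Ux] Nx]; last by rewrite /hyperplane /=; ring.
  by case: Nx.
Qed.

Let itv_le (a b s : R) (p q : bool) : s \in Interval (BSide p a) (BSide q b) ->
  `|s| <= `|a| + `|b|.
Proof.
move=> h; have /andP[h1 h2] : (a <= s <= b).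
  by move: h; case: p; case: q; rewrite in_itv /= => /andP[h1 h2];
    rewrite ?(ltW h1) ?(ltW h2) ?h1 ?h2.
rewrite ler_norml; have := ler_norm b; have := ler_norm (- a); rewrite normrN.
by have := normr_ge0 a; have := normr_ge0 b; move=> ? ? ? ?; apply/andP; split; lra.
Qed.

Lemma hvolume_slab : hvolume n (U `&` hyperplane n c) = volume (slab n c U `[0, 1[%classic).
Proof.
have -> : hvolume n (U `&` hyperplane n c) =
    volume (slab n c U (`[- 2^-1, 2^-1]%classic)).
  congr volume; apply/seteqP; split => x.
    move=> [y [Uy]]; rewrite /hyperplane /= => yc [t tI <-].
    rewrite /slab /= dotvDr dotvZr nn yc mulr1 (addrC c) addrK; split => //.
    by rewrite addrK.
  move=> [/= tI Ux]; exists (x - (dotv n x - c) *: n).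
    by split => //; rewrite /hyperplane /= dotvBr dotvZr nn; ring.
  by exists (dotv n x - c) => //; rewrite subrK.
rewrite -(@setUitv1 _ _ (BLeft (- 2^-1)) 2^-1 true); last by rewrite bnd_simp; lra.
rewrite (@volume_slab_point _ _ (`|- 2^-1| + `|2^-1|))//; last by move=> s /= /itv_le.
rewrite -(@volume_slab_shift `[0, 1[%classic (2^-1)); last exact: measurable_itv.
congr (volume (slab _ _ _ _)); apply/seteqP.
by split => s; rewrite /= !in_itv/= => /andP[? ?]; apply/andP; split; lra.
Qed.

(** The volume is additive in the height because slabs can be stacked by translation. *)
Lemma volume_slab r : 0 <= r ->
  volume (slab n c U `[0, r[%classic) = r * hvolume n (U `&` hyperplane n c).
Proof.
rewrite hvolume_slab.
apply: (@additive_monotone_linear _ (fun r => volume (slab n c U `[0, r[%classic))).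
  move=> x y x0 y0.
  have bS a b : bounded_set (slab n c U `[a, b[%classic).
    by apply: (@bounded_slab _ (`|a| + `|b|)) => s /= /itv_le.
  rewrite (@volumeID _ _ _ (slab n c U `[0, x[%classic))//; try exact: measurable_slab.
  congr (_ + _).
    congr volume; apply/seteqP; split => z; first by case.
    move=> [h Uz]; split => //; split => //; move: h; rewrite /= !in_itv /= => /andP[-> h] /=.
    by rewrite (lt_le_trans h)// lerDl.
  rewrite -(@volume_slab_shift `[0, y[%classic (- x)); last exact: measurable_itv.
  congr volume; apply/seteqP; split => z /=.
    move=> [[h Uz] nz]; split => //; rewrite /= !in_itv /= in h *.
    have : ~~ (0 <= dotv n z - c < x) by apply/negP => h'; apply: nz; split => //=; rewrite in_itv.
    case/andP: h => -> h /=; rewrite -leNgt => h'; apply/andP; split; lra.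
  move=> [h Uz]; rewrite /= in_itv /= in h; case/andP: h => h1 h2; split.
    by split => //=; rewrite in_itv /=; apply/andP; split; lra.
  by move=> [/=]; rewrite in_itv /= => /andP[_ h3] _; lra.
move=> x y x0 xy; apply: le_volume; try (by apply: measurable_slab; exact: measurable_itv).
  by apply: (@bounded_slab _ (`|0| + `|y|)) => s h; exact: (itv_le h).
move=> z [h Uz]; split => //; move: h; rewrite /= !in_itv /= => /andP[-> h] /=.
exact: lt_le_trans xy.
Qed.

Lemma sweep_slab e t : 0 < dotv n e ->
  sweep (U `&` hyperplane n c) e t =
  drift n c (- (n + (dotv n e)^-1 *: e)) @^-1` (slab n c U `]0, t * dotv n e[%classic).
Proof.
set a := dotv n e => a0.
have eT x : dotv n (drift n c (- (n + a^-1 *: e)) x) - c = - (dotv n x - c).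
  rewrite /drift dotvDr dotvZr dotvNr dotvDr dotvZr nn -/a mulVf ?gt_eqF//.
  by ring.
have eS x : drift n c (- (n + a^-1 *: e)) x + (dotv n x - c) *: n =
    x + (- (dotv n x - c) / a) *: e.
  by rewrite /drift scalerN scalerDr scalerA opprD addrA addrAC subrK mulNr scaleNr.
apply/seteqP; split => x.
  move=> [s]; rewrite in_itv /= => /andP[s0 st] [Ux]; rewrite /hyperplane /= => h.
  have xs : - (dotv n x - c) = s * a by rewrite -h dotvDr dotvZr -/a; ring.
  rewrite /slab /= eT xs -xs scaleNr opprK eS xs mulfK ?gt_eqF//.
  by rewrite in_itv /= mulr_gt0// ltr_pM2r.
rewrite /slab /= eT scaleNr opprK eS in_itv /= => -[/andP[h1 h2] Ux].
exists (- (dotv n x - c) / a).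
  by rewrite in_itv /= divr_gt0//= ltr_pdivrMr.
split => //; rewrite /hyperplane /= dotvDr dotvZr -/a divfK ?gt_eqF//; ring.
Qed.

Lemma measurable_sweep e t : 0 < dotv n e ->
  measurable (sweep (U `&` hyperplane n c) e t).
Proof.
move=> ne; rewrite sweep_slab//; apply: measurable_preimage_rV.
  exact: measurable_drift.
by apply: measurable_slab; exact: measurable_itv.
Qed.

(** The oblique prism over a face and the right prism of the same height
    correspond under an oblique reflection, which is an affine involution. *)
Lemma volume_sweep_pos e t : 0 < dotv n e -> 0 <= t ->
  volume (sweep (U `&` hyperplane n c) e t) =
  t * dotv n e * hvolume n (U `&` hyperplane n c).
Proof.
move=> ne t0; rewrite sweep_slab//.
set w := - (n + _).
have nw : dotv n w = - 2.
  by rewrite /w dotvNr dotvDr dotvZr nn mulVf ?gt_eqF//; ring.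
have mS : measurable (slab n c U `]0, t * dotv n e[%classic).
  by apply: measurable_slab; exact: measurable_itv.
rewrite /volume (@affine_involution_measure _ _ (drift n c w) (fun v => v + dotv n v *: w))//.
- rewrite -/(volume _) -volume_slab ?mulr_ge0 ?(ltW ne)//.
  move: t0; rewrite le_eqVlt => /predU1P[<-|t0].
    by rewrite !mul0r !set_itvoo0 ?set_itvco0.
  rewrite -(@setU1itv _ _ (BLeft (t * dotv n e)) 0 false); last by rewrite bnd_simp mulr_gt0.
  rewrite setUC; symmetry.
  apply: (@volume_slab_point _ _ (t * dotv n e) (measurable_itv _)) => s.
  by rewrite /= in_itv /= => /andP[s0 st]; rewrite ger0_norm ltW.
- exact: measurable_drift.
- move=> x v; rewrite /drift dotvDr (addrAC _ (dotv n v)) scalerDl.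
  by rewrite addrACA.
- move=> x; rewrite /drift dotvDr dotvZr nw.
  rewrite (_ : dotv n x + (dotv n x - c) * - 2 - c = - (dotv n x - c)); last by ring.
  by rewrite scaleNr addrK.
Qed.

End unit_normal.

Lemma volume_sweep n c U e t : dotv n n = 1 -> measurable U ->
  bounded_set (U `&` hyperplane n c) -> dotv n e != 0 -> 0 <= t ->
  measurable (sweep (U `&` hyperplane n c) e t) /\
  volume (sweep (U `&` hyperplane n c) e t) =
  t * `|dotv n e| * hvolume n (U `&` hyperplane n c).
Proof.
move=> nn mU bU; rewrite neq_lt => /orP[ne|ne] t0; last first.
  by rewrite gtr0_norm// volume_sweep_pos//; split => //; exact: measurable_sweep.
have nn' : dotv (- n) (- n) = 1 by rewrite dotvNl dotvNr opprK.
have ne' : 0 < dotv (- n) e by rewrite dotvNl oppr_gt0.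
have opp := hyperplane_opp n c.
rewrite ltr0_norm// -dotvNl -(hvolume_opp n) -opp in bU *.
by split; [exact: measurable_sweep | exact: volume_sweep_pos].
Qed.

End hyperplanes.

(** * Cells near a point of an edge *)

Section segments.
Context {R : realType} {l : nat}.
Implicit Types (A : set 'rV[R]_l) (x v w y z n : 'rV[R]_l).

Lemma line_continuous x v : continuous (fun s : R => x + s *: v).
Proof.
by move=> s; apply: cvgD; [exact: cvg_cst | apply: cvgZr_tmp; exact: cvg_id].
Qed.

(** A segment that starts in an open set and avoids its boundary stays inside, by
    connectedness. *)
Lemma segment_in_open A x v : open A -> A x ->
  (forall s, s \in `[0, 1] -> ~ boundary A (x + s *: v)) -> A (x + v).
Proof.
move=> oA Ax nb; pose g (s : R) := x + s *: v.
have gc : continuous g := @line_continuous x v.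
have := @segment_connected R 0 1.
move/(_ ([set s | s \in `[0, 1]] `&` g @^-1` A)) => h.
have e1 : [set s | s \in `[0, 1]] `&` g @^-1` A = `[0, 1]%classic.
  apply: h.
  - by exists 0; split => /=; rewrite ?in_itv /= ?lexx ?ler01// /g scale0r addr0.
  - exists (g @^-1` A) => //; exact: open_comp.
  - exists (g @^-1` closure A).
      by apply: closed_comp => //; exact: closed_closure.
    apply/seteqP; split => s [s01 h]; split => //; first exact: subset_closure.
    have := nb s s01; apply: contra_notP => nA; split => // /interior_subset.
    exact: nA.
have : `[0, 1]%classic (1 : R) by rewrite /= in_itv /= ler01 lexx.
by rewrite -e1 => -[_]; rewrite /g /= scale1r.
Qed.

Lemma ball_segment y (r s : R) z w : s \in `[0, 1] -> `|z - y| < r -> `|w - y| < r ->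
  `|w + s *: (z - w) - y| < r.
Proof.
rewrite in_itv /= => /andP[s0 s1] zr wr.
have -> : w + s *: (z - w) - y = (1 - s) *: (w - y) + s *: (z - y).
  by apply/rowP => i; rewrite !mxE; ring.
apply: (le_lt_trans (ler_normD _ _)); rewrite !normrZ ger0_norm ?subr_ge0// ger0_norm//.
have [->|s0'] := eqVneq s 0; first by rewrite subr0 mul1r mul0r addr0.
have : s * `|z - y| < s * r by rewrite ltr_pM2l// lt_neqAle eq_sym s0'.
have : (1 - s) * `|w - y| <= (1 - s) * r by rewrite ler_wpM2l ?subr_ge0// ltW.
lra.
Qed.

Lemma convex_lt (u w y a : R) : u < y -> w < y -> 0 <= a -> a <= 1 ->
  w + a * (u - w) < y.
Proof.
move=> uy wy a0 a1; have [uw|wu] := leP u w.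
  by have : a * (u - w) <= 0 by [rewrite mulr_ge0_le0// subr_le0]; lra.
by have : a * (u - w) <= 1 * (u - w) by [rewrite ler_wpM2r// subr_ge0 ltW]; lra.
Qed.

Lemma closed_hyperplane n (c : R) : closed (hyperplane n c).
Proof.
rewrite (_ : hyperplane n c = dotv n @^-1` [set c]) //.
apply: closed_comp => [x _|]; first exact: dotv_continuous.
exact: closed_eq.
Qed.

End segments.

Section mesh_geometry.
Context {R : realType} {l : nat}.
Variables (Omega : set 'rV[R]_l) (m : mesh R l).
Hypothesis adm : admissible_mesh Omega m.
Implicit Types (K L : cv m) (s : edge m).

Lemma closure_edge_hyperplane K s x y : s \in edges K -> edgeset s x ->
  closure (edgeset s) y -> dotv (normal K s) y = dotv (normal K s) x.
Proof.
move=> sK sx sy; have [_ [c [U oU sU]] _] := edge_polytope adm sK.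
have := sx; rewrite sU => -[_ /= ->].
have : closure (hyperplane (normal K s) c) y.
  by move: sy; apply: closure_subset; rewrite sU => z [].
by rewrite -(closure_id _).1//; exact: closed_hyperplane.
Qed.

Lemma boundary_cv K s x : s \in edges K -> closure (edgeset s) x ->
  boundary (cvset K) x.
Proof. by move=> sK sx; rewrite (cv_polygonal adm); exists s. Qed.

Lemma cv_not_boundary K x : cvset K x -> ~ boundary (cvset K) x.
Proof. by move=> Kx [_ nK]; apply: nK; apply: open_nbhs_nbhs; split => //; exact: cv_open adm K. Qed.

Lemma edge_nonempty K s : s \in edges K -> exists x, edgeset s x.
Proof. by move=> sK; have [[x sx] _ _] := edge_polytope adm sK; exists x. Qed.

(** Near a point of [s] off the other edges, the hyperplane of [s] cuts a small
    ball into two convex halves that do not meet the boundary of [K], hence are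
    inside or outside [K]; the outward normal tells which. *)
Lemma cv_local_half_space K s y : s \in edges K -> edgeset s y ->
  (forall s', s' \in edges K -> s' != s -> ~ closure (edgeset s') y) ->
  exists2 r, 0 < r & forall z, `|z - y| < r ->
    (dotv (normal K s) z < dotv (normal K s) y -> cvset K z) /\
    (dotv (normal K s) y < dotv (normal K s) z -> ~ cvset K z).
Proof.
move=> sK sy ny; set n := normal K s.
have nn : dotv n n = 1 by apply/enorm1_dotv/(normal_unit adm).
have : \forall z \near y, forall s', s' \in edges K -> s' != s -> ~ closure (edgeset s') z.
  apply: (@filter_forall _ (edge m) (fun s' z => s' \in edges K -> s' != s -> ~ closure (edgeset s') z) (nbhs y) (nbhs_filter y)) => s'.
  case: (boolP (s' \in edges K)) => s'K; last by near=> z.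
  case: (boolP (s' == s)) => s's; first by near=> z.
  have : nbhs y (~` closure (edgeset s')).
    apply: open_nbhs_nbhs; split; first by apply: closed_openC; exact: closed_closure.
    exact: ny.
  by apply: filterS => z h _ _.
move=> /nbhs_ballP[r /= r0 hr]; exists r => //.
have nb z : `|z - y| < r -> boundary (cvset K) z -> dotv n z = dotv n y.
  move=> zr; rewrite (cv_polygonal adm) => -[s' /= s'K s'z].
  have [e|s's] := eqVneq s' s; first by apply: closure_edge_hyperplane sK sy _; rewrite -e.
  exfalso; apply: (hr z _ s' s'K s's s'z).
  by rewrite -ball_normE /= distrC.
have [t [t0 tr [Kt nKt]]] : exists t, [/\ 0 < t, `|t *: n| < r &
    cvset K (y - t *: n) /\ ~ cvset K (y + t *: n)].
  have h1 := normal_outward adm sK sy.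
  have h2 : \forall t \near 0^'+, `|t *: n| < r.
    near=> t; rewrite normrZ.
    have : t < r / (`|n| + 1) by near: t; apply: nbhs_right_lt; rewrite divr_gt0// ltr_wpDl.
    rewrite ltr_pdivlMr ?ltr_wpDl// => h; have t0 : 0 < t by near: t; exact: nbhs_right_gt.
    rewrite gtr0_norm//; have := normr_ge0 n; nra.
  have h3 : \forall t \near (0 : R)^'+, 0 < t by exact: nbhs_right_gt.
  have [t [[? ?] ?]] := filter_ex (filterI (filterI h1 h2) h3).
  by exists t.
have seg z w : `|z - y| < r -> `|w - y| < r ->
    (forall a, a \in `[0, 1] -> dotv n (w + a *: (z - w)) != dotv n y) ->
    cvset K w -> cvset K z.
  move=> zr wr nzw Kw; rewrite -(subrK w z) addrC.
  apply: segment_in_open => //; first exact: cv_open adm K.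
  move=> a a01 /nb h; have := nzw a a01; rewrite h ?eqxx//.
  exact: ball_segment.
have half z w : dotv n z < dotv n y -> dotv n w < dotv n y ->
    forall a, a \in `[0, 1] -> dotv n (w + a *: (z - w)) != dotv n y.
  move=> h1 h2 a; rewrite in_itv /= => /andP[a0 a1].
  by rewrite dotvDr dotvZr dotvBr lt_eqF//; exact: convex_lt.
have half' z w : dotv n y < dotv n z -> dotv n y < dotv n w ->
    forall a, a \in `[0, 1] -> dotv n (w + a *: (z - w)) != dotv n y.
  move=> h1 h2 a; rewrite in_itv /= => /andP[a0 a1].
  rewrite dotvDr dotvZr dotvBr gt_eqF// -ltrN2 opprD -mulrN opprB.
  by rewrite -[X in _ * X]addrC -[X in _ * (_ + X)]opprK; apply: convex_lt; rewrite ?ltrN2.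
move=> z zr; split => hz.
  apply: (@seg _ (y - t *: n)) => //; first by rewrite addrAC subrr add0r normrN.
  by apply: half => //; rewrite dotvBr dotvZr nn; lra.
move=> Kz; apply: nKt; apply: (@seg _ z) => //; first by rewrite addrAC subrr add0r.
by apply: half' => //; rewrite dotvDr dotvZr nn; lra.
Unshelve. all: by end_near. Qed.

(** Both normals are orthogonal to the same relatively open piece of hyperplane, so
    they agree up to sign; equal normals would make the cells overlap. *)
Lemma normal_opposite K L s : K != L -> s \in edges K -> s \in edges L ->
  normal L s = - normal K s.
Proof.
move=> KL sK sL.
have [x sx] := edge_nonempty sK.
have [_ [c [U oU sU]] _] := edge_polytope adm sK.
set p := normal K s in sU *; set q := normal L s.
have pp : dotv p p = 1 by apply/enorm1_dotv/(normal_unit adm).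
have qq : dotv q q = 1 by apply/enorm1_dotv/(normal_unit adm).
pose v := q - dotv q p *: p.
have pv : dotv p v = 0 by rewrite dotvBr dotvZr pp (dotvC q); ring.
have [t t0 Ut] : exists2 t, 0 < t & U (x + t *: v).
  have Ux : U x by move: sx; rewrite sU => -[].
  have : \forall t \near (0 : R), U (x + t *: v).
    have := @line_continuous R l x v (0 : R); apply; rewrite scale0r addr0.
    exact: open_nbhs_nbhs.
  move=> /nbhs_ballP[r /= r0 hr]; exists (r / 2); first by rewrite divr_gt0.
  apply: hr; rewrite -ball_normE /= sub0r normrN gtr0_norm ?divr_gt0//.
  by rewrite ltr_pdivrMr// ltr_pMr// ltr1n.
have st : edgeset s (x + t *: v).
  rewrite sU; split => //; move: sx; rewrite sU => -[_]; rewrite /hyperplane /=.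
  by rewrite dotvDr dotvZr pv mulr0 addr0.
have qv : dotv q v = 0.
  have := closure_edge_hyperplane sL sx (subset_closure st).
  rewrite -/q dotvDr dotvZr => h.
  have /eqP : t * dotv q v = 0 by lra.
  by rewrite mulf_eq0 gt_eqF//= => /eqP.
have /eqP : dotv v v = 0 by rewrite {1}/v dotvBl dotvZl qv pv mulr0 subrr.
rewrite dotv_eq0 subr_eq0 => /eqP qp.
have a2 : dotv q p ^+ 2 = 1 by move: qq; rewrite {1}qp dotvZl (dotvC p) expr2.
have /eqP := a2; rewrite sqrf_eq1 => /orP[/eqP a1|/eqP a1]; last first.
  by rewrite qp a1 scaleN1r.
have {}qp : q = p by rewrite qp a1 scale1r.
exfalso.
have [u [[Ku _] [Lu _]]] :=
  filter_ex (filterI (normal_outward adm sK sx) (normal_outward adm sL sx)).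
rewrite -/p -/q qp in Ku Lu.
by have := cv_disjoint adm KL; rewrite -subset0; apply; split; [exact: Ku | exact: Lu].
Qed.

End mesh_geometry.

(** * Segments crossing the mesh *)

Section crossings.
Context {R : realType} {l : nat}.
Variables (Omega : set 'rV[R]_l) (m : mesh R l).
Hypothesis adm : admissible_mesh Omega m.
Implicit Types (K L : cv m) (s : edge m) (x y e : 'rV[R]_l) (a b t : R).

(** The segment from [x] to [x + t *: e] avoids the rims of all edges, is parallel to
    no edge that it meets, and meets at most one edge. Such a segment passes from
    one cell to a neighbour through their interface. *)
Definition transverse e t x := forall K s a, s \in edges K -> a \in `[0, t] ->
  closure (edgeset s) (x + a *: e) ->
  [/\ edgeset s (x + a *: e), dotv (normal K s) e != 0 &
      forall K' s' a', s' \in edges K' -> a' \in `[0, t] ->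
        closure (edgeset s') (x + a' *: e) -> s' = s].

Lemma small_step e r d : 0 < r -> 0 < d -> exists b, [/\ 0 < b, b < d & `|b *: e| < r].
Proof.
move=> r0 d0; have e0 : 0 < `|e| + 1 by rewrite ltr_wpDl.
exists (Num.min (d / 2) (r / (`|e| + 1) / 2)).
have q0 : 0 < r / (`|e| + 1) by rewrite divr_gt0.
have b0 : 0 < Num.min (d / 2) (r / (`|e| + 1) / 2) by rewrite lt_min !divr_gt0.
split => //; first by rewrite gt_min; apply/orP; left; lra.
rewrite normrZ gtr0_norm//.
set b := Num.min _ _ in b0 *.
have hb : b < r / (`|e| + 1).
  by rewrite gt_min; apply/orP; right; lra.
rewrite ltr_pdivlMr// in hb; have := normr_ge0 e; nra.
Qed.

Lemma interfaceP K L s : s \in interface K L -> [/\ K != L, s \in edges K & s \in edges L].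
Proof.
by rewrite /interface; case: eqVneq => KL; rewrite ?inE// => /andP[].
Qed.

Lemma interface_mem K L s : K != L -> s \in edges K -> s \in edges L -> s \in interface K L.
Proof. by move=> /negPf KL sK sL; rewrite /interface KL inE sK. Qed.

Lemma line_in_cv K x e a b :
  (forall c, (a <= c <= b) || (b <= c <= a) -> ~ boundary (cvset K) (x + c *: e)) ->
  cvset K (x + a *: e) -> cvset K (x + b *: e).
Proof.
move=> nb Ka.
have -> : x + b *: e = x + a *: e + (b - a) *: e by rewrite scalerBl addrA addrAC addrK.
apply: segment_in_open => //; first exact: cv_open adm K.
move=> c; rewrite in_itv /= => /andP[c0 c1].
rewrite scalerA -addrA -scalerDl; apply: nb; apply/orP.
by have [ab|ba] := leP a b; [left|right]; apply/andP; split; nra.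
Qed.

Section one_segment.
Variables (e x : 'rV[R]_l) (t : R).
Hypotheses (t0 : 0 < t) (tr : transverse e t x).

Lemma unique_crossing K s a : s \in edges K -> a \in `[0, t] ->
  edgeset s (x + a *: e) ->
  forall c, c \in `[0, t] -> boundary (cvset K) (x + c *: e) -> c = a.
Proof.
move=> sK at0 sa c ct; rewrite (cv_polygonal adm) => -[s' /= s'K s'c].
have [_ ne u] := tr sK at0 (subset_closure sa).
have ss := u _ _ _ s'K ct s'c; rewrite ss in s'c.
have := closure_edge_hyperplane adm sK sa s'c.
by rewrite !dotvDr !dotvZr => /addrI /(mulIf ne).
Qed.

(** At the crossing point no other edge is near, by transversality. *)
Lemma half_space_at_crossing K s a : s \in edges K -> a \in `[0, t] ->
  edgeset s (x + a *: e) -> 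
  exists2 r, 0 < r & forall z, `|z - (x + a *: e)| < r ->
    (dotv (normal K s) z < dotv (normal K s) (x + a *: e) -> cvset K z) /\
    (dotv (normal K s) (x + a *: e) < dotv (normal K s) z -> ~ cvset K z).
Proof.
move=> sK at0 sa; apply: (cv_local_half_space adm) => // s' s'K s's s'a.
have [_ _ u] := tr sK at0 (subset_closure sa).
by move/eqP: s's; apply; exact: u s'K at0 s'a.
Qed.

Lemma cv_before_crossing K s a : s \in edges K -> a \in `]0, t[ ->
  edgeset s (x + a *: e) -> 0 < dotv (normal K s) e -> cvset K x.
Proof.
rewrite in_itv /= => sK /andP[a0 at0] sa ne.
have aI : a \in `[0, t] by rewrite in_itv /= !ltW.
have [r r0 hr] := half_space_at_crossing sK aI sa.
have [b [b0 ba br]] := small_step e r0 a0.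
have Kb : cvset K (x + (a - b) *: e).
  apply: (hr _ _).1.
    by rewrite scalerBl opprD addrACA subrr add0r addrAC subrr add0r normrN.
  by rewrite !dotvDr !dotvZr ltrD2l ltr_pM2r// ltrBlDr ltrDl.
rewrite -(addr0 x) -(scale0r e); apply: line_in_cv Kb => c /orP[/andP[c1 c2]|/andP[c1 c2]].
  lra.
move=> /(unique_crossing sK aI sa) h; have : c = a by apply: h; rewrite in_itv /= c1 /=; lra.
lra.
Qed.

Lemma cv_after_crossing K s a : s \in edges K -> a \in `]0, t[ ->
  edgeset s (x + a *: e) -> dotv (normal K s) e < 0 -> cvset K (x + t *: e).
Proof.
rewrite in_itv /= => sK /andP[a0 at0] sa ne.
have aI : a \in `[0, t] by rewrite in_itv /= !ltW.
have [r r0 hr] := half_space_at_crossing sK aI sa.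
have [b [b0 ba br]] : exists b, [/\ 0 < b, b < t - a & `|b *: e| < r].
  by apply: small_step => //; rewrite subr_gt0.
have Kb : cvset K (x + (a + b) *: e).
  apply: (hr _ _).1.
    by rewrite scalerDl opprD addrACA subrr add0r addrAC subrr add0r.
  by rewrite !dotvDr !dotvZr ltrD2l ltr_nM2r// ltrDl.
apply: line_in_cv Kb => c /orP[/andP[c1 c2]|/andP[c1 c2]]; last lra.
move=> /(unique_crossing sK aI sa) h; have : c = a.
  by apply: h; rewrite in_itv /= c2 andbT; lra.
lra.
Qed.

Lemma crossed_interface K L s a : s \in interface K L -> a \in `]0, t[ ->
  edgeset s (x + a *: e) -> 0 < dotv (normal K s) e ->
  cvset K x /\ cvset L (x + t *: e).
Proof.
move=> /interfaceP[KL sK sL] aI sa ne; split; first exact: cv_before_crossing aI sa ne.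
apply: cv_after_crossing aI sa _ => //.
by rewrite (normal_opposite adm KL sK sL) dotvNl oppr_lt0.
Qed.

Lemma crossing_interface K L : K != L -> cvset K x -> cvset L (x + t *: e) ->
  exists s a, [/\ s \in interface K L, a \in `]0, t[, edgeset s (x + a *: e) &
                  0 < dotv (normal K s) e].
Proof.
move=> KL Kx Lx.
have dis z : cvset K z -> cvset L z -> False.
  by move=> Kz Lz; have := cv_disjoint adm KL; rewrite -subset0; apply; split; [exact: Kz | exact: Lz].
have K0 : cvset K (x + 0 *: e) by rewrite scale0r addr0.
have exb N c d : 0 <= c <= t -> 0 <= d <= t -> cvset N (x + c *: e) -> ~ cvset N (x + d *: e) ->
    exists s a, [/\ s \in edges N, a \in `[0, t] & edgeset s (x + a *: e)].
  move=> /andP[c1 c2] /andP[d1 d2] Nc nd; apply: contrapT => h; apply: nd; apply: line_in_cv Nc => a aI.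
  rewrite (cv_polygonal adm) => -[s /= sN sa]; apply: h.
  have aT : a \in `[0, t].
    by rewrite in_itv /=; case/orP: aI => /andP[? ?]; apply/andP; split; lra.
  by have [sa' _ _] := tr sN aT sa; exists s, a.
have [s [a [sK aI sa]]] : exists s a, [/\ s \in edges K, a \in `[0, t] & edgeset s (x + a *: e)].
  by apply: (exb K 0 t) => //; rewrite ?lexx ?ltW//; move=> Kt; exact: dis Kt Lx.
have [s' [a' [sL aI' sa']]] : exists s a, [/\ s \in edges L, a \in `[0, t] & edgeset s (x + a *: e)].
  by apply: (exb L t 0) => //; rewrite ?lexx ?ltW//; move=> L0; exact: dis K0 L0.
have [_ ne u] := tr sK aI (subset_closure sa).
have ss : s' = s := u _ _ _ sL aI' (subset_closure sa').
rewrite ss in sL sa'.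
have aa : a \in `]0, t[.
  have := aI; rewrite !in_itv /= => /andP[h1 h2]; rewrite !lt_neqAle h1 h2 !andbT.
  apply/andP; split; apply/eqP => h.
    apply: (cv_not_boundary adm K0); rewrite h.
    by apply: (boundary_cv adm sK); exact: subset_closure.
  apply: (cv_not_boundary adm Lx); rewrite -h.
  by apply: (boundary_cv adm sL); exact: subset_closure.
exists s, a; split => //; first exact: interface_mem.
rewrite lt_neqAle eq_sym ne /= leNgt; apply/negP => nlt.
exact: dis (cv_after_crossing sK aa sa nlt) Lx.
Qed.

End one_segment.
End crossings.

(** * Segments tangent to the mesh or crossing two edges *)

Section null_sets.
Context {R : realType} {l : nat}.
Implicit Types (A B N : set 'rV[R]_l) (x y e n p q : 'rV[R]_l).

Definition null A := [/\ measurable A, bounded_set A & volume A = 0].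

Lemma null0 : null set0.
Proof. by split => //; [apply/bounded_setP; exists 0 | exact: volume0]. Qed.

Lemma null_bigU (I : finType) (N : I -> set 'rV[R]_l) :
  (forall i, null (N i)) -> null (\bigcup_i N i).
Proof.
move=> hN.
have mU : measurable (\bigcup_i N i).
  by apply: fin_bigcup_measurable => // i _; have [] := hN i.
have bU : bounded_set (\bigcup_i N i).
  have /choice[r hr] i : exists r, forall x, N i x -> `|x| <= r.
    by have [_ /bounded_setP] := hN i.
  apply/bounded_setP; exists (\sum_i `|r i|) => x [i _] /hr xr.
  rewrite (bigD1 i)//= (le_trans xr)// (le_trans (ler_norm _))// lerDl.
  exact: sumr_ge0.
split => //; apply/eqP; rewrite eq_le volume_ge0 andbT.
rewrite (_ : 0 = \sum_(i : I) volume (N i)); last first.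
  by rewrite big1// => i _; have [] := hN i.
apply: volume_le_sum => // [i _|i _|x [i _ Ni]]; [by have [] := hN i|by have [] := hN i|].
by exists i.
Qed.

Lemma null_seqU (T : eqType) (s : seq T) (N : T -> set 'rV[R]_l) :
  (forall i, i \in s -> null (N i)) -> exists2 M, null M & forall i, i \in s -> N i `<=` M.
Proof.
move=> h.
exists (\bigcup_(i : 'I_(size s)) N (tnth (in_tuple s) i)).
  by apply: null_bigU => i; apply: h; exact: mem_tnth.
move=> i /(tnthP (in_tuple s))[j ->] x Nx; by exists j.
Qed.

Lemma null_hyperplane q (d r : R) : q != 0 -> null (hyperplane q d `&` ball 0 r).
Proof.
move=> q0.
have mH : measurable (hyperplane q d `&` ball 0 r).
  apply: measurableI; last exact: measurable_ball_rV.
  by apply: closed_measurable_rV; exact: closed_hyperplane.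
have bH : bounded_set (hyperplane q d `&` ball 0 r).
  apply/bounded_setP; exists r => x [_].
  by rewrite -ball_normE /= sub0r normrN => /ltW.
split => //; apply: (@volume_sub_hyperplane _ _ q d) => //; exact: subIsetl.
Qed.

(** The intersection of two transversal hyperplanes has codimension two, so that
    all lines of a given direction meeting it lie in a third hyperplane. *)
Lemma codim2_sweep n p e (c d : R) : dotv n n = 1 -> (forall a, p <> a *: n) ->
  exists q (b : R), q != 0 /\ forall x (a : R), dotv n (x + a *: e) = c ->
    dotv p (x + a *: e) = d -> dotv q x = b.
Proof.
move=> nn np.
have n0 : n != 0 by rewrite -dotv_eq0 nn oner_eq0.
have [ne|ne] := eqVneq (dotv n e) 0.
  have [pe|pe] := eqVneq (dotv p e) 0.
    by exists n, c; split => // x a <- _; rewrite dotvDr dotvZr ne mulr0 addr0.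
  by exists n, c; split => // x a <- _; rewrite dotvDr dotvZr ne mulr0 addr0.
exists (dotv p e *: n - dotv n e *: p), (dotv p e * c - dotv n e * d); split.
  rewrite subr_eq0; apply/eqP => h; apply: (np ((dotv n e)^-1 * dotv p e)).
  by rewrite -scalerA h scalerA mulVf// scale1r.
by move=> x a <- <-; rewrite dotvBl !dotvZl !dotvDr !dotvZr; ring.
Qed.

Lemma bounded_closure A : bounded_set A -> bounded_set (closure A).
Proof.
move=> /bounded_setP[r h]; apply/bounded_setP; exists r => x.
have : closed [set x : 'rV[R]_l | `|x| <= r].
  rewrite (_ : [set x : 'rV[R]_l | `|x| <= r] = (fun x : 'rV[R]_l => `|x|) @^-1` [set s | s <= r])//.
  by apply: closed_comp; [move=> y _; exact: norm_continuous | exact: closed_le].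
move=> /closure_id e cx.
by have : [set x : 'rV[R]_l | `|x| <= r] x by rewrite e; apply: closure_subset cx => y /h.
Qed.

End null_sets.

Section bad_segments.
Context {R : realType} {l : nat}.
Variables (Omega : set 'rV[R]_l) (m : mesh R l).
Hypotheses (adm : admissible_mesh Omega m) (bO : bounded_set Omega).
Implicit Types (K L : cv m) (s : edge m) (x y e : 'rV[R]_l) (a b t : R).

Lemma bounded_edge K s : s \in edges K -> bounded_set (edgeset s).
Proof.
move=> sK; apply: (@bounded_subset _ _ _ (closure Omega)); last exact: bounded_closure.
move=> x sx; have [h _] : boundary (cvset K) x.
  by apply: (boundary_cv adm sK); exact: subset_closure.
by apply: closure_subset h; exact: cv_sub adm K.
Qed.

Lemma edge_normal_unit K s : s \in edges K -> dotv (normal K s) (normal K s) = 1.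
Proof. by move=> sK; apply/enorm1_dotv/(normal_unit adm). Qed.

(** The rim of an edge is contained in finitely many sets of codimension two, whose
    translates along [e] fill only a negligible set. *)
Lemma edge_rim_null K s e r : s \in edges K -> exists2 N, null N &
  forall x a, `|x| < r -> closure (edgeset s) (x + a *: e) -> ~ edgeset s (x + a *: e) -> N x.
Proof.
move=> sK; have [_ [c [U oU sU]] [H hH rim]] := edge_polytope adm sK.
have [y sy] := edge_nonempty adm sK.
set n := normal K s in sU hH *; have nn := edge_normal_unit sK; rewrite -/n in nn.
have /choice[Nf hNf] (p : 'rV[R]_l * R) : exists N, p \in H -> null N /\
    forall x a, `|x| < r -> dotv n (x + a *: e) = dotv n y -> dotv p.1 (x + a *: e) = p.2 -> N x.
  case: (boolP (p \in H)) => pH; last by exists set0.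
  have [q [b [q0 qb]]] := codim2_sweep e (dotv n y) p.2 nn (hH _ pH).
  exists (hyperplane q b `&` ball 0 r) => _; split; first exact: null_hyperplane.
  move=> x a xr h1 h2; split; first exact: qb h1 h2.
  by rewrite -ball_normE /= sub0r normrN.
have [N nN hN] : exists2 M, null M & forall p, p \in H -> Nf p `<=` M.
  by apply: null_seqU => p /hNf[].
exists N => // x a xr cx nx.
have [p pH hp] := rim _ (conj cx nx).
apply: (hN _ pH); apply: (hNf _ pH).2 _ _ xr _ hp.
exact: (closure_edge_hyperplane adm sK sy cx).
Qed.

Lemma edge_parallel_null K s e r : s \in edges K -> dotv (normal K s) e = 0 ->
  exists2 N, null N & forall x a, `|x| < r -> closure (edgeset s) (x + a *: e) -> N x.
Proof.
move=> sK ne; have [y sy] := edge_nonempty adm sK.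
exists (hyperplane (normal K s) (dotv (normal K s) y) `&` ball 0 r).
  by apply: null_hyperplane; rewrite -dotv_eq0 edge_normal_unit// oner_eq0.
move=> x a xr /(closure_edge_hyperplane adm sK sy); rewrite dotvDr dotvZr ne mulr0 addr0 => h.
by split => //; rewrite -ball_normE /= sub0r normrN.
Qed.

(** A single negligible set accounts for all lines of direction [e] through points of
    a given ball that are parallel to an edge that they meet or touch a rim. *)
Lemma tangency_null e r : exists2 N, null N & forall x, `|x| < r -> ~ N x ->
  forall K s a, s \in edges K -> closure (edgeset s) (x + a *: e) ->
  edgeset s (x + a *: e) /\ dotv (normal K s) e != 0.
Proof.
have /choice[N hN] (p : cv m * edge m) : exists N, null N /\
    forall x, `|x| < r -> ~ N x -> forall a, p.2 \in edges p.1 ->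
    closure (edgeset p.2) (x + a *: e) ->
    edgeset p.2 (x + a *: e) /\ dotv (normal p.1 p.2) e != 0.
  case: (boolP (p.2 \in edges p.1)) => pe; last first.
    by exists set0; split => //; exact: null0.
  have [N1 nN1 h1] := edge_rim_null e r pe.
  have [ne|ne] := eqVneq (dotv (normal p.1 p.2) e) 0.
    have [N2 nN2 h2] := edge_parallel_null r pe ne.
    by exists N2; split => // x xr nx a _ /(h2 _ _ xr).
  exists N1; split => // x xr nx a _ cx; split => //; apply: contrapT => ncx.
  exact: nx (h1 _ _ xr cx ncx).
exists (\bigcup_p N p); first by apply: null_bigU => p; have [] := hN p.
move=> x xr nx K s a sK cx; apply: ((hN (K, s)).2 x xr _ a sK cx).
by move=> h; apply: nx; exists (K, s).
Qed.

Definition near_edge s (d : R) : set 'rV[R]_l :=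
  [set z | exists2 y, edgeset s y & `|z - y| < d].

Lemma open_near_edge s d : open (near_edge s d).
Proof.
rewrite openE => z [y sy zy].
apply/nbhs_ballP; exists (d - `|z - y|); first by rewrite /= subr_gt0.
move=> w; rewrite -ball_normE /= => zw; exists y => //.
rewrite (_ : w - y = - (z - w) + (z - y)); last by apply/rowP => i; rewrite !mxE; ring.
by rewrite (le_lt_trans (ler_normD _ _))// normrN -ltrBrDr.
Qed.

Lemma near_edge_mono s d d' : d <= d' -> near_edge s d `<=` near_edge s d'.
Proof. by move=> dd x [y sy h]; exists y => //; exact: lt_le_trans dd. Qed.

(** The part of an edge that lies close to another edge shrinks to their common
    rim, which is negligible. *)
Lemma hvolume_near_edge K K' s s' eps : s \in edges K -> s' \in edges K' -> s != s' ->
  0 < eps -> \forall d \near 0^'+,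
    hvolume (normal K s) (edgeset s `&` near_edge s' d) <= eps.
Proof.
move=> sK sK' ss eps0.
have [_ [c [U oU sU]] _] := edge_polytope adm sK.
set n := normal K s in sU *; have nn := edge_normal_unit sK; rewrite -/n in nn.
have bs : bounded_set (U `&` hyperplane n c) by rewrite -sU; exact: bounded_edge sK.
have eU d : edgeset s `&` near_edge s' d = (U `&` near_edge s' d) `&` hyperplane n c.
  by rewrite sU setIAC.
have bd d : bounded_set ((U `&` near_edge s' d) `&` hyperplane n c).
  by apply: bounded_subset bs => x [[]].
have mU d : measurable (U `&` near_edge s' d).
  by apply: open_measurable_rV; apply: openI => //; exact: open_near_edge.
pose S d := slab n c (U `&` near_edge s' d) `[0, 1[%classic.
have hS d : hvolume n (edgeset s `&` near_edge s' d) = volume (S d).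
  by rewrite eU hvolume_slab.
have mS d : measurable (S d) by apply: measurable_slab => //; exact: measurable_itv.
have bS d : bounded_set (S d).
  apply: (@bounded_slab _ _ n c _ nn (bd d) _ 1) => a /=; rewrite in_itv /= => /andP[a0 a1].
  by rewrite ger0_norm// ltW.
pose F (k : nat) := S k.+1%:R^-1.
have [r hr] := (bounded_setP _).1 (bS 1).
have [N nN hN] := edge_rim_null n (r + 1) sK'.
have cv0 : lebesgue_rV l (F k) @[k --> \oo] --> 0%E.
  have -> : 0%E = lebesgue_rV l (\bigcap_k F k).
    apply/esym/eqP; rewrite eq_le measure_ge0 andbT.
    have [mN bN vN] := nN.
    have v0 : lebesgue_rV l N = 0%E by rewrite volumeE// vN.
    rewrite -v0.
    apply: le_measure; rewrite ?inE//; first by apply: bigcapT_measurable => k; exact: mS.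
    move=> x Fx.
    have [_ [Ux _]] := Fx 0%N Logic.I.
    have nx : dotv n (x - (dotv n x - c) *: n) = c by rewrite dotvBr dotvZr nn; ring.
    have sx : edgeset s (x - (dotv n x - c) *: n) by rewrite sU; split.
    apply: (hN _ (- (dotv n x - c))).
    - rewrite (@le_lt_trans _ _ r)// ?ltrDl//; apply: hr.
      by have := Fx 0%N Logic.I; rewrite /F invr1.
    - rewrite scaleNr => B /nbhs_ballP[d /= d0 dB].
      have [k kd] : exists k : nat, k.+1%:R^-1 < d.
        by have [k _ kP] := near_infty_natSinv_lt (PosNum d0); exists k; apply: kP => /=.
      have [_ [_ [y sy yx]]] := Fx k Logic.I.
      exists y; split => //; apply: dB; rewrite -ball_normE /=.
      exact: lt_trans kd.
    - rewrite scaleNr => sx'; have := edge_disjoint adm ss; rewrite -subset0.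
      by apply; split; [exact: sx | exact: sx'].
  apply: nonincreasing_cvg_mu => //.
  - by apply: bounded_finite_measure; [exact: mS|exact: bS].
  - by move=> k; exact: mS.
  - by apply: bigcapT_measurable => k; exact: mS.
  - apply/nonincreasing_seqP => k; apply/subsetPset => x [h [Ux nx]]; split => //; split => //.
    apply: near_edge_mono nx; rewrite lef_pV2 ?posrE// ler_nat//.
have [k hk] : exists k, volume (F k) <= eps.
  have : \forall k \near \oo, (lebesgue_rV l (F k) < eps%:E)%E.
    have n0 : nbhs (0%E : \bar R) [set y : \bar R | (y < eps%:E)%E].
      by apply: open_nbhs_nbhs; split; [exact: open_ereal_lt_ereal | rewrite /= lte_fin].
    exact: (cv0 _ n0).
  move=> [k _ hk]; exists k; have := hk k (leqnn k) => /=.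
  by rewrite /F (volumeE (mS _) (bS _)) lte_fin => /ltW.
near=> d; rewrite hS; apply: le_trans hk; apply: le_volume; [exact: mS|exact: mS|exact: bS|].
move=> x [h [Ux nx]]; split => //; split => //; apply: near_edge_mono nx.
by near: d; apply: nbhs_right_le; rewrite invr_gt0.
Unshelve. all: by end_near. Qed.

End bad_segments.

Section at_right.
Context {R : realType}.

Lemma near_at_rightP (P : R -> Prop) :
  (\forall t \near 0^'+, P t) <-> exists2 d, 0 < d & forall t, 0 < t -> t < d -> P t.
Proof.
split.
  move=> [d /= d0 h]; exists d => // t t0 td; apply: h => //=.
  by rewrite sub0r normrN gtr0_norm.
move=> [d d0 h]; near=> t; apply: h; first by near: t; exact: nbhs_right_gt.
by near: t; apply: nbhs_right_lt.
Unshelve. all: by end_near. Qed.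
End at_right.

Section transfer.
Context {R : realType} {l : nat}.
Variables (Omega : set 'rV[R]_l) (m : mesh R l).
Hypotheses (adm : admissible_mesh Omega m) (bO : bounded_set Omega) (oO : open Omega).
Implicit Types (K L : cv m) (s : edge m) (x y e : 'rV[R]_l) (a b t r eps : R).

Lemma volume_leU (A B C : set 'rV[R]_l) : measurable A -> measurable B -> measurable C ->
  bounded_set A -> bounded_set B -> bounded_set C ->
  (forall x, A x -> B x \/ C x) -> volume A <= volume B + volume C.
Proof.
move=> mA mB mC bA bB bC h.
rewrite (_ : volume B + volume C = \sum_(i : bool) volume (if i then B else C)); last first.
  by rewrite big_bool.
apply: volume_le_sum => //; [by case|by case|].
by move=> x /h[Bx|Cx]; [exists true | exists false].
Qed.

Lemma edge_sweep K s e t (V : set 'rV[R]_l) : s \in edges K -> open V ->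
  dotv (normal K s) e != 0 -> 0 <= t ->
  [/\ measurable (sweep (edgeset s `&` V) e t), bounded_set (sweep (edgeset s `&` V) e t) &
    volume (sweep (edgeset s `&` V) e t) =
    t * `|dotv (normal K s) e| * hvolume (normal K s) (edgeset s `&` V)].
Proof.
move=> sK oV ne t0.
have [_ [c [U oU sU]] _] := edge_polytope adm sK.
have bs : bounded_set (edgeset s `&` V).
  by apply: bounded_subset (bounded_edge adm bO sK) => x [].
have bS := bounded_sweep e t bs.
have eS : edgeset s `&` V = (U `&` V) `&` hyperplane (normal K s) c by rewrite sU setIAC.
rewrite eS in bs bS *.
have [? ?] := volume_sweep (edge_normal_unit adm sK)
  (open_measurable_rV (openI oU oV)) bs ne t0.
by split.
Qed.

(** A segment of length of order [t] that meets two edges starts in the prism swept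
    by the points of the first edge at distance [O(t)] from the second one. Such a
    prism has volume [t] times a measure that tends to [0]. *)
Lemma transverse_off_small e r eps : 0 < eps -> \forall t \near 0^'+,
  exists B : set 'rV[R]_l, [/\ measurable B, bounded_set B, volume B <= eps * t &
    forall x, `|x| < r -> ~ B x -> transverse m e t x].
Proof.
move=> eps0.
have [N [mN bN vN] hN] := tangency_null adm e r.
pose I := ((cv m * edge m) * (cv m * edge m))%type.
pose cond (p : I) := [&& p.1.2 \in edges p.1.1, p.2.2 \in edges p.2.1, p.1.2 != p.2.2 &
   dotv (normal p.1.1 p.1.2) e != 0].
pose S (p : I) t := edgeset p.1.2 `&` near_edge p.2.2 (t * (`|e| + 1)).
(* Crossing times in [0, t] are shifted into the open interval ]0, 3 * t[. *)
pose W (p : I) t := (fun x => x + - (t *: e)) @^-1` sweep (S p t) e (3 * t).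
have e1 : 0 < `|e| + 1 by rewrite ltr_wpDl.
pose eps' := eps / (#|{: I}|%:R + 1).
have eps'0 : 0 < eps' by rewrite divr_gt0// ltr_wpDl.
have : \forall t \near (0:R)^'+, forall p, cond p ->
   [/\ measurable (W p t), bounded_set (W p t) & volume (W p t) <= eps' * t].
  apply: (@filter_forall _ _ (fun p t => cond p -> [/\ measurable (W p t), bounded_set (W p t) & volume (W p t) <= eps' * t])) => p.
  case: (boolP (cond p)) => cp; last by near=> t.
  have /and4P[sK sK' ss ne] := cp.
  have g0 : 0 < eps' / (3 * `|dotv (normal p.1.1 p.1.2) e|).
    by rewrite divr_gt0// mulr_gt0// normr_gt0.
  have /near_at_rightP[d d0 hd] := hvolume_near_edge adm bO sK sK' ss g0.
  apply/near_at_rightP; exists (d / (`|e| + 1)); first by rewrite divr_gt0.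
  move=> t t0 td _.
  have t30 : 0 <= 3 * t by rewrite mulr_ge0// ltW.
  have [mS bS vS] := edge_sweep sK (@open_near_edge _ _ m p.2.2 (t * (`|e| + 1))) ne t30.
  split; [exact: measurable_shift | exact: bounded_shift |].
  rewrite volume_shift// vS.
  have : hvolume (normal p.1.1 p.1.2) (S p t) <= eps' / (3 * `|dotv (normal p.1.1 p.1.2) e|).
    by apply: hd; [rewrite mulr_gt0 | rewrite -ltr_pdivlMr].
  rewrite ler_pdivlMr ?mulr_gt0 ?normr_gt0// => h.
  rewrite -/(S p t) (_ : _ * _ = hvolume (normal p.1.1 p.1.2) (S p t) * (3 * `|dotv (normal p.1.1 p.1.2) e|) * t).
    by rewrite ler_wpM2r// ltW.
  by ring.
move=> /near_at_rightP[d d0 hd]; apply/near_at_rightP; exists d => // t t0 td.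
have {}hd := hd t t0 td.
pose C (j : option I) := if j is Some p then (if cond p then W p t else set0) else N.
have mC j : measurable (C j).
  by case: j => [p|] //=; case: ifP => // /hd[].
have bC j : bounded_set (C j).
  case: j => [p|] //=; case: ifP => [/hd[]//|_]; by have [_ ? _] := @null0 R l.
have mB : measurable (\bigcup_j C j) by apply: fin_bigcup_measurable => [|j _]; [exact: finite_finset|exact: mC].
have bB : bounded_set (\bigcup_j C j).
  have /choice[M hM] j : exists M, forall x, C j x -> `|x| <= M by apply/bounded_setP.
  apply/bounded_setP; exists (\sum_j `|M j|) => x [j _ /hM xr].
  rewrite (bigD1 j)//= (le_trans xr)// (le_trans (ler_norm _))// lerDl.
  exact: sumr_ge0.
exists (\bigcup_j C j); split => //.
  apply: (@le_trans _ _ (\sum_j volume (C j))).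
    by apply: volume_le_sum => // x [j _ ?]; exists j.
  apply: (@le_trans _ _ (\sum_(j : option I) (if j is Some p then eps' * t else 0))).
    apply: ler_sum => -[p|] _ /=; last by rewrite vN.
    by case: ifP => [/hd[]//|_]; rewrite volume0 mulr_ge0// ltW.
  rewrite (bigD1 None)//= add0r.
  rewrite (eq_bigr (fun=> eps' * t)); last by case.
  rewrite sumr_const -mulr_natl.
  have -> : eps * t = (#|{: I}|%:R + 1) * (eps' * t).
    by rewrite /eps' mulrA (mulrC _ (eps / _)) divfK// gt_eqF// ltr_wpDl.
  rewrite ler_wpM2r ?mulr_ge0 ?ltW//.
  have -> : #|[pred i : option I | i != None]| = #|{: I}|.
    have si : injective (@Some I) by move=> p q [].
    rewrite -(card_imset _ si); apply: eq_card => -[p|].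
      by rewrite !inE /=; apply/esym/imsetP; exists p.
    by rewrite !inE /=; apply/esym/negP => /imsetP[].
  by rewrite ltrDl.
move=> x xr nB.
have nN : ~ N x by move=> Nx; apply: nB; exists None.
move=> K s a sK aI sa.
have [sa' ne] := hN x xr nN _ _ _ sK sa.
split => // K' s' a' sK' aI' sa'2; apply: contrapT => ss.
apply: nB.
have cp : cond ((K, s), (K', s')).
  by rewrite /cond /= sK sK' ne andbT; apply/eqP => h; apply: ss.
exists (Some ((K, s), (K', s'))) => //=; rewrite cp /W /=.
move: aI aI'; rewrite !in_itv /= => /andP[a0 at_] /andP[a'0 a't].
exists (a + t); first by rewrite in_itv /=; apply/andP; split; lra.
have -> : x - t *: e + (a + t) *: e = x + a *: e.
  by rewrite scalerDl addrACA (addrC (- _)) addrA -addrA subrr addr0.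
split => //=.
set y := x + a *: e; set y' := x + a' *: e in sa'2.
have yy : `|y - y'| < t * (`|e| + 1).
  rewrite /y /y' opprD addrACA subrr add0r -scalerBl normrZ.
  have : `|a - a'| <= t by rewrite ler_norml; apply/andP; split; lra.
  have := normr_ge0 e; have := normr_ge0 (a - a'); nra.
have [z [sz zy]] : exists z, edgeset s' z /\ `|y' - z| < t * (`|e| + 1) - `|y - y'|.
  have r'0 : 0 < t * (`|e| + 1) - `|y - y'| by rewrite subr_gt0.
  have [z [sz zy]] := sa'2 _ (nbhsx_ballx y' _ r'0).
  by exists z; split => //; move: zy; rewrite -ball_normE.
exists z => //.
rewrite (_ : y - z = (y - y') + (y' - z)); last by rewrite addrA subrK.
by rewrite (le_lt_trans (ler_normD _ _))// -ltrBrDl.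
Unshelve. all: by end_near. Qed.

End transfer.

(** * Exchange of volume under a translation *)

Section transfer.
Context {R : realType} {l : nat}.
Variables (Omega : set 'rV[R]_l) (m : mesh R l).
Hypotheses (adm : admissible_mesh Omega m) (bO : bounded_set Omega) (oO : open Omega).
Implicit Types (K L : cv m) (s : edge m) (x y e : 'rV[R]_l) (a b t r eps : R).

Definition moved (A : set 'rV[R]_l) e t : set 'rV[R]_l := (fun x => x + t *: e) @^-1` A.

Lemma measurable_cv K : measurable (cvset K).
Proof. by apply: open_measurable_rV; exact: cv_open adm K. Qed.

Lemma bounded_cv K : bounded_set (cvset K).
Proof. by apply: bounded_subset bO; exact: cv_sub adm K. Qed.

Let mK := measurable_cv.
Let bK := bounded_cv.

(** The rate at which volume passes from [K] to [L] under the translation along [e]. *)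
Definition outflow K L e : R :=
  \sum_(s in interface K L) Num.max 0 (dotv (normal K s) e) * edge_measure K s.

Lemma interface_cases K L : interface K L = finset.set0 \/
  exists2 s, s \in interface K L & interface K L = [set s]%SET.
Proof.
have [->|[s sI]] := set_0Vmem (interface K L); [by left|right].
exists s => //; apply/setP => s'; rewrite inE; apply/idP/eqP => [s'I|->//].
exact: (interface_unique adm) s'I sI.
Qed.

(** Off the small set of non-transverse segments, the starting points of the segments
    from [K] to [L] are exactly the points of the prism swept by the interface,
    provided that its normal points along [e]. *)
Lemma volume_transfer K L e eps : K != L -> 0 < eps -> \forall t \near 0^'+,
  `|volume (cvset K `&` moved (cvset L) e t) - t * outflow K L e| <= eps * t.
Proof.
move=> KL eps0.
have [r0 hr0] := (bounded_setP _).1 (bounded_closure bO).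
have /near_at_rightP[d d0 hd] := transverse_off_small adm bO e (`|r0| + `|e| + 1) eps0.
apply/near_at_rightP; exists (Num.min d 1); first by rewrite lt_min d0 ltr01.
move=> t t0; rewrite lt_min => /andP[td t1].
have [B [mB bB vB hB]] := hd t t0 td.
have mX : measurable (cvset K `&` moved (cvset L) e t).
  by apply: measurableI => //; exact: measurable_shift.
have bX : bounded_set (cvset K `&` moved (cvset L) e t).
  by apply: bounded_subset (bK K) => x [].
have small x a : 0 <= a <= t -> closure Omega (x + a *: e) -> `|x| < `|r0| + `|e| + 1.
  move=> /andP[a0 at_] /hr0 h; rewrite -(addrK (a *: e) x).
  apply: (le_lt_trans (ler_normB _ _)); rewrite normrZ ger0_norm//.
  have := ler_norm r0; have : a * `|e| <= 1 * `|e| by rewrite ler_wpM2r//; lra.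
  lra.
have KO x : cvset K x -> `|x| < `|r0| + `|e| + 1.
  move=> Kx; apply: (small _ 0); rewrite ?lexx ?ltW// scale0r addr0.
  by apply: subset_closure; exact: cv_sub adm K _ Kx.
have tr x : cvset K x -> ~ B x -> transverse m e t x by move=> /KO xr; exact: hB.
have none : (forall s, s \in interface K L -> dotv (normal K s) e <= 0) ->
    `|volume (cvset K `&` moved (cvset L) e t) - t * outflow K L e| <= eps * t.
  move=> h; rewrite /outflow big1 => [|s sI]; last by rewrite max_l ?mul0r// h.
  rewrite mulr0 subr0 ger0_norm ?volume_ge0// (le_trans _ vB)//; apply: le_volume => //.
  move=> x [Kx Lx]; apply: contrapT => nB.
  have [s [a [sI _ _]]] := crossing_interface adm t0 (tr _ Kx nB) KL Kx Lx.
  by rewrite ltNge h.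
have [I0|[s sI I1]] := interface_cases K L.
  by apply: none => s; rewrite I0 inE.
have [ne|ne] := leP (dotv (normal K s) e) 0.
  by apply: none => s'; rewrite I1 inE => /eqP ->.
have [_ sK sL] := interfaceP sI.
have [mY bY vY] := edge_sweep adm bO sK openT (lt0r_neq0 ne) (ltW t0).
rewrite setIT in mY bY vY.
have -> : t * outflow K L e = volume (sweep (edgeset s) e t).
  rewrite vY /outflow I1 big_set1 max_r ?ltW// gtr0_norm//.
  by rewrite /edge_measure; ring.
have h1 : volume (cvset K `&` moved (cvset L) e t) <= volume (sweep (edgeset s) e t) + volume B.
  apply: volume_leU => // x [Kx Lx].
  have [Bx|nB] := pselect (B x); [by right|left].
  have [s' [a [s'I aI sa _]]] := crossing_interface adm t0 (tr _ Kx nB) KL Kx Lx.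
  by rewrite I1 inE in s'I; rewrite (eqP s'I) in sa; exists a.
have h2 : volume (sweep (edgeset s) e t) <= volume (cvset K `&` moved (cvset L) e t) + volume B.
  apply: volume_leU => // x [a aI sa].
  have [Bx|nB] := pselect (B x); [by right|left].
  have xs : `|x| < `|r0| + `|e| + 1.
    apply: (small _ a); first by move: aI; rewrite in_itv /= => /andP[/ltW -> /ltW ->].
    have [h _] : boundary (cvset K) (x + a *: e).
      by apply: (boundary_cv adm sK); exact: subset_closure.
    by apply: closure_subset h; exact: cv_sub adm K.
  have [? ?] := crossed_interface adm (hB x xs nB) sI aI sa ne.
  by split.
by rewrite ler_norml; apply/andP; split; lra.
Qed.

(** The cells fill the domain up to their boundaries, which lie in hyperplanes. *)
Lemma cover_null : exists2 N, null N & forall x, Omega x -> N x \/ exists K, cvset K x.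
Proof.
have [r hr] := (bounded_setP _).1 bO.
have [N nN hN] := tangency_null adm 0 (r + 1).
exists N => // x Ox; apply: contrapT => /not_orP[nN' nK].
have : closure Omega x by exact: subset_closure.
rewrite -(cv_cover adm) => -[K _ cK].
have : boundary (cvset K) x.
  by split => // /interior_subset Kx; apply: nK; exists K.
rewrite (cv_polygonal adm) => -[s /= sK sx].
have xr : `|x| < r + 1 by rewrite (le_lt_trans (hr _ Ox))// ltrDl.
have := hN x xr nN' K s 0 sK; rewrite !scaler0 !addr0 => /(_ sx)[_].
by rewrite /dotv big1 ?eqxx// => i _; rewrite mxE mulr0.
Qed.

(** The volume of [K] that is carried into no cell. *)
Definition deficiency K e t : R :=
  volume (cvset K) - \sum_(L : cv m) volume (cvset K `&` moved (cvset L) e t).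

Lemma measurable_moved K e t : measurable (moved (cvset K) e t).
Proof. by apply: measurable_shift; exact: mK. Qed.

Lemma deficiency_ge0 K e t : 0 <= deficiency K e t.
Proof.
rewrite subr_ge0; apply: sum_volume_le => //.
- by move=> L _; apply: measurableI => //; exact: measurable_moved.
- move=> L L' _ _ LL; rewrite -subset0 => x [[_ Lx] [_ Lx']].
  have := cv_disjoint adm LL; rewrite -subset0 => /(_ (x + t *: e)); apply.
  by split; [exact: Lx | exact: Lx'].
Qed.

Lemma sum_deficiency e t : \sum_K deficiency K e t <=
  volume (Omega `&` ~` moved Omega e t).
Proof.
have mO : measurable Omega by exact: open_measurable_rV.
have mOt : measurable (~` moved Omega e t) by apply: measurableC; exact: measurable_shift.
apply: (@le_trans _ _ (\sum_K volume (cvset K `&` ~` moved Omega e t))); last first.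
  apply: sum_volume_le => //.
  - exact: measurableI.
  - by apply: bounded_subset bO => x [].
  - by move=> K _; apply: measurableI.
  - by move=> K _ x [Kx ?]; split => //; exact: cv_sub adm K _ Kx.
  - move=> L L' _ _ LL; rewrite -subset0 => x [[Lx _] [Lx' _]].
    by have := cv_disjoint adm LL; rewrite -subset0; apply; split; [exact: Lx | exact: Lx'].
apply: ler_sum => K _; rewrite lerBlDr.
have [N [mN bN vN] hN] := cover_null.
pose C (j : cv m + bool) := match j with
  | inl L => cvset K `&` moved (cvset L) e t
  | inr true => moved N e t
  | inr false => cvset K `&` ~` moved Omega e t end.
have -> : volume (cvset K `&` ~` moved Omega e t) +
  \sum_(L : cv m) volume (cvset K `&` moved (cvset L) e t) = \sum_j volume (C j).
  by rewrite big_sumType /= big_bool /= volume_shift// vN add0r addrC.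
apply: volume_le_sum => //.
- move=> [L|[]] _ /=; [|exact: measurable_shift|exact: measurableI].
  by apply: measurableI => //; exact: measurable_moved.
- move=> [L|[]] _ /=; [|exact: bounded_shift|]; by apply: bounded_subset (bK K) => x [].
- move=> x Kx; have [Ox|nOx] := pselect (moved Omega e t x); last by exists (inr false).
  have [Nx|[L Lx]] := hN _ Ox; first by exists (inr true).
  by exists (inl L).
Qed.

Lemma transfer_sym K L e t :
  volume (cvset K `&` moved (cvset L) e t) = volume (cvset L `&` moved (cvset K) (- e) t).
Proof.
rewrite -[RHS](volume_shift (t *: e)); last first.
  by apply: measurableI => //; exact: measurable_moved.
congr volume; apply/funext => x; apply/propext.
by rewrite /moved /setI /mkset /= scalerN addrK; split=> -[? ?]; split.
Qed.

(** Summation by parts for the volumes exchanged between the cells when they are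
    translated by [t *: e]: only what leaves the domain is not compensated. *)
Lemma transfer_sum_le (w : cv m -> R) W e t : 0 <= W -> (forall K, `|w K| <= W) ->
  `|\sum_K \sum_L (w L - w K) * volume (cvset K `&` moved (cvset L) e t)| <=
  W * (volume (Omega `&` ~` moved Omega e t) + volume (Omega `&` ~` moved Omega (- e) t)).
Proof.
move=> W_ge0 wW.
have -> : \sum_K \sum_L (w L - w K) * volume (cvset K `&` moved (cvset L) e t) =
   \sum_K w K * deficiency K e t - \sum_K w K * deficiency K (- e) t.
  have E e' : \sum_K w K * deficiency K e' t =
     \sum_K w K * volume (cvset K) - \sum_(K : cv m) \sum_(L : cv m) w K * volume (cvset K `&` moved (cvset L) e' t).
    by rewrite -sumrB; apply: eq_bigr => K _; rewrite /deficiency mulrBr mulr_sumr.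
  rewrite !E [X in _ = _ - (_ - X)]exchange_big /=.
  rewrite [RHS](_ : _ = \sum_(i : cv m) \sum_(j : cv m) w j * volume (cvset j `&` moved (cvset i) (- e) t)
     - \sum_(K : cv m) \sum_(L : cv m) w K * volume (cvset K `&` moved (cvset L) e t)); last by ring.
  rewrite -sumrB; apply: eq_bigr => K _; rewrite -sumrB; apply: eq_bigr => L _.
  by rewrite mulrBl -transfer_sym.
have W0 e' : `|\sum_K w K * deficiency K e' t| <= W * volume (Omega `&` ~` moved Omega e' t).
  apply: (le_trans (ler_norm_sum _ _ _)).
  apply: (@le_trans _ _ (\sum_K W * deficiency K e' t)).
    by apply: ler_sum => L _; rewrite normrM (ger0_norm (deficiency_ge0 _ _ _)) ler_wpM2r// deficiency_ge0.
  by rewrite -mulr_sumr ler_wpM2l ?sum_deficiency.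
by rewrite mulrDr (le_trans (ler_normB _ _))// lerD.
Qed.

(** A one-sided form of the statement that the domain has finite perimeter in the
    direction [e]. *)
Definition translation_loss e c := \forall t \near 0^'+,
  volume (Omega `&` ~` moved Omega e t) <= c * t.

(** First-order terms in [t] of [transfer_sum_le]. *)
Lemma outflow_sum_le (w : cv m -> R) W c e : 0 <= W -> (forall K, `|w K| <= W) ->
  translation_loss e c -> translation_loss (- e) c ->
  `|\sum_K \sum_L (w L - w K) * outflow K L e| <= 2 * W * c.
Proof.
move=> W0 wW h1 h2; apply/ler_addgt0Pr => eps eps0.
pose D := \sum_K \sum_L `|w L - w K|.
have D0 : 0 <= D by apply: sumr_ge0 => K _; exact: sumr_ge0.
have D1 : 0 < D + 1 by rewrite ltr_wpDl.
have d0 : 0 < eps / (D + 1) by rewrite divr_gt0.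
have h3 : \forall t \near 0^'+, forall p : cv m * cv m, p.1 != p.2 ->
    `|volume (cvset p.1 `&` moved (cvset p.2) e t) - t * outflow p.1 p.2 e| <= eps / (D + 1) * t.
  apply: (@filter_forall _ _ (fun (p : cv m * cv m) t => p.1 != p.2 ->
    `|volume (cvset p.1 `&` moved (cvset p.2) e t) - t * outflow p.1 p.2 e| <= eps / (D + 1) * t)) => p.
  case: (eqVneq p.1 p.2) => [e12|KL]; first by near=> t.
  by have := volume_transfer e KL d0; apply: filterS.
move: h1 h2 h3 => /near_at_rightP[d1 d1_gt0 h1] /near_at_rightP[d2 d2_gt0 h2].
move=> /near_at_rightP[d3 d3_gt0 h3].
pose t := Num.min (Num.min d1 d2) d3 / 2.
have min0 : 0 < Num.min (Num.min d1 d2) d3 by rewrite !lt_min d1_gt0 d2_gt0.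
have t0 : 0 < t by rewrite divr_gt0.
have : t < Num.min (Num.min d1 d2) d3 by rewrite /t; lra.
rewrite !lt_min => /andP[/andP[/(h1 t t0) v1 /(h2 t t0) v2] /(h3 t t0) v3].
rewrite -(ler_pM2r t0).
have -> : `|\sum_K \sum_L (w L - w K) * outflow K L e| * t =
    `|\sum_K \sum_L (w L - w K) * (t * outflow K L e)|.
  rewrite -[X in _ * X](gtr0_norm t0) -normrM mulr_suml; congr `|_|.
  by apply: eq_bigr => K _; rewrite mulr_suml; apply: eq_bigr => L _; ring.
have -> : \sum_K \sum_L (w L - w K) * (t * outflow K L e) =
   \sum_K \sum_L (w L - w K) * volume (cvset K `&` moved (cvset L) e t) -
   \sum_K \sum_L (w L - w K) * (volume (cvset K `&` moved (cvset L) e t) - t * outflow K L e).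
  rewrite -sumrB; apply: eq_bigr => K _; rewrite -sumrB; apply: eq_bigr => L _; ring.
apply: (le_trans (ler_normB _ _)); rewrite mulrDl lerD//.
  apply: (le_trans (transfer_sum_le _ _ W0 wW)).
  rewrite (_ : 2 * W * c * t = W * (c * t + c * t)); last by ring.
  by rewrite ler_wpM2l// lerD.
apply: (@le_trans _ _ (D * (eps / (D + 1) * t))).
  rewrite mulr_suml (le_trans (ler_norm_sum _ _ _))//; apply: ler_sum => K _.
  rewrite mulr_suml (le_trans (ler_norm_sum _ _ _))//; apply: ler_sum => L _.
  rewrite normrM; have [->|KL] := eqVneq K L; first by rewrite subrr normr0 !mul0r.
  by rewrite ler_wpM2l//; exact: (v3 (K, L)).
rewrite (_ : D * _ = D / (D + 1) * (eps * t)); last by ring.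
rewrite ler_piMl//; first by rewrite mulr_ge0 ?ltW.
by rewrite ler_pdivrMr// mul1r lerDl.
Unshelve. all: by end_near. Qed.

(** A component of the normal is the difference of its positive parts along [e] and
    along [- e]. *)
Lemma normal_flux_sum_le (w : cv m -> R) W c (i : 'I_l) : 0 <= W -> (forall K, `|w K| <= W) ->
  translation_loss (delta_mx ord0 i) c -> translation_loss (- delta_mx ord0 i) c ->
  `|\sum_K \sum_L \sum_(s in interface K L)
      edge_measure K s * normal K s ord0 i * (w K - w L)| <= 4 * W * c.
Proof.
move=> W0 wW h1 h2; set e := delta_mx _ _ in h1 h2.
have ne (n : 'rV[R]_l) : dotv n e = n ord0 i.
  rewrite /dotv (bigD1 i)//= /e mxE !eqxx mulr1 big1 ?addr0// => j ji.
  by rewrite mxE (negPf ji) andbF mulr0.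
have -> : \sum_K \sum_L \sum_(s in interface K L)
      edge_measure K s * normal K s ord0 i * (w K - w L) =
   \sum_K \sum_L (w L - w K) * outflow K L (- e) - \sum_K \sum_L (w L - w K) * outflow K L e.
  rewrite -sumrB; apply: eq_bigr => K _; rewrite -sumrB; apply: eq_bigr => L _.
  rewrite -mulrBr -sumrB mulr_sumr; apply: eq_bigr => s _.
  rewrite dotvNr ne; set a := normal _ _ _ _.
  have [a0|a0] := leP 0 a; last by rewrite max_r ?oppr_ge0 ?ltW//; ring.
  by rewrite max_l ?oppr_le0//; ring.
apply: (le_trans (ler_normB _ _)).
rewrite (_ : 4 * W * c = 2 * W * c + 2 * W * c); last by ring.
by rewrite lerD// outflow_sum_le// opprK.
Qed.

End transfer.

(** * Loss of volume of a Lipschitz domain under a translation *)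

Section lipschitz_domains.
Context {R : realType} {l : nat}.
Implicit Types (x y z v e : 'rV[R]_l) (t r : R).

Lemma normr_coord_le x i : `|x ord0 i| <= `|x|.
Proof. exact: (rV_norm_le x (normr_ge0 x)).2. Qed.

Lemma enorm_le_norm x : enorm x <= l.+1%:R * `|x|.
Proof.
rewrite -[leRHS]ger0_norm ?mulr_ge0// -sqrtr_sqr ler_wsqrtr//.
apply: (@le_trans _ _ (\sum_(i < l) `|x| ^+ 2)).
  apply: ler_sum => i _; rewrite -expr2 -[_ ^+ 2]ger0_norm ?sqr_ge0// normrX.
  by rewrite lerXn2r ?nnegrE// normr_coord_le.
rewrite sumr_const card_ord -[leLHS]mulr_natl exprMn ler_wpM2r ?sqr_ge0//.
by rewrite expr2 -natrM ler_nat (leq_trans (leqnSn l))// leq_pmulr.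
Qed.

Lemma dotv_unit_le x e : enorm e = 1 -> `|dotv x e| <= l.+1%:R * `|x|.
Proof.
move=> e1; have ee := enorm1_dotv e1.
have ei i : `|e ord0 i| <= 1.
  rewrite -(@expr_le1 _ 2)// -normrX ger0_norm ?sqr_ge0// -ee /dotv (bigD1 i)//= -expr2 lerDl.
  by apply: sumr_ge0 => j _; rewrite -expr2 sqr_ge0.
apply: (le_trans (ler_norm_sum _ _ _)).
apply: (@le_trans _ _ (\sum_(i < l) `|x|)).
  apply: ler_sum => i _; rewrite normrM -[leRHS]mulr1.
  by apply: ler_pM => //; exact: normr_coord_le.
by rewrite sumr_const card_ord -[leLHS]mulr_natl ler_wpM2r// ler_nat.
Qed.

(** The signed vertical distance to the graph describes the domain near a boundary
    point; it is Lipschitz and decreases at unit speed in the vertical direction. *)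
Lemma lipschitz_chart (Omega : set 'rV[R]_l) x0 : lipschitz_boundary Omega ->
  boundary Omega x0 -> exists (rho kappa : R) e (G : 'rV[R]_l -> R),
  [/\ 0 < rho, 0 < kappa, (forall y z, `|G y - G z| <= kappa * `|y - z|),
      (forall y s, G (y + s *: e) = G y - s) &
      forall y, `|y - x0| < rho -> (Omega y <-> 0 < G y)].
Proof.
move=> lip /lip[r [k [e [g [r0 e1 gk gO]]]]].
have ee := enorm1_dotv e1.
have c0 : 0 < l.+1%:R :> R by [].
pose c : R := l.+1%:R.
exists (r / c), (`|k| * (c * (1 + c * `|e|)) + c), e, (fun y => g (y - dotv y e *: e) - dotv y e).
split.
- by rewrite divr_gt0.
- rewrite ltr_wpDl// !mulr_ge0 ?addr_ge0 ?mulr_ge0// ltW//.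
- move=> y z.
  rewrite (_ : _ - _ = (g (y - dotv y e *: e) - g (z - dotv z e *: e)) - dotv (y - z) e); last first.
    by rewrite dotvBl; ring.
  rewrite (le_trans (ler_normB _ _))// mulrDl lerD//; last exact: dotv_unit_le.
  rewrite (le_trans (gk _ _))//.
  have -> : y - dotv y e *: e - (z - dotv z e *: e) = (y - z) - dotv (y - z) e *: e.
    by rewrite dotvBl scalerBl; apply/rowP => i; rewrite !mxE; ring.
  set w := _ - _ *: e.
  have hw : enorm w <= c * (1 + c * `|e|) * `|y - z|.
    rewrite (le_trans (enorm_le_norm _))// -mulrA ler_wpM2l ?(ltW c0)//.
    rewrite (le_trans (ler_normB _ _))// mulrDl mul1r lerD// normrZ mulrAC ler_wpM2r//.
    exact: dotv_unit_le.
  have w0 : 0 <= enorm w by exact: sqrtr_ge0.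
  rewrite -mulrA (le_trans (_ : _ <= `|k| * enorm w)) ?ler_wpM2r ?ler_norm//.
  by rewrite ler_wpM2l.
- move=> y s; rewrite dotvDl dotvZl ee mulr1.
  rewrite (_ : y + s *: e - (dotv y e + s) *: e = y - dotv y e *: e); first by ring.
  by rewrite scalerDl opprD addrACA subrr addr0.
- move=> y yx; rewrite subr_gt0; apply: gO.
  by rewrite (le_lt_trans (enorm_le_norm _))// mulrC -ltr_pdivlMr.
Qed.

(** A point of the domain that leaves it in time [t] lies in a strip of height
    [kappa * t] below the graph. About [1 / (kappa * t)] vertical translates of the
    strip are disjoint in a bounded set, so the strip has volume [O(t)]. *)
Lemma lipschitz_strip (Omega : set 'rV[R]_l) x0 : lipschitz_boundary Omega ->
  boundary Omega x0 -> exists rho c : R, [/\ 0 < rho, 0 <= c &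
  \forall t \near 0^'+, exists A : set 'rV[R]_l, [/\ measurable A, bounded_set A,
    volume A <= c * t & forall x v, `|v| <= 1 -> `|x - x0| < rho ->
      `|x + t *: v - x0| < rho -> Omega x -> ~ Omega (x + t *: v) -> A x]].
Proof.
move=> lip /(lipschitz_chart lip)[rho [k [e [G [rho0 k0 GL Ge GO]]]]].
pose V := volume (ball x0 (rho + `|e| + 1)).
exists rho, (2 * k * V); split => //.
  by rewrite mulr_ge0 ?volume_ge0// mulr_ge0// ltW.
have Gc : continuous G.
  move=> y; apply: (@cvgrPdist_lt _ R^o _ (nbhs y) _ G (G y)).2 => eps eps0; apply/nbhs_ballP.
  exists (eps / k); first by rewrite /= divr_gt0.
  move=> z; rewrite -ball_normE /= => h; apply: (le_lt_trans (GL _ _)).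
  by rewrite mulrC -ltr_pdivlMr.
apply/near_at_rightP; exists k^-1; first by rewrite invr_gt0.
move=> t t0 tk.
have kt0 : 0 < k * t by rewrite mulr_gt0.
have kt1 : k * t < 1 by rewrite mulrC -ltr_pdivlMr// mul1r.
exists (ball x0 rho `&` (G @^-1` [set s | 0 < s] `&` G @^-1` [set s | s <= k * t])).
set A := ball x0 rho `&` _.
have mA : measurable A.
  apply: measurableI; first exact: measurable_ball_rV.
  apply: measurableI.
    by apply: open_measurable_rV; apply: open_comp => //; exact: open_gt.
  by apply: closed_measurable_rV; apply: closed_comp => //; exact: closed_le.
have bB r : bounded_set (ball x0 r).
  apply/bounded_setP; exists (`|x0| + r) => x; rewrite -ball_normE /= => h.
  rewrite -(subrK x0 x) addrC (le_trans (ler_normD _ _))// lerD2l distrC ltW//.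
have bA : bounded_set A by apply: bounded_subset (bB rho) => x [].
split => //; last first.
  move=> x v v1 xr xtr Ox nO; split; first by rewrite -ball_normE /= distrC.
  split => /=; first exact/(GO _ xr).
  have : G (x + t *: v) <= 0 by rewrite leNgt; apply/negP => /(GO _ xtr).
  have := GL x (x + t *: v); rewrite opprD addrA subrr sub0r normrN normrZ (gtr0_norm t0).
  have : k * (t * `|v|) <= k * t by rewrite ler_pM2l// ler_piMr// ltW.
  by move=> h1 /(le_trans (ler_norm _)) h2 h3; lra.
(* the number of disjoint strips that fit in a height of at most 1 *)
pose q := Num.trunc ((k * t)^-1).
have kt'0 : 0 <= (k * t)^-1 by rewrite invr_ge0 ltW.
have /andP[q1 q2] := truncn_itv kt'0; rewrite -/q in q1 q2.
have q0 : (0 < q)%N.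
  rewrite lt0n; apply/eqP => qz; rewrite qz in q2.
  have : 1 <= (k * t)^-1 by rewrite invf_ge1// ltW.
  by rewrite leNgt q2.
have pack : q%:R * volume A <= V.
  apply: (@volume_packing _ _ _ _ ((k * t) *: e)) => //.
  - exact: measurable_ball_rV.
  - move=> i j x _ _ [_ [/= h1 h2]] [_ [/= h3 h4]].
    rewrite scalerA !Ge in h1 h2; rewrite scalerA !Ge in h3 h4.
    have d1 : (i%:R - j%:R) * (k * t) < 1 * (k * t) by lra.
    have d2 : (j%:R - i%:R) * (k * t) < 1 * (k * t) by lra.
    rewrite ltr_pM2r// in d1; rewrite ltr_pM2r// in d2.
    have : (i < j.+1)%N by rewrite -(ltr_nat R) -natr1; lra.
    have : (j < i.+1)%N by rewrite -(ltr_nat R) -natr1; lra.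
    by rewrite !ltnS => a b; apply/eqP; rewrite eqn_leq a b.
  - move=> i x iq [h _]; move: h; rewrite -!ball_normE /= scalerA => h.
    rewrite (_ : x0 - x = (x0 - (x + (i%:R * (k * t)) *: e)) + (i%:R * (k * t)) *: e); last first.
      by rewrite opprD addrA subrK.
    have i1 : i%:R * (k * t) <= 1.
      by rewrite -ler_pdivlMr// mul1r (le_trans _ q1)// ler_nat ltnW.
    have i2 : `|(i%:R * (k * t)) *: e| <= `|e|.
      by rewrite normrZ ler_piMl// ger0_norm// mulr_ge0// ltW.
    apply: (le_lt_trans (ler_normD _ _)); lra.
have : (k * t)^-1 * volume A <= 2 * V.
  apply: (@le_trans _ _ (2 * (q%:R * volume A))); last by rewrite ler_wpM2l.
  rewrite mulrA ler_wpM2r ?volume_ge0// (le_trans (ltW q2))// -natr1.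
  by have : (1 : R) <= q%:R by [rewrite ler1n]; lra.
by rewrite mulrC ler_pdivrMr//; lra.
Qed.

End lipschitz_domains.

Section translation_loss.
Context {R : realType} {l : nat}.

Lemma compact_boundary (A : set 'rV[R]_l) : bounded_set A -> compact (boundary A).
Proof.
move=> bA; apply: bounded_closed_compact.
  by apply: bounded_subset (bounded_closure bA) => x [].
rewrite /boundary setDE; apply: closedI; first exact: closed_closure.
by apply: open_closedC; exact: open_interior.
Qed.

(** A segment that leaves the domain meets the boundary, which is compact and thus
    covered by finitely many charts. *)
Lemma lipschitz_translation_loss (Omega : set 'rV[R]_l) :
  open Omega -> bounded_set Omega -> lipschitz_boundary Omega ->
  exists2 c : R, 0 <= c & forall e : 'rV[R]_l, `|e| <= 1 -> translation_loss Omega e c.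
Proof.
move=> oO bO lip.
have /choice[h hP] (x0 : 'rV[R]_l) : exists p : R * R, boundary Omega x0 -> [/\ 0 < p.1, 0 <= p.2 &
  \forall t \near 0^'+, exists A : set 'rV[R]_l, [/\ measurable A, bounded_set A,
    volume A <= p.2 * t & forall x v, `|v| <= 1 -> `|x - x0| < p.1 ->
      `|x + t *: v - x0| < p.1 -> Omega x -> ~ Omega (x + t *: v) -> A x]].
  have [bx|nb] := pselect (boundary Omega x0); last by exists (0, 0).
  by have [r [c ?]] := lipschitz_strip lip bx; exists (r, c).
have := compact_boundary bO; rewrite compact_cover.
move=> /(_ _ (boundary Omega) (fun x => ball x ((h x).1 / 2))).
move=> [x _|x bx|D DO cov]; first exact: ball_open.
  by exists x => //; apply: ballxx; rewrite divr_gt0//; have [] := hP x bx.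
pose s : seq 'rV[R]_l := finmap.enum_fset D.
pose pt (j : 'I_(size s)) := tnth (in_tuple s) j.
have hD j : boundary Omega (pt j).
  by have := DO (pt j) (mem_tnth j (in_tuple s)); rewrite inE.
exists (\sum_(j : 'I_(size s)) (h (pt j)).2).
  by apply: sumr_ge0 => j _; have [] := hP _ (hD j).
move=> e e1.
have : \forall t \near 0^'+, forall j : 'I_(size s), t < (h (pt j)).1 / 2 /\
   exists A : set 'rV[R]_l, [/\ measurable A, bounded_set A,
    volume A <= (h (pt j)).2 * t & forall x v, `|v| <= 1 -> `|x - pt j| < (h (pt j)).1 ->
      `|x + t *: v - pt j| < (h (pt j)).1 -> Omega x -> ~ Omega (x + t *: v) -> A x].
  apply: (@filter_forall _ _ (fun (j : 'I_(size s)) t => t < (h (pt j)).1 / 2 /\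
   exists A : set 'rV[R]_l, [/\ measurable A, bounded_set A,
    volume A <= (h (pt j)).2 * t & forall x v, `|v| <= 1 -> `|x - pt j| < (h (pt j)).1 ->
      `|x + t *: v - pt j| < (h (pt j)).1 -> Omega x -> ~ Omega (x + t *: v) -> A x])) => j.
  have [r0 _ /near_at_rightP[d d0 hd]] := hP _ (hD j).
  apply/near_at_rightP; exists (Num.min d ((h (pt j)).1 / 2)).
    by rewrite lt_min d0 divr_gt0.
  by move=> t t0; rewrite lt_min => /andP[td tr]; split => //; exact: hd.
move=> /near_at_rightP[d d0 hd]; apply/near_at_rightP; exists d => // t t0 td.
have /choice[A hA] := fun j => (hd t t0 td j).2.
rewrite mulr_suml.
have mO : measurable Omega by exact: open_measurable_rV.
apply: (@le_trans _ _ (\sum_(j : 'I_(size s)) volume (A j))); last first.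
  by apply: ler_sum => j _; have [] := hA j.
apply: volume_le_sum.
- apply: measurableI => //; apply: measurableC; exact: measurable_shift.
- by apply: bounded_subset bO => x [].
- by move=> j _; have [] := hA j.
- by move=> j _; have [] := hA j.
move=> x [Ox nO].
have [a [a01 ba]] : exists a, a \in `[0, 1] /\ boundary Omega (x + a *: (t *: e)).
  apply: contrapT => nb; apply: nO; apply: segment_in_open => // a a01 ba.
  by apply: nb; exists a.
have [j0 /= jD] := cov _ ba.
rewrite -ball_normE /= => xj.
have /(tnthP (in_tuple s))[j ej] : j0 \in s by [].
rewrite -/(pt j) in ej; rewrite ej in xj.
have [_ _ _ hj] := hA j; have [tj _] := hd t t0 td j.
move: a01; rewrite in_itv /= => /andP[a0 a1].
have te : `|t *: e| <= t by rewrite normrZ gtr0_norm// ler_piMr// ltW.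
exists j => //; apply: (hj x e) => //=.
  rewrite (_ : x - pt j = - (pt j - (x + a *: (t *: e))) - a *: (t *: e)); last first.
    by apply/rowP => i; rewrite !mxE; ring.
  rewrite (le_lt_trans (ler_normB _ _))// normrN (splitr (h (pt j)).1) ltrD// (le_lt_trans _ tj)//.
  by rewrite normrZ ger0_norm// (le_trans _ te)// ler_piMl.
rewrite (_ : x + t *: e - pt j = - (pt j - (x + a *: (t *: e))) + (1 - a) *: (t *: e)); last first.
  by rewrite scalerBl scale1r; apply/rowP => i; rewrite !mxE; ring.
rewrite (le_lt_trans (ler_normD _ _))// normrN (splitr (h (pt j)).1) ltrD// (le_lt_trans _ tj)//.
by rewrite normrZ ger0_norm ?subr_ge0// (le_trans _ te)// ler_piMl// gerBl.
Qed.

Lemma norm_delta_mx (i : 'I_l) : `|delta_mx ord0 i : 'rV[R]_l| <= 1.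
Proof.
apply/rV_norm_le => // j; rewrite mxE eqxx /=.
by case: eqP => _; rewrite ?normr1 ?normr0.
Qed.

(** The divergence theorem in the cells, combined with the finite perimeter of the
    domain: the constant depends on the domain only, not on the mesh. *)
Lemma lipschitz_normal_flux_sum_le (Omega : set 'rV[R]_l) :
  open Omega -> bounded_set Omega -> lipschitz_boundary Omega ->
  exists2 c : R, 0 <= c & forall (m : mesh R l) (w : cv m -> R) W (i : 'I_l),
    admissible_mesh Omega m -> 0 <= W -> (forall K, `|w K| <= W) ->
    `|\sum_K \sum_L \sum_(s in interface K L)
      edge_measure K s * normal K s ord0 i * (w K - w L)| <= 4 * W * c.
Proof.
move=> oO bO lip; have [c c0 hc] := lipschitz_translation_loss oO bO lip.
exists c => // m w W i adm W0 wW; apply: (normal_flux_sum_le adm) => //.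
  by apply: hc; exact: norm_delta_mx.
by apply: hc; rewrite normrN; exact: norm_delta_mx.
Qed.

End translation_loss.

(** * Dissipation of a monotone flux *)

Section primitives.
Context {R : realType} {l : nat}.
Variables (umax : R) (f : R -> 'rV[R]_l).
Hypotheses (umax0 : 0 < umax) (fc : {within `[0, umax], continuous f}).

Definition is_primitive (G g : R -> R) :=
  {within `[0, umax], continuous G} /\
  forall x, x \in `]0, umax[ -> is_derive x 1 G (g x).

Lemma primitive_mean_value G g x y : is_primitive G g ->
  0 <= x -> x <= y -> y <= umax ->
  exists2 s, s \in `[x, y] & G y - G x = g s * (y - x).
Proof.
move=> [Gc Gd] x0 xy yu.
have d z : z \in `]x, y[ -> is_derive z 1 G (g z).
  move=> /[!in_itv] /andP[xz zy].
  apply: Gd.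
  rewrite in_itv /=.
  by apply/andP; split; [exact: le_lt_trans xz|exact: lt_le_trans yu].
have c : {within `[x, y], continuous G}.
  apply: continuous_subspaceW Gc => z.
  rewrite /= !in_itv /= => /andP[xz zy].
  by apply/andP; split; [exact: le_trans xz|exact: le_trans yu].
have := @MVT_segment R G g x y xy d c.
done.
Qed.

Lemma coord_within_continuous (i : 'I_l) :
  {within `[0, umax], continuous (fun s => f s ord0 i)}.
Proof.
move=> s; apply: (@continuous_comp (subspace `[0, umax]%classic) _ _ f (fun v : 'rV[R]_l => v ord0 i) s).
  exact: fc.
exact: coord_continuous.
Qed.

(** One vector-valued primitive serves all edges, since the fluxes depend linearly on
    the normal. *)
Lemma exists_primitive : exists Psi : R -> 'rV[R]_l, Psi 0 = 0 /\
  forall n : 'rV[R]_l, is_primitive (fun s => dotv n (Psi s)) (fun s => dotv n (f s)).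
Proof.
pose P (i : 'I_l) x := parameterized_integral lebesgue_measure 0 x (fun s => f s ord0 i).
have Pp i : is_primitive (P i) (fun s => f s ord0 i).
  have fi := @coord_within_continuous i.
  have int : (@lebesgue_measure R).-integrable `[0, umax] (EFin \o (fun s => f s ord0 i)).
    by apply: continuous_compact_integrable => //; exact: segment_compact.
  split; first by apply: parameterized_integral_continuous => //; exact: ltW.
  move=> x; rewrite in_itv /= => /andP[x0 xu].
  have fx : {for x, continuous (fun s => f s ord0 i)}.
    by apply: (within_continuous_continuous umax0 fi); rewrite in_itv /= x0.
  have [dP eP] := continuous_FTC1_closed xu int x0 fx.
  by apply: DeriveDef => //; rewrite -derive1E.
exists (fun x => \row_i P i x); split.
  by apply/rowP => i; rewrite !mxE /P /parameterized_integral set_itv1 Rintegral_set1.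
move=> n.
have key (s : seq 'I_l) : is_primitive (fun x => \sum_(i <- s) n ord0 i * P i x)
    (fun x => \sum_(i <- s) n ord0 i * f x ord0 i).
  elim: s => [|i s [IHc IHd]].
    rewrite (_ : (fun x => \sum_(i <- [::]) n ord0 i * P i x) = cst 0); last first.
      by apply/funext => x; rewrite big_nil.
    split; first exact: cst_continuous.
    by move=> x _; rewrite big_nil; exact: is_derive_cst.
  have [Pc Pd] := Pp i.
  rewrite (_ : (fun x => \sum_(j <- i :: s) n ord0 j * P j x) =
    (n ord0 i *: P i) + (fun x => \sum_(j <- s) n ord0 j * P j x)); last first.
    by apply/funext => x; rewrite big_cons.
  split.
    move=> x; apply: (@cvgD _ R^o); last exact: IHc.
    by apply: cvgZl_tmp; apply: Pc.
  move=> x xI; rewrite big_cons; apply: is_deriveD; last exact: IHd.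
  by apply: is_deriveZ; exact: Pd.
have := key (index_enum 'I_l).
rewrite (_ : (fun x => \sum_i n ord0 i * P i x) = (fun s => dotv n (\row_i P i s)))//.
by apply/funext => x; apply: eq_bigr => i _; rewrite mxE.
Qed.

Lemma normr_coord_le_enorm (x : 'rV[R]_l) i : `|x ord0 i| <= enorm x.
Proof.
rewrite -sqrtr_sqr ler_wsqrtr// /dotv (bigD1 i)//= -expr2 lerDl.
by apply: sumr_ge0 => j _; rewrite -expr2 sqr_ge0.
Qed.

Lemma enorm_le_sup_norm s : s \in `[0, umax] -> enorm (f s) <= sup_norm umax f.
Proof.
move=> sI; apply: ub_le_sup; last by exists s.
have fn : {within `[0, umax], continuous (fun s => `|f s|)}.
  move=> x; apply: (@continuous_comp (subspace `[0, umax]%classic) _ _ f (fun v : 'rV[R]_l => `|v|) x).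
    exact: fc.
  exact: norm_continuous.
have [c cI hc] := EVT_max (ltW umax0) fn.
exists (l.+1%:R * `|f c|) => _ [t tI <-].
by rewrite (le_trans (enorm_le_norm _))// ler_wpM2l// hc.
Qed.

Lemma primitive_bound Psi s i : Psi 0 = 0 ->
  (forall n : 'rV[R]_l, is_primitive (fun s => dotv n (Psi s)) (fun s => dotv n (f s))) ->
  s \in `[0, umax] -> `|Psi s ord0 i| <= sup_norm umax f * umax.
Proof.
move=> P0 PP; rewrite in_itv /= => /andP[s0 su].
have de (v : 'rV[R]_l) : dotv (delta_mx ord0 i) v = v ord0 i.
  rewrite /dotv (bigD1 i)//= mxE !eqxx mul1r big1 ?addr0// => j ji.
  by rewrite mxE (negPf ji) andbF mul0r.
have [c cI] := primitive_mean_value (PP (delta_mx ord0 i)) (lexx 0) s0 su.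
rewrite !de P0 mxE !subr0 => ->; rewrite normrM (ger0_norm s0).
have cI' : c \in `[0, umax].
  by move: cI; rewrite !in_itv /= => /andP[-> /le_trans ->].
apply: ler_pM => //; rewrite (le_trans (normr_coord_le_enorm _ _))//.
exact: enorm_le_sup_norm.
Qed.

End primitives.

Section two_point_flux.
Context {R : realType}.
Variables (umax Lam : R) (F : R -> R -> R) (G g : R -> R).
Local Notation I := `[0, umax].
Hypotheses
  (F_incr : {in I & &, forall a a' b, a <= a' -> F a b <= F a' b})
  (F_decr : {in I & &, forall a b b', b <= b' -> F a b' <= F a b})
  (F_lip : forall a b a' b', a \in I -> b \in I -> a' \in I -> b' \in I ->
      `|F a b - F a' b'| <= Lam * (`|a - a'| + `|b - b'|))
  (F_diag : {in I, forall a, F a a = g a})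
  (Gg : is_primitive umax G g).

(** The integral of [F b a - g s] for [s] between [a] and [b], expressed through the
    primitive [G] of [g]. *)
Definition dissipation a b := F b a * (b - a) - (G b - G a).

Lemma dissipation_ge (a b c d X : R) : 0 <= a -> a <= c -> c <= d -> d <= b -> b <= umax ->
  (forall s, s \in `[a, b] -> g s <= F b a) -> (forall s, s \in `[c, d] -> g s <= F b a - X) ->
  X * (d - c) <= dissipation a b.
Proof.
move=> a0 ac cd db bu h1 h2.
have [c0 d0] : 0 <= c /\ 0 <= d by lra.
have [cu du] : c <= umax /\ d <= umax by lra.
have [s1 i1 e1] := primitive_mean_value Gg a0 ac cu.
have [s2 i2 e2] := primitive_mean_value Gg c0 cd du.
have [s3 i3 e3] := primitive_mean_value Gg d0 db bu.
have u1 : g s1 * (c - a) <= F b a * (c - a).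
  rewrite ler_wpM2r ?subr_ge0// h1//; move: i1; rewrite !in_itv /= => /andP[? ?]; apply/andP; split; lra.
have u2 : g s2 * (d - c) <= (F b a - X) * (d - c).
  by rewrite ler_wpM2r ?subr_ge0// h2.
have u3 : g s3 * (b - d) <= F b a * (b - d).
  rewrite ler_wpM2r ?subr_ge0// h1//; move: i3; rewrite !in_itv /= => /andP[? ?]; apply/andP; split; lra.
by rewrite /dissipation; lra.
Qed.

Lemma F_between a b c d : 0 <= a -> a <= c -> c <= b -> a <= d -> d <= b -> b <= umax ->
  F d c <= F b a.
Proof.
move=> a0 ac cb ad db bu.
have J z : a <= z -> z <= b -> z \in I by move=> ? ?; rewrite in_itv /=; apply/andP; split; lra.
apply: (@le_trans _ _ (F b c)); first by apply: F_incr; rewrite ?J//; lra.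
by apply: F_decr; rewrite ?J//; lra.
Qed.

Lemma dissipation_ge0 a b : 0 <= a -> a <= b -> b <= umax -> 0 <= dissipation a b.
Proof.
move=> a0 ab bu.
have h s : s \in `[a, b] -> g s <= F b a.
  rewrite in_itv /= => /andP[? ?]; rewrite -F_diag; first by apply: F_between; lra.
  by rewrite in_itv /=; apply/andP; split; lra.
have := @dissipation_ge a b a b 0 a0 (lexx a) ab (lexx b) bu h.
by rewrite mul0r; apply => s; rewrite subr0; exact: h.
Qed.

(** The gap shrinks at most at the rate [Lam] when one argument moves towards the
    other, so it stays above [X / 2] on a length [X / (2 * Lam)], where it bounds the
    integrand of the dissipation from below. *)
Lemma dissipation_sqr_le (a b c d X : R) : 0 <= Lam -> 0 <= a -> a <= c -> c <= d ->
  d <= b -> b <= umax -> 0 <= X ->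
  X = F d c - F d d \/ X = F d c - F c c -> X ^+ 2 <= 4 * Lam * dissipation a b.
Proof.
move=> L0 a0 ac cd db bu X0 XE.
have ab : a <= b by lra.
have h s : s \in `[a, b] -> g s <= F b a.
  rewrite in_itv /= => /andP[? ?]; rewrite -F_diag; first by apply: F_between; lra.
  by rewrite in_itv /=; apply/andP; split; lra.
have J z : a <= z -> z <= b -> z \in I by move=> ? ?; rewrite in_itv /=; apply/andP; split; lra.
have I0 := dissipation_ge0 a0 ab bu.
have dcF : F d c <= F b a by apply: F_between; lra.
have XL : X <= Lam * (d - c).
  case: XE => ->; apply: (le_trans (ler_norm _)).
    apply: (le_trans (F_lip _ _ _ _)); rewrite ?J//; try lra.
    by rewrite subrr normr0 add0r distrC ger0_norm// subr_ge0.
  apply: (le_trans (F_lip _ _ _ _)); rewrite ?J//; try lra.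
  by rewrite subrr normr0 addr0 ger0_norm// subr_ge0.
move: L0; rewrite le_eqVlt => /predU1P[L0|L0].
  have -> : X = 0 by move: XL; rewrite -L0 mul0r; lra.
  by rewrite expr0n/= -L0; lra.
(* a gap that decreases at the rate Lam from X needs this length to reach X / 2 *)
pose r := X / (2 * Lam).
have r0 : 0 <= r by rewrite divr_ge0// mulr_ge0// ltW.
have rL : Lam * r = X / 2 by rewrite /r; field; rewrite gt_eqF.
have rd : r <= d - c by rewrite -(ler_pM2l L0) rL; lra.
suff : X / 2 * r <= dissipation a b.
  move=> h2; have -> : X ^+ 2 = 4 * Lam * (X / 2 * r) by rewrite /r; field; rewrite gt_eqF.
  by rewrite ler_pM2l// mulr_gt0.
case: XE => XE.
  have -> : r = d - (d - r) by ring.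
  apply: dissipation_ge => //; try lra.
  move=> s; rewrite in_itv /= => /andP[s1 s2].
  have e1 : g s <= F d s.
    by rewrite -F_diag ?J//; try lra; apply: F_incr; rewrite ?J//; lra.
  have : F d s - F d d <= Lam * (d - s).
    apply: (le_trans (ler_norm _)); apply: (le_trans (F_lip _ _ _ _)); rewrite ?J//; try lra.
    by rewrite subrr normr0 add0r distrC ger0_norm// subr_ge0.
  have : Lam * (d - s) <= Lam * r by rewrite ler_pM2l//; lra.
  by rewrite rL; lra.
have -> : r = (c + r) - c by ring.
apply: dissipation_ge => //; try lra.
move=> s; rewrite in_itv /= => /andP[s1 s2].
have e1 : g s <= F s c.
  by rewrite -F_diag ?J//; try lra; apply: F_decr; rewrite ?J//; lra.
have : F s c - F c c <= Lam * (s - c).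
  apply: (le_trans (ler_norm _)); apply: (le_trans (F_lip _ _ _ _)); rewrite ?J//; try lra.
  by rewrite subrr normr0 addr0 ger0_norm// subr_ge0.
have : Lam * (s - c) <= Lam * r by rewrite ler_pM2l//; lra.
by rewrite rL; lra.
Qed.

(** Inequality between the arithmetic and geometric means, with a free weight [lam]. *)
Lemma max_between_le (a b lam : R) (H : R -> R -> R) : 0 <= Lam -> 0 < lam ->
  0 <= a -> a <= b -> b <= umax ->
  (forall c d, H c d = F d c - F d d) \/ (forall c d, H c d = F d c - F c c) ->
  max_between a b H <= lam * Lam + dissipation a b / lam.
Proof.
move=> L0 lam0 a0 ab bu HE.
have I0 := dissipation_ge0 a0 ab bu.
apply: ge_sup.
  by exists (H a b), a, b.
move=> _ [c [d [ac cd db ->]]].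
have S0 : 0 <= lam * Lam + dissipation a b / lam.
  by apply: addr_ge0; [rewrite mulr_ge0 // ltW|rewrite divr_ge0 // ltW].
have [X0|X0] := leP 0 (H c d); last by apply: le_trans S0; exact: ltW.
rewrite -(@ler_pXn2r _ 2)// ?nnegrE//.
have : H c d ^+ 2 <= 4 * Lam * dissipation a b.
  apply: (dissipation_sqr_le L0 a0 ac cd db bu X0).
  by case: HE => ->; [left|right].
move=> /le_trans; apply.
have := sqr_ge0 (lam * Lam - dissipation a b / lam).
have : lam * Lam * (dissipation a b / lam) = Lam * dissipation a b by field; rewrite gt_eqF.
by rewrite sqrrB sqrrD; lra.
Qed.

End two_point_flux.

(** * Sums over interfaces *)

Section interface_sums.
Context {R : realType} {l : nat}.
Variable m : mesh R l.
Implicit Types (K L : cv m) (s : edge m) (v : cv m -> R) (A T : cv m -> cv m -> edge m -> R).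

(** Ordered pairs: every interface is counted twice. *)
Definition pair_sum T : R := \sum_K \sum_L \sum_(s in interface K L) T K L s.

Lemma interfaceC K L : interface K L = interface L K.
Proof. by rewrite /interface eq_sym finset.setIC. Qed.

Lemma eq_pair_sum T T' : (forall K L s, s \in interface K L -> T K L s = T' K L s) ->
  pair_sum T = pair_sum T'.
Proof.
move=> h; apply: eq_bigr => K _; apply: eq_bigr => L _; apply: eq_bigr => s.
exact: h.
Qed.

Lemma pair_sumB T T' : pair_sum (fun K L s => T K L s - T' K L s) =
  pair_sum T - pair_sum T'.
Proof.
rewrite /pair_sum -sumrB; apply: eq_bigr => K _.
by rewrite -sumrB; apply: eq_bigr => L _; rewrite -sumrB.
Qed.

Lemma pair_sumZ (a : R) T : pair_sum (fun K L s => a * T K L s) = a * pair_sum T.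
Proof.
rewrite /pair_sum mulr_sumr; apply: eq_bigr => K _.
by rewrite mulr_sumr; apply: eq_bigr => L _; rewrite mulr_sumr.
Qed.

Lemma pair_sum_swap T : pair_sum T = pair_sum (fun K L s => T L K s).
Proof.
rewrite /pair_sum exchange_big; apply: eq_bigr => K _; apply: eq_bigr => L _.
by rewrite interfaceC.
Qed.

Lemma interface_sum_le v T T' :
  (forall K L s, v L < v K -> s \in interface K L -> T K L s <= T' K L s) ->
  interface_sum v T <= interface_sum v T'.
Proof.
move=> h; apply: ler_sum => K _; apply: ler_sum => L vv; apply: ler_sum => s.
exact: h.
Qed.

Lemma interface_sumD v T T' : interface_sum v (fun K L s => T K L s + T' K L s) =
  interface_sum v T + interface_sum v T'.
Proof.
rewrite /interface_sum -big_split; apply: eq_bigr => K _ /=.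
by rewrite -big_split; apply: eq_bigr => L _ /=; rewrite -big_split.
Qed.

Lemma interface_sumZ v a T : interface_sum v (fun K L s => a * T K L s) =
  a * interface_sum v T.
Proof.
rewrite /interface_sum mulr_sumr; apply: eq_bigr => K _ /=.
by rewrite mulr_sumr; apply: eq_bigr => L _ /=; rewrite mulr_sumr.
Qed.

Lemma pair_sum_symmetric v T :
  (forall K L s, s \in interface K L -> T K L s = T L K s) ->
  (forall K L s, s \in interface K L -> v K = v L -> T K L s = 0) ->
  pair_sum T = interface_sum v T *+ 2.
Proof.
move=> Tsym T0.
have -> : pair_sum T = \sum_K \sum_L
    ((if v L < v K then \sum_(s in interface K L) T K L s else 0) +
     (if v K < v L then \sum_(s in interface K L) T K L s else 0)).
  apply: eq_bigr => K _; apply: eq_bigr => L _.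
  have [||e] := ltgtP (v L) (v K); rewrite ?addr0 ?add0r//.
  by rewrite big1 // => s sI; apply: T0.
under eq_bigr do rewrite big_split /=.
rewrite big_split /= mulr2n; congr (_ + _).
  by apply: eq_bigr => K _; rewrite -big_mkcond.
rewrite exchange_big; apply: eq_bigr => K _ /=; rewrite -big_mkcond /=.
apply: eq_bigr => L _; rewrite interfaceC; apply: eq_bigr => s sI.
by rewrite Tsym// interfaceC.
Qed.

(** Discrete integration by parts for a conservative flux. *)
Lemma pair_sum_antisymmetric v A :
  (forall K L s, s \in interface K L -> A K L s = - A L K s) ->
  pair_sum (fun K L s => A K L s * v K) =
  interface_sum v (fun K L s => A K L s * (v K - v L)).
Proof.
move=> Aanti.
have hs : pair_sum (fun K L s => A K L s * v L) = - pair_sum (fun K L s => A K L s * v K).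
  rewrite pair_sum_swap -[RHS]mulN1r -pair_sumZ; apply: eq_pair_sum => K L s sI.
  by rewrite mulN1r (Aanti _ _ _ sI) mulNr opprK.
have h : pair_sum (fun K L s => A K L s * (v K - v L)) =
    pair_sum (fun K L s => A K L s * v K) *+ 2.
  rewrite mulr2n -[X in _ = _ + X]opprK -hs -pair_sumB; apply: eq_pair_sum => K L s _.
  by rewrite mulrBr.
have e : pair_sum (fun K L s => A K L s * (v K - v L)) =
    interface_sum v (fun K L s => A K L s * (v K - v L)) *+ 2.
  apply: (@pair_sum_symmetric v (fun K L s => A K L s * (v K - v L))).
    move=> K L s sI.
    rewrite (Aanti _ _ _ sI).
    by rewrite mulNr -mulrN opprB.
  move=> K L s sI ->.
  by rewrite subrr mulr0.
by move: h; rewrite e; move: (pair_sum _) (interface_sum _ _) => x y; rewrite !mulr2n; lra.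
Qed.

End interface_sums.

Section mesh_bounds.
Context {R : realType} {l : nat}.
Variables (Omega : set 'rV[R]_l) (m : mesh R l) (alpha : R).
Hypotheses (adm : admissible_mesh Omega m) (bO : bounded_set Omega) (oO : open Omega).
Hypotheses (l0 : (0 < l)%N) (alpha0 : 0 < alpha) (reg : regular_mesh Omega m alpha).
Implicit Types (K L : cv m) (s : edge m).

Lemma edge_measure_ge0 K s : 0 <= edge_measure K s.
Proof. exact: volume_ge0. Qed.

Lemma edge_measureC K L s : s \in interface K L -> edge_measure L s = edge_measure K s.
Proof.
move=> /interfaceP[KL sK sL].
by rewrite /edge_measure (normal_opposite adm KL sK sL) hvolume_opp.
Qed.

Lemma enormN (x : 'rV[R]_l) : enorm (- x) = enorm x.
Proof. by rewrite /enorm dotvNl dotvNr opprK. Qed.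

Lemma transmissibilityC K L s : s \in interface K L ->
  transmissibility L K s = transmissibility K L s.
Proof. by move=> sI; rewrite /transmissibility (edge_measureC sI) -enormN opprB. Qed.

(** Two neighbours across the same edge would have opposite normals to each other, and
    both have the normal opposite to that of [K]. *)
Lemma interface_neighbour_unique K L L' s :
  s \in interface K L -> s \in interface K L' -> L = L'.
Proof.
move=> /interfaceP[KL sK sL] /interfaceP[KL' _ sL'].
apply/eqP; apply: contraT => LL.
have h := normal_opposite adm LL sL sL'.
rewrite (normal_opposite adm KL sK sL) (normal_opposite adm KL' sK sL') opprK in h.
have := edge_normal_unit adm sK.
have : dotv (normal K s) (normal K s) = - dotv (normal K s) (normal K s).
  by rewrite -dotvNr h.
by lra.
Qed.

Lemma sum_interface_measure_le K :
  \sum_(L : cv m) \sum_(s in interface K L) edge_measure K s <= \sum_(s in edges K) edge_measure K s.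
Proof.
under eq_bigr do rewrite big_mkcond /=.
rewrite exchange_big /= [leRHS]big_mkcond; apply: ler_sum => s _.
case: ifPn => sK; last first.
  by rewrite big1// => L _; case: ifPn => // /interfaceP[]; rewrite (negPf sK).
have [[L sI]|nL] := pselect (exists L, s \in interface K L).
  rewrite (bigD1 L)//= sI big1 ?addr0// => L' LL.
  by case: ifPn => // sI'; rewrite (interface_neighbour_unique sI sI') eqxx in LL.
rewrite big1 ?edge_measure_ge0// => L _; case: ifPn => // sI; exfalso.
by apply: nL; exists L.
Qed.

(** A nonempty open cell contains a short segment. *)
Lemma mesh_size_gt0 K : 0 < mesh_size m.
Proof.
apply: (@lt_le_trans _ _ (diam (cvset K))); last exact: le_bigmax.
have [x Kx] := cv_nonempty adm K.
pose e : 'rV[R]_l := delta_mx ord0 (Ordinal l0).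
have : \forall t \near (0 : R), cvset K (x + t *: e).
  have := @line_continuous R l x e (0 : R); apply; rewrite scale0r addr0.
  by apply: open_nbhs_nbhs; split => //; exact: cv_open adm K.
move=> /nbhs_ballP[r /= r0 hr].
have r20 : 0 < r / 2 by rewrite divr_gt0.
have Kt : cvset K (x + (r / 2) *: e).
  by apply: hr; rewrite -ball_normE /= sub0r normrN gtr0_norm//; lra.
apply: (@lt_le_trans _ _ (enorm ((x + (r / 2) *: e) - x))).
  apply: (lt_le_trans _ (normr_coord_le_enorm _ (Ordinal l0))).
  by rewrite addrAC subrr add0r !mxE !eqxx mulr1 gtr0_norm.
apply: ub_le_sup; last by exists (x + (r / 2) *: e, x).
have [M hM] := (bounded_setP _).1 (bounded_cv adm bO K).
exists (l.+1%:R * (M + M)) => _ [[y z] [/= Ky Kz] <-].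
rewrite (le_trans (enorm_le_norm _))// ler_wpM2l//.
by rewrite (le_trans (ler_normB _ _))// lerD// hM.
Qed.

Lemma total_interface_measure_le K0 :
  \sum_(K : cv m) \sum_(L : cv m) \sum_(s in interface K L) edge_measure K s <=
  volume Omega / alpha ^+ 2 / mesh_size m.
Proof.
have h0 := mesh_size_gt0 K0; set h := mesh_size m in h0 *.
have [_ reg2 reg3] := reg; rewrite -/h in reg2 reg3.
apply: (@le_trans _ _ (#|cv m|%:R * (alpha^-1 * h ^+ l.-1))).
  rewrite mulr_natl -sumr_const; apply: ler_sum => K _.
  exact: le_trans (sum_interface_measure_le K) (reg2 K).
apply: (@le_trans _ _ (volume Omega / alpha * h ^- l * (alpha^-1 * h ^+ l.-1))).
  by rewrite ler_wpM2r// mulr_ge0 ?invr_ge0 ?exprn_ge0// ltW.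
rewrite le_eqVlt; apply/orP; left; apply/eqP.
have -> : h ^+ l = h * h ^+ l.-1 by rewrite -exprS prednK.
have : h ^+ l.-1 != 0 by rewrite expf_neq0// gt_eqF.
move: (h ^+ l.-1) => y y0; field.
by rewrite y0 !gt_eqF.
Qed.

Lemma sum_cv_volume_le : \sum_(K : cv m) volume (cvset K) <= volume Omega.
Proof.
apply: sum_volume_le => //.
- exact: open_measurable_rV.
- by move=> K _; exact: (measurable_cv adm K).
- by move=> K _; exact: (cv_sub adm (K := K)).
- by move=> K L _ _ KL; exact: (cv_disjoint adm KL).
Qed.

End mesh_bounds.

(** * The energy estimate *)

Section weak_bv.
Context {R : realType} {l : nat}.
Variables (Omega : set 'rV[R]_l) (m : mesh R l).
Variables (umax uc dt M : R) (f : R -> 'rV[R]_l) (phi : R -> R) (u0 : 'rV[R]_l -> R).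
Variables (F : cv m -> edge m -> R -> R -> R) (u : nat -> cv m -> R).
Hypotheses (adm : admissible_mesh Omega m) (bO : bounded_set Omega) (oO : open Omega).
Hypotheses (umax0 : 0 < umax) (pd : problem_data umax uc f phi Omega u0).
Hypotheses (nf : numerical_flux umax M f F) (dt0 : 0 < dt).
Hypothesis sol : approximate_solution umax dt phi F u0 u.
Implicit Types (K L : cv m) (s : edge m).

Let uI n K : u n K \in `[0, umax]. Proof. exact: solution_itv sol n K. Qed.

Definition square_norm n : R := \sum_K volume (cvset K) * u n K ^+ 2.

(** The scheme tested with the new values: the convexity of the square bounds the time
    difference from below and the diffusion is dissipative. *)
Lemma energy_step n :
  dt * interface_sum (u n.+1)
    (fun K L s => F K s (u n.+1 K) (u n.+1 L) * (u n.+1 K - u n.+1 L)) <=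
  2^-1 * (square_norm n - square_norm n.+1).
Proof.
set v := u n.+1.
pose tau K L s := transmissibility K L s * (phi (v L) - phi (v K)).
have eF : pair_sum (fun K L s => F K s (v K) (v L) * v K) =
    interface_sum v (fun K L s => F K s (v K) (v L) * (v K - v L)).
  apply: (@pair_sum_antisymmetric _ _ _ v (fun K L s => F K s (v K) (v L))) => K L s sI.
  exact: (flux_conservative nf sI (uI _ _) (uI _ _)).
have et : pair_sum (fun K L s => tau K L s * v K) =
    interface_sum v (fun K L s => tau K L s * (v K - v L)).
  apply: (@pair_sum_antisymmetric _ _ _ v tau) => K L s sI.
  by rewrite /tau (transmissibilityC adm sI) -mulrN opprB.
have t0 : interface_sum v (fun K L s => tau K L s * (v K - v L)) <= 0.
  apply: sumr_le0 => K _; apply: sumr_le0 => L vv; apply: sumr_le0 => s _.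
  apply: mulr_le0_ge0; last by rewrite subr_ge0 ltW.
  apply: mulr_ge0_le0; last rewrite subr_le0.
    by rewrite divr_ge0 ?edge_measure_ge0 ?sqrtr_ge0.
  by apply: (phi_nondecreasing pd) => //; [exact: uI | exact: uI | exact: ltW].
have eK : \sum_K volume (cvset K) * ((v K - u n K) / dt) * v K +
    pair_sum (fun K L s => F K s (v K) (v L) * v K) -
    pair_sum (fun K L s => tau K L s * v K) = 0.
  rewrite -big_split -sumrB big1 //= => K _.
  have := congr1 (fun z => z * v K) (solution_scheme sol n K).
  rewrite /= mul0r mulrBl mulrDl !mulr_suml => h; rewrite -[RHS]h.
  by congr (_ + _ - _); apply: eq_bigr => L _; rewrite mulr_suml.
rewrite -eF; rewrite -et in t0.
have -> : dt * pair_sum (fun K L s => F K s (v K) (v L) * v K) =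
  dt * pair_sum (fun K L s => tau K L s * v K) -
  dt * \sum_K volume (cvset K) * ((v K - u n K) / dt) * v K.
  by move: eK; move: (pair_sum _) (pair_sum _) (\sum_K _) => x y z e; have -> : y = x - z by [lra]; ring.
have -> : dt * \sum_K volume (cvset K) * ((v K - u n K) / dt) * v K =
    \sum_K volume (cvset K) * (v K - u n K) * v K.
  rewrite mulr_sumr; apply: eq_bigr => K _; field; exact: lt0r_neq0.
have : 2^-1 * (square_norm n.+1 - square_norm n) <= \sum_K volume (cvset K) * (v K - u n K) * v K.
  rewrite /square_norm -sumrB mulr_sumr; apply: ler_sum => K _; rewrite -/v.
  have := mulr_ge0 (volume_ge0 (cvset K)) (sqr_ge0 (v K - u n K)).
  by rewrite sqrrB; lra.
have : dt * pair_sum (fun K L s => tau K L s * v K) <= 0.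
  by rewrite pmulr_rle0.
move: (pair_sum _) (\sum_K _) => x y h1 h2; lra.
Qed.

Lemma sum_energy N : \sum_(n < N) dt * interface_sum (u n.+1)
    (fun K L s => F K s (u n.+1 K) (u n.+1 L) * (u n.+1 K - u n.+1 L)) <=
  2^-1 * (umax ^+ 2 * volume Omega).
Proof.
have h k : \sum_(n < k) dt * interface_sum (u n.+1)
    (fun K L s => F K s (u n.+1 K) (u n.+1 L) * (u n.+1 K - u n.+1 L)) <=
  2^-1 * (square_norm 0 - square_norm k).
  elim: k => [|k IH]; first by rewrite big_ord0 subrr mulr0.
  rewrite big_ord_recr /=; have := energy_step k; lra.
apply: (le_trans (h N)); rewrite ler_pM2l ?invr_gt0//.
have s0 : 0 <= square_norm N.
  by apply: sumr_ge0 => K _; rewrite mulr_ge0 ?volume_ge0 ?sqr_ge0.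
suff : square_norm 0 <= umax ^+ 2 * volume Omega by lra.
apply: (@le_trans _ _ (umax ^+ 2 * \sum_K volume (cvset K))); last first.
  by apply: ler_wpM2l; [exact: sqr_ge0 | exact: (sum_cv_volume_le adm bO oO)].
rewrite mulr_sumr; apply: ler_sum => K _; rewrite mulrC ler_wpM2r ?volume_ge0//.
have := uI 0 K; rewrite in_itv /= => /andP[a b].
by rewrite lerXn2r ?nnegrE// ltW.
Qed.

(** By consistency, its derivative in [x] is [F K s x x]. *)
Definition flux_primitive (Psi : R -> 'rV[R]_l) K s (x : R) : R :=
  dotv (edge_measure K s *: normal K s) (Psi x).

(** The sum over interfaces is half a sum over ordered pairs, which splits into the
    components of the normals. *)
Lemma interface_sum_primitive_le (Psi : R -> 'rV[R]_l) (B : R) (v : cv m -> R) :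
  (forall i : 'I_l, `|\sum_(K : cv m) \sum_(L : cv m) \sum_(s in interface K L)
      edge_measure K s * normal K s ord0 i * (Psi (v K) ord0 i - Psi (v L) ord0 i)| <= B) ->
  - interface_sum v (fun K L s => flux_primitive Psi K s (v K) - flux_primitive Psi K s (v L))
    <= l%:R * B / 2.
Proof.
move=> hB.
set T := fun K L s => flux_primitive Psi K s (v K) - flux_primitive Psi K s (v L).
have eT : pair_sum T = interface_sum v T *+ 2.
  apply: (@pair_sum_symmetric _ _ _ v T) => K L s sI; last first.
    by move=> e; rewrite /T e subrr.
  have [KL sK sL] := interfaceP sI.
  rewrite /T /flux_primitive (edge_measureC adm sI) (normal_opposite adm KL sK sL).
  by rewrite scalerN !dotvNl opprK addrC.
have eS : pair_sum T = \sum_(i < l) \sum_(K : cv m) \sum_(L : cv m) \sum_(s in interface K L)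
      edge_measure K s * normal K s ord0 i * (Psi (v K) ord0 i - Psi (v L) ord0 i).
  rewrite exchange_big; apply: eq_bigr => K _; rewrite exchange_big; apply: eq_bigr => L _.
  rewrite exchange_big; apply: eq_bigr => s _; rewrite /T /flux_primitive -dotvBr.
  by apply: eq_bigr => i _; rewrite !mxE.
have : `|pair_sum T| <= l%:R * B.
  rewrite eS (le_trans (ler_norm_sum _ _ _))//.
  rewrite -[l in l%:R](card_ord l) mulr_natl -sumr_const; apply: ler_sum => i _; exact: hB.
rewrite eT mulr2n; move: (interface_sum v T) => x; rewrite ler_norml => /andP[h1 h2]; lra.
Qed.

Definition face_dissipation (Psi : R -> 'rV[R]_l) (v : cv m -> R) K L s : R :=
  dissipation (F K s) (flux_primitive Psi K s) (v L) (v K).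

Lemma interface_sum_dissipation (Psi : R -> 'rV[R]_l) (v : cv m -> R) :
  interface_sum v (face_dissipation Psi v) =
  interface_sum v (fun K L s => F K s (v K) (v L) * (v K - v L)) -
  interface_sum v (fun K L s => flux_primitive Psi K s (v K) - flux_primitive Psi K s (v L)).
Proof.
apply: (canRL (addrK _)); rewrite -interface_sumD; congr (interface_sum v _).
apply/funext => K; apply/funext => L; apply/funext => s.
by rewrite /face_dissipation /dissipation subrK.
Qed.

Section one_interface.
Variable Psi : R -> 'rV[R]_l.
Hypothesis PP : forall n : 'rV[R]_l,
  is_primitive umax (fun x => dotv n (Psi x)) (fun x => dotv n (f x)).
Variables (K : cv m) (s : edge m).
Hypothesis sK : s \in edges K.

Let g (a : R) := dotv (edge_measure K s *: normal K s) (f a).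

Let F_incr : {in `[0, umax] & &, forall a a' b, a <= a' -> F K s a b <= F K s a' b}.
Proof. exact: (flux_nondecreasing nf sK). Qed.

Let F_decr : {in `[0, umax] & &, forall a b b', b <= b' -> F K s a b' <= F K s a b}.
Proof. exact: (flux_nonincreasing nf sK). Qed.

Let F_lip a b a' b' : a \in `[0, umax] -> b \in `[0, umax] -> a' \in `[0, umax] ->
  b' \in `[0, umax] ->
  `|F K s a b - F K s a' b'| <= edge_measure K s * `|M| * (`|a - a'| + `|b - b'|).
Proof.
move=> aI bI a'I b'I; apply: (le_trans (flux_lipschitz nf sK aI bI a'I b'I)).
by rewrite ler_wpM2r ?addr_ge0// ler_wpM2l ?edge_measure_ge0// ler_norm.
Qed.

Let F_diag : {in `[0, umax], forall a, F K s a a = g a}.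
Proof.
by move=> a aI; rewrite (flux_consistent nf sK aI) /g dotvZl (dotvC (normal K s)).
Qed.

Lemma face_max_between_le (a b lam : R) (H : R -> R -> R) : 0 < lam ->
  0 <= a -> a <= b -> b <= umax ->
  (forall c d, H c d = F K s d c - F K s d d) \/ (forall c d, H c d = F K s d c - F K s c c) ->
  max_between a b H <= lam * `|M| * edge_measure K s +
    lam^-1 * dissipation (F K s) (flux_primitive Psi K s) a b.
Proof.
move=> lam0 a0 ab bu HE.
have L0 : 0 <= edge_measure K s * `|M| by rewrite mulr_ge0 ?edge_measure_ge0.
have := max_between_le F_incr F_decr F_lip F_diag (PP _) L0 lam0 a0 ab bu HE.
by rewrite (mulrC (edge_measure K s)) mulrA (mulrC lam^-1).
Qed.

End one_interface.

Lemma interface_sum_max_between_le (Psi : R -> 'rV[R]_l) (v : cv m -> R) (lam : R)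
    (H : cv m -> edge m -> R -> R -> R) :
  (forall n : 'rV[R]_l, is_primitive umax (fun x => dotv n (Psi x)) (fun x => dotv n (f x))) ->
  (forall K, v K \in `[0, umax]) -> 0 < lam ->
  (forall K s c d, H K s c d = F K s d c - F K s d d) \/
  (forall K s c d, H K s c d = F K s d c - F K s c c) ->
  interface_sum v (fun K L s => max_between (v L) (v K) (H K s)) <=
  lam * `|M| * \sum_(K : cv m) \sum_(L : cv m) \sum_(s in interface K L) edge_measure K s +
  lam^-1 * interface_sum v (face_dissipation Psi v).
Proof.
move=> PP vI lam0 HE.
apply: (@le_trans _ _ (interface_sum v (fun K L s => lam * `|M| * edge_measure K s +
    lam^-1 * face_dissipation Psi v K L s))).
  apply: interface_sum_le => K L s vv /interfaceP[_ sK _].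
  have := vI K; have := vI L; rewrite !in_itv /= => /andP[L0 _] /andP[_ Ku].
  apply: (face_max_between_le PP sK lam0 L0 (ltW vv) Ku).
  by case: HE => h; [left|right] => c d; rewrite h.
rewrite interface_sumD !interface_sumZ lerD2r ler_wpM2l ?mulr_ge0 ?(ltW lam0)//.
apply: ler_sum => K _; rewrite big_mkcond; apply: ler_sum => L _.
case: ifP => // _; apply: sumr_ge0 => s _; exact: edge_measure_ge0.
Qed.

End weak_bv.

(** * The estimate of the flux gaps *)

(** There are [N + 1] steps, of total length less than [T + dt]. *)
Lemma step_count (R : realType) (T dt : R) (N : nat) : 0 < dt -> dt <= T ->
  N%:R < T / dt -> \sum_(n < N.+1) dt <= 2 * T.
Proof.
move=> dt0 dtT; rewrite ltr_pdivlMr// => h.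
by rewrite sumr_const card_ord -mulr_natl -natr1; lra.
Qed.

Unset Implicit Arguments.

Theorem lemma4p3 (R : realType) (l : nat) (Omega : set 'rV[R]_l)
    (alpha M : R) :
  (0 < l)%N -> open Omega -> bounded_set Omega -> lipschitz_boundary Omega ->
  0 < alpha ->
  exists C : R -> R -> R -> R -> R,
    (forall a b c d, 0 <= C a b c d) /\
    forall (umax uc T dt : R) (f : R -> 'rV[R]_l) (phi : R -> R)
      (u0 : 'rV[R]_l -> R) (m : mesh R l) (F : cv m -> edge m -> R -> R -> R)
      (u : nat -> cv m -> R) (N : nat),
    0 < umax -> problem_data umax uc f phi Omega u0 ->
    admissible_mesh Omega m -> regular_mesh Omega m alpha ->
    numerical_flux umax M f F ->
    0 < T -> 0 < dt -> dt <= T ->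
    approximate_solution umax dt phi F u0 u ->
    N%:R < T / dt -> (forall n : nat, n%:R < T / dt -> (n <= N)%N) ->
    \sum_(n < N.+1) dt * interface_sum (u n.+1) (fun K L s =>
        max_between (u n.+1 L) (u n.+1 K) (fun c d => F K s d c - F K s d d))
    + \sum_(n < N.+1) dt * interface_sum (u n.+1) (fun K L s =>
        max_between (u n.+1 L) (u n.+1 K) (fun c d => F K s d c - F K s c c))
    <= C (sup_norm umax f) umax T (volume Omega) / Num.sqrt (mesh_size m).
Proof.
move=> l0 oO bO lip alpha0.
have [c0 c00 flux_sum] := lipschitz_normal_flux_sum_le oO bO lip.
pose A (T V : R) := 2 * T * (`|M| * (V / alpha ^+ 2)).
pose E (S U T V : R) := 2^-1 * (U ^+ 2 * V) + 2 * T * (l%:R * (4 * (S * U) * c0) / 2).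
(* The absolute value makes C nonnegative at arguments that do not occur. *)
exists (fun S U T V => `|2 * (A T V + E S U T V)|); split => [*|]; first exact: normr_ge0.
move=> umax uc T dt f phi u0 m F u N umax0 pd adm reg nf T0 dt0 dtT sol NT _.
set h := mesh_size m; set S := sup_norm umax f; set V := volume Omega.
(* Without cells the mesh size is 0, and so is the right-hand side. *)
have [K0|nK] := pselect (exists K : cv m, True); last first.
  have is0 v T' : @interface_sum R l m v T' = 0.
    by rewrite /interface_sum big1// => K _; exfalso; apply: nK; exists K.
  rewrite !big1 ?addr0 ?divr_ge0 ?sqrtr_ge0// => n _; by rewrite is0 mulr0.
have {K0}[K0 _] := K0.
have h0 : 0 < h by exact: (mesh_size_gt0 adm bO l0 K0).
(* This weight balances lam / h, from the measures of the interfaces, and 1 / lam. *)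
set lam := Num.sqrt h; have lam0 : 0 < lam by rewrite sqrtr_gt0.
have lam2 : lam ^+ 2 = h by rewrite sqr_sqrtr// ltW.
have [Psi [Psi0 PP]] := exists_primitive umax0 (f_continuous pd).
have uI n K : u n K \in `[0, umax] by exact: solution_itv sol n K.
have S0 : 0 <= S.
  apply: le_trans (@enorm_le_sup_norm _ _ _ _ umax0 (f_continuous pd) 0 _).
    exact: sqrtr_ge0.
  by rewrite in_itv /= lexx ltW.
have W0 : 0 <= S * umax by rewrite mulr_ge0// ltW.
have B0 n : - interface_sum (u n.+1) (fun K L s =>
     flux_primitive Psi K s (u n.+1 K) - flux_primitive Psi K s (u n.+1 L)) <=
     l%:R * (4 * (S * umax) * c0) / 2.
  apply: (interface_sum_primitive_le adm) => i.
  apply: (flux_sum m (fun K => Psi (u n.+1 K) ord0 i)) => // K.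
  by rewrite /=; apply: (primitive_bound umax0 (f_continuous pd)) => //; exact: uI.
have sdt := step_count dt0 dtT NT.
have EE : \sum_(n < N.+1) dt * interface_sum (u n.+1) (face_dissipation F Psi (u n.+1)) <=
    E S umax T V.
  have b0 : 0 <= l%:R * (4 * (S * umax) * c0) / 2 by rewrite divr_ge0// mulr_ge0 // mulr_ge0 // mulr_ge0.
  apply: (@le_trans _ _ (2^-1 * (umax ^+ 2 * V) +
      \sum_(n < N.+1) dt * (l%:R * (4 * (S * umax) * c0) / 2))); last first.
    by rewrite /E lerD2l -mulr_suml ler_wpM2r.
  apply: le_trans (lerD (sum_energy adm bO oO umax0 pd nf dt0 sol N.+1) (lexx _)).
  rewrite -big_split; apply: ler_sum => n _ /=.
  by rewrite interface_sum_dissipation -mulrDr ler_pM2l// lerD2l; exact: B0.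
have key (H : cv m -> edge m -> R -> R -> R) :
    (forall K s c d, H K s c d = F K s d c - F K s d d) \/
    (forall K s c d, H K s c d = F K s d c - F K s c c) ->
    \sum_(n < N.+1) dt * interface_sum (u n.+1) (fun K L s =>
      max_between (u n.+1 L) (u n.+1 K) (H K s)) <= (A T V + E S umax T V) / lam.
  move=> HE.
  have Mh : lam * `|M| * \sum_(K : cv m) \sum_(L : cv m) \sum_(s in interface K L) edge_measure K s
      <= `|M| * (V / alpha ^+ 2) / lam.
    apply: (@le_trans _ _ (lam * `|M| * (V / alpha ^+ 2 / h))).
      rewrite ler_wpM2l ?mulr_ge0 ?(ltW lam0)//.
      exact: (total_interface_measure_le adm bO l0 alpha0 reg K0).
    rewrite -lam2 le_eqVlt; apply/orP; left; apply/eqP; field.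
    by rewrite !gt_eqF.
  have P0 : 0 <= `|M| * (V / alpha ^+ 2) / lam.
    by rewrite divr_ge0 ?(ltW lam0)// mulr_ge0// divr_ge0 ?volume_ge0// exprn_ge0// ltW.
  apply: (@le_trans _ _ (\sum_(n < N.+1) (dt * (`|M| * (V / alpha ^+ 2) / lam) +
     lam^-1 * (dt * interface_sum (u n.+1) (face_dissipation F Psi (u n.+1)))))).
    apply: ler_sum => n _; rewrite [lam^-1 * _]mulrCA -mulrDr ler_pM2l//.
    apply: (le_trans (interface_sum_max_between_le nf PP (uI n.+1) lam0 HE)).
    by rewrite lerD2r.
  rewrite big_split /= -mulr_suml -mulr_sumr [leRHS]mulrDl lerD//.
    by rewrite /A -[leRHS]mulrA ler_wpM2r.
  by rewrite mulrC ler_pM2r// invr_gt0.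
have k1 := key (fun K s c d => F K s d c - F K s d d) (or_introl (fun _ _ _ _ => erefl)).
have k2 := key (fun K s c d => F K s d c - F K s c c) (or_intror (fun _ _ _ _ => erefl)).
apply: (le_trans (lerD k1 k2)).
rewrite -mulrDl ler_pM2r ?invr_gt0// (le_trans _ (ler_norm _))//.
by rewrite mulr2n mulrDl mul1r.
Qed.
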